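(* Let $S>0$, $H\in[1/2,1)$ and $c\in(0,S^H]$. Then $$\max\left(\mathbf E\,\mathrm{UTV}^c(W^H,S)+c,\ S^H\right)\sim\mathbf E\,\mathrm{UTV}^c(W^H,S),$$ and for $u\ge\max\left(\mathbf E\,\mathrm{UTV}^c(W^H,S)+c,\ S^H\right)$ the upper estimate $$\mathbf P\left(\left|\mathrm{UTV}^c(W^H,S)-\mathbf E\,\mathrm{UTV}^c(W^H,S)\right|>u\right)\le\hat A\exp\left(-\hat B\,S^{-2H}u^2\right)$$ (which holds for every $u>0$ with universal positive constants $\hat A\le2$ and $\hat B\ge2/\pi^2$) is optimal in the sense that there exists a universal positive constant $T$ such that for every $u\ge\max\left(\mathbf E\,\mathrm{UTV}^c(W^H,S)+c,\ S^H\right)$, $$\mathbf P\left(\left|\mathrm{UTV}^c(W^H,S)-\mathbf E\,\mathrm{UTV}^c(W^H,S)\right|>u\right)\ge\frac12\exp\left(-T\,S^{-2H}u^2\right).$$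
   Context: $W^H=(W^H_t)_{t\ge0}$ is a fractional Brownian motion with Hurst index $H\in(0,1)$, i.e. a centered Gaussian process with (a.s.) continuous trajectories and $\mathbf E(W^H_sW^H_t)=\frac12\{|s|^{2H}+|t|^{2H}-|t-s|^{2H}\}$ for $s,t\ge0$. For a path $f:[0,+\infty)\to\mathbb R$ that is right-continuous with left limits, $c\ge0$ and $0\le s<t$, the upward truncated variation is $$\mathrm{UTV}^c(f,[s,t])=\sup_{n\ge1}\ \sup_{s\le s_1<t_1<s_2<t_2<\dots<s_n<t_n\le t}\ \sum_{i=1}^n\left(f(t_i)-f(s_i)-c\right)_+,\qquad (x)_+=\max(x,0),$$ and $\mathrm{UTV}^c(f,S):=\mathrm{UTV}^c(f,[0,S])$ for $S>0$. For positive quantities $a,b$ depending on one or more parameters, $a\sim b$ means that there exists a universal positive constant $C$ such that $C^{-1}a\le b\le Ca$. A constant is universal if it does not depend on any of the parameters ($H$, $S$, $c$, $u$). *)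

(* Defs.v *)
From HB Require Import structures.
From mathcomp Require Import all_boot all_order all_algebra.
From mathcomp Require Import all_classical all_reals all_analysis.
Set Implicit Arguments.
Unset Strict Implicit.
Unset Printing Implicit Defensive.
Import Order.TTheory GRing.Theory Num.Theory.
Import numFieldTopology.Exports numFieldNormedType.Exports.
Local Open Scope classical_set_scope.
Local Open Scope ring_scope.

(* Degenerate Gaussian variables are allowed. The case s = 0 is kept apart
   because normal_prob m 0 is by convention the uniform law on [0, 1], not the
   Dirac mass at m. The parameter s is the standard deviation. *)
Definition gaussian_rv (R : realType) (d : measure_display)
    (Omega : measurableType d) (P : probability Omega R) (X : Omega -> R)
    : Prop :=
  measurable_fun [set: Omega] X /\
  exists m s : R, forall A : set R, measurable A ->
    P (X @^-1` A) = (if s == 0 then \d_m A else normal_prob m s A).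

(* Only the variables W t with 0 <= t are constrained. *)
Record is_fBm (R : realType) (d : measure_display) (Omega : measurableType d)
    (P : probability Omega R) (H : R) (W : R -> Omega -> R) : Prop := IsFBm {
  fBm_gaussian : forall (n : nat) (t a : 'I_n -> R), (forall i, 0 <= t i) ->
    gaussian_rv P (fun w => \sum_(i < n) a i * W (t i) w) ;
  fBm_centered : forall t : R, 0 <= t -> ('E_P[W t] = 0)%E ;
  fBm_covariance : forall s t : R, 0 <= s -> 0 <= t ->
    ('E_P[(fun w => (W s w * W t w)%R)] =
     (2^-1 * (`|s| `^ (2 * H) + `|t| `^ (2 * H) - `|t - s| `^ (2 * H)))%:E)%E ;
  fBm_continuous : {ae P, forall w,
    {within `[0, +oo[, continuous (fun t => W t w)}}
}.

(* a 0 < b 0 < a 1 < b 1 < ... < a n < b n in [s, t]; the values of a and b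
   beyond n are irrelevant. There are n.+1 >= 1 pairs. *)
Definition interlaced (R : realType) (s t : R) (n : nat) (a b : nat -> R)
    : Prop :=
  [/\ s <= a 0%N,
      forall i, (i <= n)%N -> a i < b i,
      forall i, (i < n)%N -> b i < a i.+1
    & b n <= t].

(* The supremum is taken in the extended reals, so that it makes sense for
   every function f; it only depends on the restriction of f to [s, t]. *)
Definition UTV (R : realType) (c : R) (f : R -> R) (s t : R) : \bar R :=
  ereal_sup [set x : \bar R | exists (n : nat) (a b : nat -> R),
    interlaced s t n a b /\
    x = (\sum_(i < n.+1) Num.max (f (b i) - f (a i) - c) 0)%:E].

(* a ~ b with constant C. The relation is meant for positive real quantities,
   hence finiteness and positivity are part of it. *)
Definition sim_with (R : realType) (C : R) (a b : \bar R) : Prop :=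
  [/\ a \is a fin_num, b \is a fin_num, (0 < a)%E, (0 < b)%E
    & ((C^-1)%:E * a <= b <= C%:E * a)%E].

(* Probability of an event for the completion of P. As trajectories are only
   almost surely continuous, the events considered differ from measurable sets
   by P-negligible sets, and P carries no information outside of its
   sigma-algebra. The outer measure mu_ext P is the completion of P on such
   sets and agrees with P on measurable sets (measurable_mu_extE). Likewise
   \int[P]_w X w is the integral with respect to the completion for a
   nonnegative X almost everywhere equal to a measurable function. *)
Definition prob (R : realType) (d : measure_display)
    (Omega : measurableType d) (P : probability Omega R) (E : set Omega)
    : \bar R := mu_ext P E.

(* Main.v *)
(** For c > 0 the variable U = UTV^c(W, S) is, up to a null set, the supremum of
    countably many affine functionals X_k + b_k of W, where X_k is a sum of
    increments of W over disjoint intervals of [0, S] with rational endpoints.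
    As H >= 1/2, disjoint increments are nonnegatively correlated, so that
    E X_k^2 <= E (W_S - W_0)^2 = S^{2H} =: s^2.

    Let F be the maximum of finitely many X_k + b_k and X' an independent copy
    of X. The path t -> sin t X + cos t X' joins X' to X, and at each t the pair
    (X_t, X_t') is distributed as (X, X'). The increment of F along a small step
    is at most that of the coordinate attaining the maximum at the end of the
    step, whose derivative is independent of this end; by convexity of exp
    (Maurey and Pisier), E exp(l (F(X) - F(X'))) <= exp(l^2 pi^2 s^2 / 8).
    A smooth F is not needed: independence is only used between one coordinate
    and the index of the maximum, and follows from the characteristic function.
    In the product form E exp(l F) E exp(-l F) <= exp(l^2 pi^2 s^2 / 8) the
    bound passes to the supremum U, which is finite by continuity of the paths.
    Hence U is integrable, and Jensen's and Chernoff's inequalities give the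
    upper estimate.

    For the lower estimates, U >= W_S - W_0 - c, and W_S - W_0 is Gaussian of
    variance S^{2H}. *)
Require Import Defs.
From HB Require Import structures.
From mathcomp Require Import all_boot all_order all_algebra.
From mathcomp Require Import all_classical all_reals all_analysis.
From mathcomp Require Import measurable_realfun ring lra.
Import Order.TTheory GRing.Theory Num.Theory.
Import numFieldTopology.Exports numFieldNormedType.Exports.
Local Open Scope classical_set_scope.
Local Open Scope ring_scope.
Set Implicit Arguments.
Unset Strict Implicit.
Unset Printing Implicit Defensive.

(** * Gaussian variables *)

(** The hypothesis on [W] only gives the laws of single linear combinations, so that no joint
    density is at hand. A Gaussian vector and its copy are therefore described by the laws of their
    linear forms, a description that rotations preserve. Independence has to be used against an
    unbounded exponential, on the event that a given coordinate is the maximum. An integrable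
    function whose integrals against all cosines of a variable vanish is shown to integrate to 0
    against polynomials in sines, signs, half-line indicators and exponentials of this variable as
    well; since products of cosines are sums of cosines, this iterates over finitely many
    half-spaces. A rotation in m steps leaves a remainder depending on the number of coordinates. It
    vanishes as m grows, the vector being fixed, and the dimension-free constant (pi/2)^2 / 2 = pi^2
    / 8 remains, pi/2 being the length of the quarter circle. The product form avoids any prior
    integrability of U: as U is almost surely finite, E exp(-l U) is positive, and dividing by it
    bounds E exp(l U). *)

Section NormalLaw.
Context {R : realType}.
Local Notation mu := (@lebesgue_measure R).

Lemma ge0_integral_normal_prob (m s : R) (f : R -> \bar R) :
  measurable_fun [set: R] f -> (forall x, 0 <= f x)%E ->
  (\int[normal_prob m s]_x f x =
   \int[mu]_x (f x * (normal_pdf m s x)%:E))%E.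
Proof.
move=> mf f0.
rewrite -(Radon_Nikodym_SigmaFinite.change_of_variables
            (normal_prob_dominates m s))//.
apply: ae_eq_integral => //.
- apply: emeasurable_funM => //; apply: (measurable_int mu).
  exact: (Radon_Nikodym_SigmaFinite.f_integrable (normal_prob_dominates m s)).
- apply: emeasurable_funM => //; apply/measurableT_comp => //.
  exact: measurable_normal_pdf.
- apply: ae_eqe_mul2l => /=.
  apply: integral_ae_eq => //=.
  + exact: (Radon_Nikodym_SigmaFinite.f_integrable (normal_prob_dominates m s)).
  + by apply/measurableT_comp => //; exact: measurable_normal_pdf.
  + move=> E _ mE.
    by rewrite -(Radon_Nikodym_SigmaFinite.f_integral (normal_prob_dominates m s)).
Qed.

(** Completing the square: an exponential weight moves the mean by [t * s ^+ 2]. The exponential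
    moments, Stein's identity and the characteristic function below all come from this identity. *)
Lemma normal_pdf_tilt (m s t x : R) : s != 0 ->
  expR (t * x) * normal_pdf m s x =
  expR (m * t + t ^+ 2 * s ^+ 2 / 2) * normal_pdf (m + t * s ^+ 2) s x.
Proof.
move=> s0; rewrite !normal_pdfE// mulrCA [RHS]mulrCA; congr (_ * _).
rewrite /normal_fun -!expRD; congr expR.
by rewrite -[s ^+ 2 *+ 2]mulr_natr; field.
Qed.

Lemma normal_pdf_shift (m s x : R) : s != 0 ->
  normal_pdf m s (x + m) = normal_pdf 0 s x.
Proof. by move=> s0; rewrite !normal_pdfE// /normal_fun addrK subr0. Qed.

Lemma continuous_shift_integral (c : R) (G : R -> R) :
  continuous G -> (forall x, 0 <= G x) ->
  (\int[mu]_x (G x)%:E = \int[mu]_x (G (x + c))%:E)%E.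
Proof.
move=> cG G0.
have dE (x : R) : is_derive x 1 (fun x : R => x + c) 1.
  by apply: is_derive_eq; rewrite addr0.
have d1E : (fun x : R => x + c)^`()%classic = cst 1.
  by apply/funext => x; rewrite derive1E; apply: derive_val.
rewrite (@increasing_ge0_integration_by_substitutionT _ (fun x => x + c) G)//.
- by rewrite d1E; apply: eq_integral => x _; rewrite !fctE mulr1.
- by move=> x y; rewrite ltrD2r.
- by rewrite d1E => x; exact: cvg_cst.
- by rewrite d1E; exact: is_cvg_cst.
- by rewrite d1E; exact: is_cvg_cst.
- exact: cvg_addrr_Ny.
- exact: cvg_addrr.
Qed.

End NormalLaw.

Section GaussianVariable.
Context {R : realType} {d : measure_display} {Omega : measurableType d}.
Variable P : probability Omega R.
Local Notation mu := (@lebesgue_measure R).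
Variables (Z : Omega -> R) (m s : R).
Hypothesis mZ : measurable_fun [set: Omega] Z.
Hypothesis lawZ : forall A : set R, measurable A ->
    P (Z @^-1` A) = (if s == 0 then \d_m A else normal_prob m s A).

Let Z' : {mfun Omega >-> measurableTypeR R} :=
  HB.pack Z (isMeasurableFun.Build _ _ _ (measurableTypeR R) Z mZ).

Lemma ge0_integral_gaussian (f : R -> \bar R) : s != 0 ->
  measurable_fun [set: R] f -> (forall x, 0 <= f x)%E ->
  (\int[P]_w f (Z w) = \int[mu]_x (f x * (normal_pdf m s x)%:E))%E.
Proof.
move=> s0 mf f0; rewrite -ge0_integral_normal_prob//.
rewrite -(@ge0_integral_distribution _ _ _ _ _ P Z')//.
apply: (@eq_measure_integral _ _ _ _ (normal_prob m s)) => A mA _.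
by have := lawZ mA; rewrite (negbTE s0).
Qed.

Lemma ge0_integral_degenerate_gaussian (f : R -> \bar R) : s = 0 ->
  measurable_fun [set: R] f -> (forall x, 0 <= f x)%E ->
  (\int[P]_w f (Z w) = f m)%E.
Proof.
move=> s0 mf f0.
rewrite -(@ge0_integral_distribution _ _ _ _ _ P Z')//.
pose m' : measurableTypeR R := m.
rewrite (@eq_measure_integral _ _ _ _ (\d_m')).
  by rewrite integral_dirac// diracT mul1e.
by move=> A mA _; have := lawZ mA; rewrite s0 eqxx.
Qed.

Lemma gaussian_mgf (t : R) :
  (\int[P]_w (expR (t * Z w))%:E = (expR (m * t + t ^+ 2 * s ^+ 2 / 2))%:E)%E.
Proof.
have mf : measurable_fun [set: R] (fun x => (expR (t * x))%:E).
  by apply/measurable_EFinP; apply: measurableT_comp.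
have f0 x : (0 <= (expR (t * x))%:E)%E by rewrite lee_fin expR_ge0.
have [s0|s0] := eqVneq s 0.
  rewrite (ge0_integral_degenerate_gaussian s0 mf f0) s0 expr0n mulr0 mul0r addr0.
  by rewrite mulrC.
rewrite (ge0_integral_gaussian s0 mf f0).
under eq_integral do rewrite -EFinM normal_pdf_tilt// EFinM.
rewrite ge0_integralZl//.
- by rewrite integral_normal_pdf mule1.
- by apply/measurable_EFinP; exact: measurable_normal_pdf.
- by move=> x _; rewrite lee_fin normal_pdf_ge0.
Qed.

End GaussianVariable.

(** * Elementary inequalities for sine, cosine and exponential *)

Section RealInequalities.
Context {R : realType}.
Implicit Types x y : R.

Lemma ge0_derive_le (f df : R -> R) x : 0 <= x ->
  (forall y, is_derive y 1 f (df y)) -> (forall y, 0 <= y -> 0 <= df y) ->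
  f 0 <= f x.
Proof.
move=> x0 fdf df0.
have cf : {within `[0, x], continuous f}.
  apply: continuous_subspaceT => y.
  exact/differentiable_continuous/derivable1_diffP.
have [c /[!in_itv]/= /andP[c0 _] fE] := MVT_segment x0 (fun y _ => fdf y) cf.
by rewrite -subr_ge0 fE subr0 mulr_ge0// df0.
Qed.

Lemma ler_sin x : 0 <= x -> sin x <= x.
Proof.
move=> x0; have df (y : R) : is_derive y 1 (fun y => y - sin y) (1 - cos y).
  exact: is_deriveB.
rewrite -subr_ge0; have := ge0_derive_le x0 df; rewrite sin0 subrr; apply => y _.
by rewrite subr_ge0 cos_le1.
Qed.

Lemma ler_1subcos x : 1 - cos x <= x ^+ 2 / 2.
Proof.
wlog x0 : x / 0 <= x => [hw|].
  have [/hw//|/ltW x0] := leP 0 x.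
  by rewrite -cosN -sqrrN; apply: hw; rewrite oppr_ge0.
have df (y : R) :
    is_derive y 1 (fun y => y ^+ 2 * 2^-1 - (1 - cos y)) (y - sin y).
  by apply: is_derive_eq; rewrite /GRing.scale/=; lra.
rewrite -subr_ge0; have := ge0_derive_le x0 df.
rewrite cos0 expr0n mul0r !subrr; apply => y y0.
by rewrite subr_ge0 ler_sin.
Qed.

Lemma ler_sinh x : 0 <= x -> 2 * x <= expR x - expR (- x).
Proof.
move=> x0.
have df (y : R) : is_derive y 1 (fun y => expR y - expR (- y) - 2 * y)
    (expR y + expR (- y) - 2).
  by apply: is_derive_eq; rewrite /GRing.scale/=; lra.
rewrite -subr_ge0; have := ge0_derive_le x0 df.
rewrite oppr0 expR0 mulr0 !subrr; apply => z _.
have -> : expR z + expR (- z) - 2 = (expR (z / 2) - expR (- (z / 2))) ^+ 2.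
  have ez : expR z = expR (z / 2) ^+ 2 by rewrite -expRM_natl; congr expR; field.
  have eN : expR (- z) = expR (- (z / 2)) ^+ 2.
    by rewrite -expRM_natl; congr expR; field.
  have e1 : expR (z / 2) * expR (- (z / 2)) = 1 by rewrite expRxMexpNx_1.
  by rewrite ez eN; ring: e1.
exact: sqr_ge0.
Qed.

Lemma sqr_expRDN x : 2 + x ^+ 2 <= expR x + expR (- x).
Proof.
wlog x0 : x / 0 <= x => [hw|].
  have [/hw//|/ltW x0] := leP 0 x.
  by have := hw (- x); rewrite opprK sqrrN oppr_ge0 => /(_ x0); lra.
have df (y : R) : is_derive y 1 (fun y => expR y + expR (- y) - (2 + y ^+ 2))
    (expR y - expR (- y) - 2 * y).
  by apply: is_derive_eq; rewrite /GRing.scale/=; lra.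
rewrite -subr_ge0; have := ge0_derive_le x0 df.
rewrite oppr0 expR0 expr0n addr0 !subrr; apply => z z0.
by rewrite subr_ge0 ler_sinh.
Qed.

Lemma ler_normr_expRDN x : `|x| <= expR x + expR (- x).
Proof.
have [x0|x0] := ger0P x.
  by have := expR_ge1Dx x; have := expR_ge0 (- x); lra.
by have := expR_ge1Dx (- x); have := expR_ge0 x; lra.
Qed.

Lemma ler_norm_sin x : `|sin x| <= `|x|.
Proof.
wlog x0 : x / 0 <= x => [hw|].
  have [/hw//|/ltW x0] := leP 0 x.
  by rewrite -normrN -sinN -[leRHS]normrN; apply: hw; rewrite oppr_ge0.
rewrite [leRHS]ger0_norm// ler_norml ler_sin// andbT -subr_ge0 opprK.
have df (y : R) : is_derive y 1 (fun y => sin y + y) (cos y + 1).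
  exact: is_deriveD.
have := ge0_derive_le x0 df; rewrite sin0 addr0; apply => y _.
by rewrite -lerBlDr sub0r cos_geN1.
Qed.

Lemma ler_subsin x : 0 <= x -> x - sin x <= x ^+ 3 / 6.
Proof.
move=> x0.
have df (y : R) : is_derive y 1 (fun y => y ^+ 3 * 6^-1 - (y - sin y))
    (y ^+ 2 / 2 - (1 - cos y)).
  by apply: is_derive_eq; rewrite /GRing.scale/=; lra.
rewrite -subr_ge0; have := ge0_derive_le x0 df.
rewrite sin0 expr0n mul0r !subrr; apply => y _.
by rewrite subr_ge0 ler_1subcos.
Qed.

(** At low frequency the bounded sine recovers the identity; [rho_expR] reaches exponentials of an
    unbounded variable in this way. For x >= 0 the error is at most x^3 / (6 (n + 1)). *)
Lemma cvg_mul_sin_inv x : n.+1%:R * sin (n.+1%:R^-1 * x) @[n --> \oo] --> x.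
Proof.
have pos (y : R) : 0 <= y -> n.+1%:R * sin (n.+1%:R^-1 * y) @[n --> \oo] --> y.
  move=> y0.
  have h : \forall n \near \oo, y - n.+1%:R^-1 * (y ^+ 3 / 6) <=
      n.+1%:R * sin (n.+1%:R^-1 * y) <= (fun=> y) n.
    apply: nearW => n; have n0 : 0 < n.+1%:R :> R by rewrite ltr0n.
    have z0 : 0 <= n.+1%:R^-1 * y by rewrite mulr_ge0// invr_ge0.
    have n1 : n.+1%:R^-1 <= 1 :> R by rewrite invf_le1// ler1n.
    have l1 := ler_sin z0; have l2 := ler_subsin z0.
    apply/andP; split; last first.
      by rewrite -[leRHS](mulVKf (lt0r_neq0 n0)) ler_pM2l.
    set m := n.+1%:R in n0 z0 n1 l1 l2 *.
    rewrite lerBlDr -lerBlDl.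
    have -> : y - m * sin (m^-1 * y) = m * (m^-1 * y - sin (m^-1 * y)).
      by field; rewrite gt_eqF.
    rewrite (le_trans (ler_wpM2l (ltW n0) l2))//.
    have -> : m * ((m^-1 * y) ^+ 3 / 6) = m^-1 * (m^-1 * (y ^+ 3 / 6)).
      by field; rewrite gt_eqF.
    rewrite ler_wpM2l ?invr_ge0 ?(ltW n0)// ler_piMl// divr_ge0// exprn_ge0//.
  apply: (squeeze_cvgr h); last exact: cvg_cst.
  rewrite -[X in _ --> X]subr0; apply: cvgB; first exact: cvg_cst.
  rewrite -[X in _ --> X](mul0r (y ^+ 3 / 6)); apply: cvgM; last exact: cvg_cst.
  exact: cvg_harmonic.
have [x0|x0] := leP 0 x; first exact: pos.
rewrite (_ : (fun n => _) = (fun n : nat => - (n.+1%:R * sin (n.+1%:R^-1 * - x)))).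
  2: by apply/funext => n; rewrite mulrN sinN mulrN opprK.
rewrite -[X in _ --> X]opprK; apply: cvgN; apply: pos.
by rewrite oppr_ge0 ltW.
Qed.

End RealInequalities.

(** * Integrable real functions on a probability space *)

Section Integrability.
Context {R : realType} {d : measure_display} {T : measurableType d}.
Variable P : probability T R.
Implicit Types f g : T -> R.

Lemma le_integrable_EFin f g : measurable_fun [set: T] f ->
  (forall x, `|f x| <= g x) ->
  P.-integrable [set: T] (EFin \o g) -> P.-integrable [set: T] (EFin \o f).
Proof.
move=> mf fg; apply: le_integrable => //; first exact/measurable_EFinP.
move=> x _ /=; rewrite lee_fin (le_trans (fg x))// ler_norm//.
Qed.

Lemma bounded_integrable_EFin f (M : R) : measurable_fun [set: T] f ->
  (forall x, `|f x| <= M) -> P.-integrable [set: T] (EFin \o f).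
Proof.
move=> mf fM; apply: (@le_integrable_EFin _ (cst M)) => //.
exact: finite_measure_integrable_cst.
Qed.

Lemma ge0_integrable_EFin f (c : R) : measurable_fun [set: T] f ->
  (forall x, 0 <= f x) -> (\int[P]_x (f x)%:E = c%:E)%E ->
  P.-integrable [set: T] (EFin \o f).
Proof.
move=> mf f0 fc; apply/integrableP; split; first exact/measurable_EFinP.
under eq_integral do rewrite /= ger0_norm//.
by rewrite fc ltry.
Qed.

Lemma Rintegral_EFin f : P.-integrable [set: T] (EFin \o f) ->
  (\int[P]_x (f x)%:E = (\int[P]_x f x)%R%:E)%E.
Proof. by move=> fi; rewrite /Rintegral fineK//; exact: integrable_fin_num. Qed.

Lemma RintegralE f (c : R) : (\int[P]_x (f x)%:E = c%:E)%E -> \int[P]_x f x = c.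
Proof. by rewrite /Rintegral => ->. Qed.

Lemma Rintegral_prob_cst (c : R) : \int[P]_x c = c.
Proof.
rewrite Rintegral_cst //.
have -> : fine (P setT) = 1 by rewrite probability_setT.
by rewrite mulr1.
Qed.

Lemma integrable_EFin_cst (c : R) : P.-integrable [set: T] (EFin \o (fun=> c)).
Proof. exact: finite_measure_integrable_cst. Qed.

Lemma integrable_EFinD f g : P.-integrable [set: T] (EFin \o f) ->
  P.-integrable [set: T] (EFin \o g) ->
  P.-integrable [set: T] (EFin \o (fun x => f x + g x)).
Proof. by move=> fi gi; exact: (integrableD measurableT fi gi). Qed.

Lemma integrable_EFinB f g : P.-integrable [set: T] (EFin \o f) ->
  P.-integrable [set: T] (EFin \o g) ->
  P.-integrable [set: T] (EFin \o (fun x => f x - g x)).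
Proof. by move=> fi gi; exact: (integrableB measurableT fi gi). Qed.

Lemma integrable_EFinZ (c : R) f : P.-integrable [set: T] (EFin \o f) ->
  P.-integrable [set: T] (EFin \o (fun x => c * f x)).
Proof. by move=> fi; exact: (integrableZl measurableT c fi). Qed.

Lemma integrable_EFin_sum (I : Type) (r : seq I) (Q : pred I) (f : I -> T -> R) :
  (forall i, Q i -> P.-integrable [set: T] (EFin \o f i)) ->
  P.-integrable [set: T] (EFin \o (fun x => \sum_(i <- r | Q i) f i x)).
Proof.
move=> fi; elim: r => [|i r IH].
  by under eq_fun do rewrite big_nil; exact: integrable_EFin_cst.
under eq_fun do rewrite big_cons.
have [Qi|//] := boolP (Q i).
by apply: integrable_EFinD => //; exact: fi.
Qed.

Lemma integrable_EFinM_bounded f g (M : R) : measurable_fun [set: T] g ->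
  (forall x, `|g x| <= M) -> P.-integrable [set: T] (EFin \o f) ->
  P.-integrable [set: T] (EFin \o (fun x => f x * g x)).
Proof.
move=> mg gM fi.
apply: (@le_integrable_EFin _ (fun x => M * `|f x|)).
- apply: measurable_funM => //.
  by apply/measurable_EFinP; exact: measurable_int fi.
- by move=> x; rewrite normrM mulrC ler_wpM2r.
- by apply: integrable_EFinZ; exact: (integrable_norm fi).
Qed.

End Integrability.

(** * Moments and characteristic function of a centred Gaussian variable *)

Section CenteredGaussian.
Context {R : realType} {d : measure_display} {Omega : measurableType d}.
Variable P : probability Omega R.
Local Notation mu := (@lebesgue_measure R).

Lemma gaussian_integrable (Z : Omega -> R) (m s : R) :
  measurable_fun [set: Omega] Z ->
  (forall A : set R, measurable A ->
    P (Z @^-1` A) = (if s == 0 then \d_m A else normal_prob m s A)) ->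
  P.-integrable [set: Omega] (EFin \o Z).
Proof.
move=> mZ lawZ.
have iexp t : P.-integrable [set: Omega] (EFin \o (fun w => expR (t * Z w))).
  apply: ge0_integrable_EFin (gaussian_mgf mZ lawZ t) => //.
  by apply: measurableT_comp => //; exact: measurable_funM.
apply: (@le_integrable_EFin _ _ _ _ _
  (fun w => expR (1 * Z w) + expR (- 1 * Z w))) => //.
  by move=> x; rewrite mul1r mulN1r ler_normr_expRDN.
by apply: integrable_EFinD.
Qed.

(** Integrating 1 + t Z <= exp(t Z) shows that the logarithm m t + t^2 s^2 / 2 of the exponential
    moment is nonnegative for every t, which forces m = 0. The choice t = - m / (s^2 + 1) also
    covers s = 0. *)
Lemma gaussian_mean0 (Z : Omega -> R) (m s : R) :
  measurable_fun [set: Omega] Z ->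
  (forall A : set R, measurable A ->
    P (Z @^-1` A) = (if s == 0 then \d_m A else normal_prob m s A)) ->
  \int[P]_w Z w = 0 -> m = 0.
Proof.
move=> mZ lawZ EZ.
have mt t : measurable_fun [set: Omega] (fun w => expR (t * Z w)).
  apply: measurableT_comp => //; exact: measurable_funM.
have iexp t : P.-integrable [set: Omega] (EFin \o (fun w => expR (t * Z w))).
  exact: ge0_integrable_EFin (gaussian_mgf mZ lawZ t).
have iZ := gaussian_integrable mZ lawZ.
have main t : 0 <= m * t + t ^+ 2 * s ^+ 2 / 2.
  rewrite leNgt -expR_lt1 -leNgt -lee_fin.
  rewrite -(gaussian_mgf mZ lawZ t) (Rintegral_EFin (iexp t)) lee_fin.
  rewrite -(Rintegral_prob_cst P 1) -[leLHS]addr0 -(mulr0 t) -EZ -RintegralZl//.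
  have i1 := integrable_EFin_cst P 1; have itZ := integrable_EFinZ t iZ.
  rewrite -RintegralD//; apply: le_Rintegral => //.
    exact: integrable_EFinD.
  by move=> x _; exact: expR_ge1Dx.
have s1 : 0 < s ^+ 2 + 1 by rewrite ltr_wpDl// sqr_ge0.
have := main (- m / (s ^+ 2 + 1)).
have -> : m * (- m / (s ^+ 2 + 1)) + (- m / (s ^+ 2 + 1)) ^+ 2 * s ^+ 2 / 2 =
  - (m ^+ 2 * (s ^+ 2 + 2) / (2 * (s ^+ 2 + 1) ^+ 2)).
  by field; rewrite gt_eqF.
rewrite oppr_ge0 pmulr_lle0 ?invr_gt0 ?mulr_gt0 ?exprn_gt0// pmulr_lle0; last first.
  by rewrite ltr_wpDl// sqr_ge0.
by move=> m0; apply/eqP; rewrite -sqrf_eq0 eq_le m0 sqr_ge0.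
Qed.

Section Tilting.
Variables (Z : Omega -> R) (s : R).
Hypothesis mZ : measurable_fun [set: Omega] Z.
Hypothesis lawZ : forall A : set R, measurable A ->
    P (Z @^-1` A) = (if s == 0 then \d_(0 : R) A else normal_prob 0 s A).

(** The Cameron-Martin formula in dimension one. For [s = 0] both sides are [g 0]. *)
Lemma ge0_gaussian_tilt (g : R -> R) (a : R) : continuous g ->
  (forall x, 0 <= g x) ->
  (\int[P]_w (g (Z w) * expR (a * Z w))%:E =
   (expR (a ^+ 2 * s ^+ 2 / 2))%:E * \int[P]_w (g (Z w + a * s ^+ 2))%:E)%E.
Proof.
move=> cg g0.
have mg : measurable_fun [set: R] g by exact: continuous_measurable_fun.
have mf : measurable_fun [set: R] (fun x => (g x * expR (a * x))%:E).
  apply/measurable_EFinP; apply: measurable_funM => //.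
  by apply: measurableT_comp.
have mgs : measurable_fun [set: R] (fun x => (g (x + a * s ^+ 2))%:E).
  apply/measurable_EFinP; apply: (measurableT_comp mg).
  exact: measurable_funD.
have f0 x : (0 <= (g x * expR (a * x))%:E)%E.
  by rewrite lee_fin mulr_ge0// expR_ge0.
have gs0 x : (0 <= (g (x + a * s ^+ 2))%:E)%E by rewrite lee_fin.
have [s0|s0] := eqVneq s 0.
  rewrite (ge0_integral_degenerate_gaussian mZ lawZ s0 mf f0).
  rewrite (ge0_integral_degenerate_gaussian mZ lawZ s0 mgs gs0).
  by rewrite s0 expr0n !mulr0 addr0 mul0r expR0 mulr1 mul1e.
rewrite (ge0_integral_gaussian mZ lawZ s0 mf f0).
rewrite (ge0_integral_gaussian mZ lawZ s0 mgs gs0).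
have pdf0 x : 0 <= normal_pdf (a * s ^+ 2) s x by exact: normal_pdf_ge0.
have gpdf0 x : 0 <= g x * normal_pdf (a * s ^+ 2) s x by exact: mulr_ge0.
under eq_integral => x _.
  rewrite -EFinM -mulrA normal_pdf_tilt// mul0r !add0r mulrCA EFinM.
  over.
have mgpdf : measurable_fun [set: R]
    (fun x => (g x * normal_pdf (a * s ^+ 2) s x)%:E).
  by apply/measurable_EFinP/measurable_funM => //; exact: measurable_normal_pdf.
have egpdf0 x : [set: R] x -> (0 <= (g x * normal_pdf (a * s ^+ 2) s x)%:E)%E.
  by rewrite lee_fin.
have e0 : 0 <= expR (a ^+ 2 * s ^+ 2 / 2) by exact: expR_ge0.
rewrite (@ge0_integralZl_EFin _ _ _ mu _ measurableT _ egpdf0 mgpdf _ e0).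
apply: congr1.
rewrite (continuous_shift_integral (a * s ^+ 2)).
- by apply: eq_integral => x _; rewrite -EFinM normal_pdf_shift.
- by move=> x; apply: cvgM; [exact: cg|exact: continuous_normal_pdf].
- exact: gpdf0.
Qed.

Lemma gaussian_expR_integrable (a : R) :
  P.-integrable [set: Omega] (EFin \o (fun w => expR (a * Z w))).
Proof.
apply: ge0_integrable_EFin (gaussian_mgf mZ lawZ a) => //.
by apply: measurableT_comp => //; exact: measurable_funM.
Qed.

(** Adding the bound [M] makes [g] nonnegative, and the contribution of [M] to both sides is the
    exponential moment. *)
Lemma gaussian_tilt (g : R -> R) (a M : R) : continuous g ->
  (forall x, `|g x| <= M) ->
  \int[P]_w (g (Z w) * expR (a * Z w)) =
  expR (a ^+ 2 * s ^+ 2 / 2) * \int[P]_w g (Z w + a * s ^+ 2).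
Proof.
move=> cg gM.
have mg : measurable_fun [set: R] g by exact: continuous_measurable_fun.
have mgZ : measurable_fun [set: Omega] (g \o Z) by exact: measurableT_comp.
have mgZs : measurable_fun [set: Omega] (fun w => g (Z w + a * s ^+ 2)).
  by apply: measurableT_comp => //; exact: measurable_funD.
have cgM : continuous (fun x => g x + M).
  by move=> x; apply: cvgD; [exact: cg|exact: cvg_cst].
have gM0 x : 0 <= g x + M.
  by rewrite -lerBlDr sub0r; have /ler_normlP[] := gM x; rewrite lerNl.
have E1 := ge0_gaussian_tilt a cgM gM0.
have E2 := gaussian_mgf mZ lawZ a; rewrite mul0r add0r in E2.
have iE := gaussian_expR_integrable a.
have igE : P.-integrable [set: Omega] (EFin \o (fun w => g (Z w) * expR (a * Z w))).
  under eq_fun do rewrite mulrC.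
  by apply: (@integrable_EFinM_bounded _ _ _ _ _ (g \o Z) M) => //= x; exact: gM.
have iMgE : P.-integrable [set: Omega] (EFin \o (fun w => M * expR (a * Z w))).
  exact: integrable_EFinZ.
have igs : P.-integrable [set: Omega] (EFin \o (fun w => g (Z w + a * s ^+ 2))).
  exact: (@bounded_integrable_EFin _ _ _ _ _ M).
have iM := integrable_EFin_cst P M.
have {}E1 : \int[P]_w ((g (Z w) + M) * expR (a * Z w)) =
    expR (a ^+ 2 * s ^+ 2 / 2) * \int[P]_w (g (Z w + a * s ^+ 2) + M).
  apply: RintegralE; rewrite E1 Rintegral_EFin//.
  exact: integrable_EFinD.
have {}E2 := RintegralE E2.
move: E1; under eq_Rintegral do rewrite mulrDl.
rewrite !RintegralD// RintegralZl// E2 Rintegral_prob_cst; lra.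
Qed.

Lemma gaussian_norm_integrable :
  P.-integrable [set: Omega] (EFin \o (fun w => `|Z w|)).
Proof.
apply: (@le_integrable_EFin _ _ _ _ _
    (fun w => expR (1 * Z w) + expR (- 1 * Z w))).
- exact: measurableT_comp.
- by move=> x; rewrite normr_id mul1r mulN1r ler_normr_expRDN.
- by apply: integrable_EFinD; exact: gaussian_expR_integrable.
Qed.

(** Gaussian integration by parts for x -> cos(t x + r), obtained by differentiating [gaussian_tilt]
    in [a] at 0; the degenerate case needs no separate argument. *)
Lemma gaussian_stein (t r : R) :
  \int[P]_w (cos (t * Z w + r) * Z w) =
  - (t * s ^+ 2) * \int[P]_w sin (t * Z w + r).
Proof.
pose f a w := cos (t * Z w + r) * expR (a * Z w).
have mcos : measurable_fun [set: Omega] (fun w => cos (t * Z w + r)).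
  apply: (measurableT_comp (f := @cos R)).
    exact: continuous_measurable_fun (@continuous_cos R).
  by apply: measurable_funD => //; exact: measurable_funM.
have msin : measurable_fun [set: Omega] (fun w => sin (t * Z w + r)).
  apply: (measurableT_comp (f := @sin R)).
    exact: continuous_measurable_fun (@continuous_sin R).
  by apply: measurable_funD => //; exact: measurable_funM.
have icos : P.-integrable [set: Omega] (EFin \o (fun w => cos (t * Z w + r))).
  by apply: (@bounded_integrable_EFin _ _ _ _ _ 1) => // x; exact: cos_max.
have isin : P.-integrable [set: Omega] (EFin \o (fun w => sin (t * Z w + r))).
  by apply: (@bounded_integrable_EFin _ _ _ _ _ 1) => // x; exact: sin_max.
have fi a : P.-integrable [set: Omega] (EFin \o f a).
  rewrite /f; under eq_fun do rewrite mulrC.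
  apply: (@integrable_EFinM_bounded _ _ _ _ _ _ 1) => //.
    by move=> x; exact: cos_max.
  exact: gaussian_expR_integrable.
have df y (a : R) : is_derive a 1 (f ^~ y) (cos (t * Z y + r) * Z y * expR (a * Z y)).
  by apply: is_derive_eq; rewrite /GRing.scale/=; ring.
(* Dominates the derivative for |a| < 1: both |Z| and exp(a Z) are at most exp(Z) + exp(-Z), whose
   square is at most 2 (exp(2 Z) + exp(-2 Z)). *)
pose G w := 4 * (expR (2 * Z w) + expR (- 2 * Z w)).
have L1 : (fun a => \int[P]_w f a w)^`()%classic 0 =
    \int[P]_w (cos (t * Z w + r) * Z w).
  rewrite (@differentiation_under_integral _ _ _ P f setT measurableT 0 (-1) 1 _ _ _ G).
  - apply: eq_Rintegral => w _; rewrite partial1of2E.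
    by rewrite (@derive_val _ _ _ _ _ _ _ (df w 0)) mul0r expR0 mulr1.
  - by rewrite /= in_itv/= oppr_lt0 ltr01.
  - by move=> x _; exact: fi.
  - by move=> x y _ _; exact: (@ex_derive _ _ _ _ _ _ _ (df y x)).
  - by move=> y; rewrite /G mulr_ge0// addr_ge0// expR_ge0.
  - by apply: integrable_EFinZ; apply: integrable_EFinD; exact: gaussian_expR_integrable.
  - move=> x y; rewrite /= in_itv/= => /andP[x0 x1] _.
    rewrite partial1of2E (@derive_val _ _ _ _ _ _ _ (df y x)) /G.
    have ez : expR (x * Z y) <= expR (Z y) + expR (- Z y).
      have [z0|z0] := leP 0 (Z y).
        by rewrite (@le_trans _ _ (expR (Z y)))// ?ler_expR ?lerDl ?expR_ge0//; nra.
      by rewrite (@le_trans _ _ (expR (- Z y)))// ?ler_expR ?lerDr ?expR_ge0//; nra.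
    have zz := ler_normr_expRDN (Z y).
    rewrite !normrM [`|expR _|]ger0_norm ?expR_ge0//.
    have c1 := cos_max (t * Z y + r).
    have e2 : expR (2 * Z y) = expR (Z y) ^+ 2 by rewrite -expRM_natl.
    have eN2 : expR (- 2 * Z y) = expR (- Z y) ^+ 2.
      by rewrite -expRM_natl; congr expR; ring.
    have c0 := normr_ge0 (cos (t * Z y + r)).
    have z0 := normr_ge0 (Z y); have x0' := expR_ge0 (x * Z y).
    rewrite e2 eN2 (@le_trans _ _ ((expR (Z y) + expR (- Z y)) ^+ 2))//.
      rewrite expr2; apply: ler_pM => //.
      by rewrite (le_trans _ zz)// ler_piMl.
    by have := sqr_ge0 (expR (Z y) - expR (- Z y)); nra.
pose C := \int[P]_w cos (t * Z w + r); pose S := \int[P]_w sin (t * Z w + r).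
have LE : (fun a => \int[P]_w f a w) = (fun a => expR (a ^+ 2 * s ^+ 2 * 2^-1) *
    (cos (t * s ^+ 2 * a) * C - sin (t * s ^+ 2 * a) * S)).
  apply/funext => a.
  have cg : continuous (fun x => cos (t * x + r)).
    move=> x; apply: continuous_comp; last exact: continuous_cos.
    apply: cvgD; last exact: cvg_cst.
    by apply: cvgM; [exact: cvg_cst|exact: cvg_id].
  rewrite (@gaussian_tilt (fun x => cos (t * x + r)) a 1 cg); last first.
    by move=> x; exact: cos_max.
  congr (_ * _); rewrite /C /S -!RintegralZl// -RintegralB//; try exact: integrable_EFinZ.
  apply: eq_Rintegral => w _; rewrite -cosD; congr cos; ring.
have dL : is_derive (0 : R) 1 (fun a => expR (a ^+ 2 * s ^+ 2 * 2^-1) *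
    (cos (t * s ^+ 2 * a) * C - sin (t * s ^+ 2 * a) * S)) (- (t * s ^+ 2) * S).
  apply: is_derive_eq; rewrite /GRing.scale/= !mulr0 expr0n/= !mul0r expR0 cos0 sin0.
  ring.
by rewrite -L1 LE derive1E (@derive_val _ _ _ _ _ _ _ dL).
Qed.

(** By Stein's identity F(t) = E cos(t Z + r) satisfies F' = - s^2 t F, so that F(t) exp(s^2 t^2 /
    2) is constant. The phase [r] stands for the real and imaginary parts of the characteristic
    function at once. *)
Lemma gaussian_cf (t r : R) :
  \int[P]_w cos (t * Z w + r) = expR (- (s ^+ 2 * t ^+ 2 / 2)) * cos r.
Proof.
pose f t w := cos (t * Z w + r).
have mcos u : measurable_fun [set: Omega] (f u).
  apply: (measurableT_comp (f := @cos R)).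
    exact: continuous_measurable_fun (@continuous_cos R).
  by apply: measurable_funD => //; exact: measurable_funM.
have icos u : P.-integrable [set: Omega] (EFin \o f u).
  by apply: (@bounded_integrable_EFin _ _ _ _ _ 1) => // x; exact: cos_max.
have df y (u : R) : is_derive u 1 (f ^~ y) (- (sin (u * Z y + r) * Z y)).
  by apply: is_derive_eq; rewrite /GRing.scale/=; ring.
have FE u : partial1of2 f u = fun y => - (sin (u * Z y + r) * Z y).
  by apply/funext => y; rewrite partial1of2E (@derive_val _ _ _ _ _ _ _ (df y u)).
have uI (u : R) : [set` `]u - 1, u + 1[] u by rewrite /= in_itv/=; lra.
pose F u := \int[P]_w f u w.
have dF (u : R) : is_derive u 1 F (- (s ^+ 2 * u) * F u).
  have fi x : [set` `]u - 1, u + 1[] x -> P.-integrable [set: Omega] (EFin \o f x) by [].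
  have fd x y : [set` `]u - 1, u + 1[] x -> [set: Omega] y -> derivable (f ^~ y) x 1.
    by move=> _ _; exact: (@ex_derive _ _ _ _ _ _ _ (df y x)).
  have G0 y : 0 <= `|Z y| by [].
  have Gub' x y : [set` `]u - 1, u + 1[] x -> [set: Omega] y ->
      `|partial1of2 f x y| <= `|Z y|.
    by rewrite FE normrN normrM => _ _; rewrite ler_piMl// sin_max.
  have dd := derivable_under_integral measurableT (uI u) fi fd G0
    gaussian_norm_integrable Gub'.
  apply: DeriveDef => //.
  rewrite -derive1E (differentiation_under_integral measurableT (uI u) fi fd G0
    gaussian_norm_integrable Gub') FE.
  (* The phase shift turns the sine of the derivative into the cosine of Stein's identity. *)
  have := gaussian_stein u (r - pi / 2).
  have cE w : cos (u * Z w + (r - pi / 2)) = sin (u * Z w + r).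
    by rewrite addrA cosBpihalf.
  have sE w : sin (u * Z w + (r - pi / 2)) = - f u w.
    by rewrite addrA sinBpihalf.
  under eq_Rintegral do rewrite cE.
  under [X in _ = _ * X]eq_Rintegral do rewrite sE -mulN1r.
  under [X in _ -> X = _]eq_Rintegral do rewrite -mulN1r.
  have isZ : P.-integrable [set: Omega] (EFin \o (fun w => sin (u * Z w + r) * Z w)).
    apply: (le_integrable_EFin _ _ gaussian_norm_integrable).
      apply: measurable_funM => //; apply: (measurableT_comp (f := @sin R)).
        exact: continuous_measurable_fun (@continuous_sin R).
      by apply: measurable_funD => //; exact: measurable_funM.
    by move=> w; rewrite normrM ler_piMl// sin_max.
  rewrite !RintegralZl// => ->; rewrite /F; ring.
pose h u := expR (s ^+ 2 * 2^-1 * u ^+ 2) * F u.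
have dh (u : R) : is_derive u 1 h 0.
  by apply: is_derive_eq; rewrite /GRing.scale/=; field.
have := is_derive_0_is_cst t 0 dh.
rewrite /h expr0n mulr0 expR0 mul1r => hE.
rewrite -[LHS]/(F t).
have -> : F t = expR (- (s ^+ 2 * t ^+ 2 / 2)) * F 0.
  by rewrite -hE mulrA -expRD -[LHS]mul1r -expR0; congr (expR _ * _); field.
congr (_ * _); rewrite /F /f; under eq_Rintegral do rewrite mul0r add0r.
exact: Rintegral_prob_cst.
Qed.

Lemma gaussian_sqr_integrable :
  P.-integrable [set: Omega] (EFin \o (fun w => Z w ^+ 2)).
Proof.
apply: (@le_integrable_EFin _ _ _ _ _
    (fun w => expR (1 * Z w) + expR (- 1 * Z w))).
- exact: measurable_funX.
- move=> x; rewrite ger0_norm ?sqr_ge0// mul1r mulN1r.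
  by have := sqr_expRDN (Z x); lra.
- by apply: integrable_EFinD; exact: gaussian_expR_integrable.
Qed.

(** The second moment q is squeezed: 2 + x^2 <= exp(x) + exp(-x) bounds it from above by the
    exponential moment, and 1 - cos x <= x^2 / 2 from below by the characteristic function. To
    second order in t both bounds equal s^2. *)
Lemma gaussian_variance : \int[P]_w (Z w ^+ 2) = s ^+ 2.
Proof.
have iq := gaussian_sqr_integrable.
set q := \int[P]_w _; set v := s ^+ 2.
have q0 : 0 <= q by apply: Rintegral_ge0 => w _; exact: sqr_ge0.
have v0 : 0 <= v by exact: sqr_ge0.
have mgfR t : \int[P]_w expR (t * Z w) = expR (t ^+ 2 * v / 2).
  by apply: RintegralE; rewrite (gaussian_mgf mZ lawZ) mul0r add0r.
have up t : 2 + t ^+ 2 * q <= 2 * expR (t ^+ 2 * v / 2).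
  have ie u : P.-integrable [set: Omega] (EFin \o (fun w => expR (u * Z w))).
    exact: gaussian_expR_integrable.
  have iq2 := integrable_EFinZ (t ^+ 2) iq.
  have i2 := integrable_EFin_cst P (2 : R).
  have -> : 2 * expR (t ^+ 2 * v / 2) =
      \int[P]_w (expR (t * Z w) + expR (- t * Z w)).
    by rewrite RintegralD// !mgfR sqrrN; lra.
  rewrite -{1}(Rintegral_prob_cst P 2) -RintegralZl// -RintegralD//.
  apply: le_Rintegral => //; [exact: integrable_EFinD|exact: integrable_EFinD|].
  by move=> w _; rewrite mulNr -exprMn; exact: sqr_expRDN.
have lo t : 1 - expR (- (v * t ^+ 2 / 2)) <= t ^+ 2 * q / 2.
  have mcos : measurable_fun [set: Omega] (fun w => cos (t * Z w + 0)).
    apply: (measurableT_comp (f := @cos R)).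
      exact: continuous_measurable_fun (@continuous_cos R).
    by apply: measurable_funD => //; exact: measurable_funM.
  have icos : P.-integrable [set: Omega] (EFin \o (fun w => cos (t * Z w + 0))).
    by apply: (@bounded_integrable_EFin _ _ _ _ _ 1) => // x; exact: cos_max.
  have iq2 := integrable_EFinZ (t ^+ 2 / 2) iq.
  have i1 := integrable_EFin_cst P (1 : R).
  have := gaussian_cf t 0; rewrite cos0 mulr1 => <-.
  rewrite [leRHS]mulrAC -{1}(Rintegral_prob_cst P 1) -RintegralZl// -RintegralB//.
  apply: le_Rintegral => //; first exact: integrable_EFinB.
  by move=> w _; rewrite addr0 (le_trans (ler_1subcos _))// exprMn; lra.
pose tau : R := `|q - v| / (q * v + 1).
have qv0 : 0 <= q * v by exact: mulr_ge0.
have qv1 : 0 < q * v + 1 by rewrite ltr_wpDl.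
have tau0 : 0 <= tau by rewrite divr_ge0// ltW.
have tauE : tau * (q * v + 1) = `|q - v| by rewrite divfK// gt_eqF.
have st : Num.sqrt tau ^+ 2 = tau by rewrite sqr_sqrtr.
have {}up := up (Num.sqrt tau); have {}lo := lo (Num.sqrt tau).
rewrite st in up lo.
have [qv|qv|//] := ltgtP q v.
- exfalso; rewrite ltr0_norm ?subr_lt0// in tauE.
  have e1 := expR_ge1Dx (v * tau / 2).
  have e2 := expRxMexpNx_1 (v * tau / 2).
  have e3 := expR_gt0 (- (v * tau / 2)).
  set E := expR (- (v * tau / 2)) in lo e2 e3 *.
  have e4 : E * (1 + v * tau / 2) <= 1.
    by rewrite -[leRHS]e2 mulrC ler_pM2r.
  have vt : 0 <= v * tau by exact: mulr_ge0.
  have t1 : v * tau / 2 <= tau * q / 2 * (1 + v * tau / 2).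
    have : (1 - E) * (1 + v * tau / 2) <= tau * q / 2 * (1 + v * tau / 2).
      by rewrite ler_wpM2r//; lra.
    by move: e4; lra.
  have tau1 : 0 < tau.
    rewrite lt_neqAle tau0 andbT eq_sym; apply/eqP => t0.
    by move: tauE; rewrite t0 mul0r; lra.
  have : tau * v <= tau * (q * (1 + v * tau / 2)) by lra.
  rewrite ler_pM2l//; nra.
- exfalso; rewrite gtr0_norm ?subr_gt0// in tauE.
  have e1 := expR_ge1Dx (- (tau * v / 2)).
  have e2 := expRxMexpNx_1 (tau * v / 2).
  have e3 := expR_gt0 (tau * v / 2).
  set E := expR (tau * v / 2) in up e2 e3 *.
  have e4 : E * (1 - tau * v / 2) <= 1.
    by rewrite -[leRHS]e2 ler_pM2l.
  have vt : 0 <= tau * v by exact: mulr_ge0.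
  have tv1 : tau * v < 1.
    rewrite -(ltr_pM2r qv1) mulrAC tauE; nra.
  have tau1 : 0 < tau.
    rewrite lt_neqAle tau0 andbT eq_sym; apply/eqP => t0.
    by move: tauE; rewrite t0 mul0r; lra.
  have t1 : (2 + tau * q) * (1 - tau * v / 2) <= 2 * E * (1 - tau * v / 2).
    by rewrite ler_wpM2r//; lra.
  have : tau * (q * (1 - tau * v / 2)) <= tau * v by lra.
  rewrite ler_pM2l//; nra.
Qed.

End Tilting.

End CenteredGaussian.

(** * Functions annihilated by all cosines *)

Section SignApproximation.
Context {R : realType}.
Implicit Types v : R.

(** Iterates of v -> (3 v - v^3) / 2, which fixes -1, 0 and 1 and attracts ]0, 1] to 1. They are
    polynomials bounded by 1 on [-1, 1] that converge there to the sign, at 0 included. *)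
Fixpoint sign_poly (k : nat) : {poly R} :=
  if k is j.+1 then 2^-1 *: (3 *: sign_poly j - sign_poly j ^+ 3) else 'X.

Lemma horner_sign_polyS k v : (sign_poly k.+1).[v] =
  2^-1 * (3 * (sign_poly k).[v] - (sign_poly k).[v] ^+ 3).
Proof. by rewrite /= !hornerE. Qed.

Lemma horner_sign_polyN k v : (sign_poly k).[- v] = - (sign_poly k).[v].
Proof.
elim: k => [|k IH]; first by rewrite /= !hornerX.
by rewrite !horner_sign_polyS IH; ring.
Qed.

Lemma horner_sign_poly0 k : (sign_poly k).[0] = 0.
Proof.
have := horner_sign_polyN k 0; rewrite oppr0 => /eqP.
by rewrite -addr_eq0 -mulr2n mulrn_eq0/= => /eqP.
Qed.

(** If w is an iterate, the next one is at distance (1 - w) (1 - w) (2 + w) / 2 from 1, and (1 - w)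
    (2 + w) / 2 <= 1 - v / 2 because w >= v. Hence the convergence is geometric. *)
Lemma sign_poly_pos k v : 0 < v <= 1 ->
  v <= (sign_poly k).[v] <= 1 /\ 1 - (sign_poly k).[v] <= (1 - v / 2) ^+ k.
Proof.
move=> /andP[v0 v1]; elim: k => [|k [/andP[l1 l2] l3]].
  by rewrite /= hornerX lexx v1 expr0 gerBl ltW.
rewrite horner_sign_polyS [(_ - _) ^+ _.+1]exprS; set w := (sign_poly k).[v] in l1 l2 l3 *.
have w0 : 0 < w by exact: lt_le_trans l1.
have E : 1 - 2^-1 * (3 * w - w ^+ 3) = (1 - w) * ((1 - w) * (2 + w) / 2) by field.
have c0 : 0 <= (1 - w) * (2 + w) / 2 by nra.
have cv : (1 - w) * (2 + w) / 2 <= 1 - v / 2 by nra.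
have d1 : 0 <= 1 - w by rewrite subr_ge0.
split; last by rewrite E mulrC ler_pM.
apply/andP; split; last by rewrite -subr_ge0 E mulr_ge0.
rewrite (le_trans l1)// -subr_ge0.
have -> : 2^-1 * (3 * w - w ^+ 3) - w = 2^-1 * w * (1 - w) * (1 + w) by field.
by rewrite !mulr_ge0// ?invr_ge0//; lra.
Qed.

Lemma sign_poly_bound k v : `|v| <= 1 -> `|(sign_poly k).[v]| <= 1.
Proof.
have pos (u : R) : 0 < u <= 1 -> `|(sign_poly k).[u]| <= 1.
  move=> u01; have [/andP[u0 u1] _] := sign_poly_pos k u01.
  by rewrite ger0_norm// (le_trans _ u0)//; case/andP: u01 => /ltW.
move=> v1; have [v0|v0|->] := ltgtP v 0.
- rewrite -[v]opprK horner_sign_polyN normrN pos// oppr_gt0 v0/=.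
  by rewrite -(ltr0_norm v0).
- by rewrite pos// v0 -(gtr0_norm v0).
- by rewrite horner_sign_poly0 normr0.
Qed.

Lemma cvg_sign_poly v : `|v| <= 1 -> (sign_poly k).[v] @[k --> \oo] --> Num.sg v.
Proof.
have pos (u : R) : 0 < u <= 1 -> (sign_poly k).[u] @[k --> \oo] --> (1 : R).
  move=> u01; have /andP[u0 u1] := u01.
  have g0 : (1 - u / 2) ^+ k @[k --> \oo] --> (0 : R).
    by apply: cvg_expr; rewrite ger0_norm; lra.
  have g1 : 1 - (1 - u / 2) ^+ k @[k --> \oo] --> (1 : R).
    by rewrite -[X in _ --> X]subr0; apply: cvgB => //; exact: cvg_cst.
  have h : \forall k \near \oo, 1 - (1 - u / 2) ^+ k <= (sign_poly k).[u] <= (fun=> 1) k.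
    apply: nearW => k; have [/andP[_ h1] h2] := sign_poly_pos k u01.
    by rewrite h1 andbT; lra.
  exact: (squeeze_cvgr h g1 (cvg_cst _)).
move=> v1; have [v0|v0|->] := ltgtP v 0.
- rewrite ltr0_sg//.
  rewrite (_ : (fun k => (sign_poly k).[v]) = (fun k => - (sign_poly k).[- v])).
    2: by apply/funext => k; rewrite horner_sign_polyN opprK.
  apply: cvgN; apply: pos; rewrite oppr_gt0 v0/=.
  by rewrite -(ltr0_norm v0).
- by rewrite gtr0_sg//; apply: pos; rewrite v0 -(gtr0_norm v0).
- by rewrite sgr0; under eq_fun do rewrite horner_sign_poly0; exact: cvg_cst.
Qed.

Lemma sg_sin v : `|v| < 2 -> Num.sg (sin v) = Num.sg v.
Proof.
move=> v2; have [v0|v0|->] := ltgtP v 0; last by rewrite sin0.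
- have sv : 0 < sin (- v) by rewrite sin2_gt0// oppr_gt0 v0/= -(ltr0_norm v0).
  by rewrite !ltr0_sg// -oppr_gt0 -sinN.
- by rewrite !gtr0_sg// sin2_gt0// v0/= -(gtr0_norm v0).
Qed.

End SignApproximation.

Section DominatedVanishing.
Context {R : realType} {d : measure_display} {T : measurableType d}.
Variable P : probability T R.

(** Dominated convergence in the form that carries the vanishing of integrals from one class of test
    functions to the next. *)
Lemma Rintegral_cvg0 (f_ : nat -> T -> R) (f g : T -> R) :
  (forall n, measurable_fun [set: T] (f_ n)) ->
  (forall x, f_ n x @[n --> \oo] --> f x) ->
  P.-integrable [set: T] (EFin \o g) ->
  (forall n x, `|f_ n x| <= g x) ->
  (forall n, \int[P]_x f_ n x = 0) -> \int[P]_x f x = 0.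
Proof.
move=> mf_ f_f ig fg f0.
have mf : measurable_fun [set: T] f.
  by apply: (measurable_fun_cvg mf_) => x _; exact: f_f.
have if_ n : P.-integrable [set: T] (EFin \o f_ n).
  exact: (le_integrable_EFin (mf_ n) (fg n)).
have emf_ n : measurable_fun [set: T] (EFin \o f_ n) by exact/measurable_EFinP.
have emf : measurable_fun [set: T] (EFin \o f) by exact/measurable_EFinP.
have ef_f : {ae P, forall x, [set: T] x -> (EFin \o f_ n) x @[n --> \oo] --> (EFin \o f) x}.
  by apply: aeW => x _; apply: cvg_EFin; [exact: nearW|exact: f_f].
have efg : {ae P, forall x n, [set: T] x -> (`|(EFin \o f_ n) x| <= (EFin \o g) x)%E}.
  by apply: aeW => x n _ /=; rewrite lee_fin.
have [_ _] := dominated_convergence measurableT emf_ emf ef_f ig efg.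
under eq_fun => n do rewrite (Rintegral_EFin (if_ n)) f0.
move=> /cvg_lim; rewrite lim_cst// => /(_ (@ereal_hausdorff R)) E0.
by rewrite /Rintegral -[X in fine X]E0.
Qed.

End DominatedVanishing.

Section CosineUniqueness.
Context {R : realType} {d : measure_display} {T : measurableType d}.
Variable P : probability T R.
Variables (rho Y : T -> R).
Hypothesis irho : P.-integrable [set: T] (EFin \o rho).
Hypothesis mY : measurable_fun [set: T] Y.
Hypothesis rho_cos : forall t r, \int[P]_w (rho w * cos (t * Y w + r)) = 0.

Let mrho : measurable_fun [set: T] rho.
Proof. by apply/measurable_EFinP; exact: measurable_int irho. Qed.

Let maff (u u0 : R) : measurable_fun [set: T] (fun w => u * Y w + u0).
Proof. by apply: measurable_funD => //; exact: measurable_funM. Qed.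

Let mcosY t r : measurable_fun [set: T] (fun w => cos (t * Y w + r)).
Proof.
apply: (measurableT_comp (f := @cos R)) => //.
exact: continuous_measurable_fun (@continuous_cos R).
Qed.

Let msinY t r : measurable_fun [set: T] (fun w => sin (t * Y w + r)).
Proof.
apply: (measurableT_comp (f := @sin R)) => //.
exact: continuous_measurable_fun (@continuous_sin R).
Qed.

Let irho_mul (g : T -> R) : measurable_fun [set: T] g ->
  (forall w, `|g w| <= 1) -> P.-integrable [set: T] (EFin \o (fun w => rho w * g w)).
Proof. by move=> mg g1; exact: (integrable_EFinM_bounded mg g1 irho). Qed.

(** A cosine times a sine is half the sum of two cosines with other frequencies and phases, whence
    an induction with [t] and [r] free. *)
Lemma rho_cos_sinX (u u0 : R) (k : nat) : forall t r : R,
  \int[P]_w (rho w * (cos (t * Y w + r) * sin (u * Y w + u0) ^+ k)) = 0.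
Proof.
elim: k => [t r|k IH t r].
  by under eq_Rintegral do rewrite expr0 mulr1; exact: rho_cos.
have cs w : cos (t * Y w + r) * sin (u * Y w + u0) =
    2^-1 * (cos ((t + u) * Y w + (r + u0 - pi / 2)) +
            cos ((t - u) * Y w + (r - u0 + pi / 2))).
  have -> : (t + u) * Y w + (r + u0 - pi / 2) =
      (t * Y w + r) + (u * Y w + u0 - pi / 2) by ring.
  have -> : (t - u) * Y w + (r - u0 + pi / 2) =
      (t * Y w + r) - (u * Y w + u0 - pi / 2) by ring.
  move: (t * Y w + r) (u * Y w + u0) => x y.
  by rewrite (cosB x) (cosD x) cosBpihalf; field.
have i1 t' r' : P.-integrable [set: T]
   (EFin \o (fun w => rho w * (cos (t' * Y w + r') * sin (u * Y w + u0) ^+ k))).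
  apply: irho_mul; first by apply: measurable_funM => //; exact: measurable_funX.
  by move=> w; rewrite normrM normrX mulr_ile1// ?cos_max// exprn_ile1// sin_max.
have E w : rho w * (cos (t * Y w + r) * sin (u * Y w + u0) ^+ k.+1) =
  2^-1 * (rho w * (cos ((t + u) * Y w + (r + u0 - pi / 2)) * sin (u * Y w + u0) ^+ k)
   + rho w * (cos ((t - u) * Y w + (r - u0 + pi / 2)) * sin (u * Y w + u0) ^+ k)).
  by rewrite exprS [X in rho w * X]mulrA cs; ring.
under eq_Rintegral do rewrite E.
by rewrite RintegralZl// ?RintegralD// ?IH ?addr0 ?mulr0//; exact: integrable_EFinD.
Qed.

Lemma rho_horner_sin (u u0 : R) (p : {poly R}) :
  \int[P]_w (rho w * p.[sin (u * Y w + u0)]) = 0.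
Proof.
under eq_Rintegral do rewrite horner_coef.
(* The factor [cos (0 * Y w + 0)] is 1; it puts the powers of the sine in the form of
   [rho_cos_sinX]. *)
have i1 i : P.-integrable [set: T]
    (EFin \o (fun w => rho w * (cos (0 * Y w + 0) * sin (u * Y w + u0) ^+ i))).
  apply: irho_mul; first by apply: measurable_funM => //; exact: measurable_funX.
  by move=> w; rewrite normrM normrX mulr_ile1// ?cos_max// exprn_ile1// sin_max.
have E w : rho w * (\sum_(i < size p) p`_i * sin (u * Y w + u0) ^+ i) =
    \sum_(i < size p) p`_i * (rho w * (cos (0 * Y w + 0) * sin (u * Y w + u0) ^+ i)).
  rewrite mulr_sumr; apply: eq_bigr => i _.
  by rewrite mul0r addr0 cos0 mul1r mulrCA.
under eq_Rintegral do rewrite E.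
elim: (index_enum _) => [|i s IH].
  by under eq_Rintegral do rewrite big_nil; rewrite Rintegral_prob_cst.
under eq_Rintegral do rewrite big_cons.
rewrite RintegralD//.
- by rewrite IH RintegralZl// rho_cos_sinX mulr0 addr0.
- exact: integrable_EFinZ.
- by apply: integrable_EFin_sum => j _; exact: integrable_EFinZ.
Qed.

Let mhorner (p : {poly R}) (g : T -> R) : measurable_fun [set: T] g ->
  measurable_fun [set: T] (fun w => p.[g w]).
Proof.
move=> mg; under eq_fun do rewrite horner_coef.
apply: measurable_sum => i; apply: measurable_funM => //.
exact: measurable_funX.
Qed.

Let irhoN : P.-integrable [set: T] (EFin \o (fun w => `|rho w|)).
Proof. exact: (integrable_norm irho). Qed.

Lemma rho_sg_sin (u u0 : R) :
  \int[P]_w (rho w * Num.sg (sin (u * Y w + u0))) = 0.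
Proof.
apply: (@Rintegral_cvg0 _ _ _ P
  (fun k w => rho w * (sign_poly k).[sin (u * Y w + u0)]) _ (fun w => `|rho w|)).
- by move=> k; apply: measurable_funM => //; exact: mhorner.
- by move=> w; apply: cvgM; [exact: cvg_cst|apply: cvg_sign_poly; exact: sin_max].
- exact: irhoN.
- by move=> k w; rewrite normrM ler_piMr// sign_poly_bound// sin_max.
- by move=> k; exact: rho_horner_sin.
Qed.

Let msg (g : T -> R) : measurable_fun [set: T] g ->
  measurable_fun [set: T] (fun w => Num.sg (g w)).
Proof.
move=> mg.
have -> : (fun w => Num.sg (g w)) = (fun w => \1_`]0, +oo[ (g w) - \1_`]-oo, 0[ (g w)).
  apply/funext => w; rewrite !indicE !mem_setE !in_itv/= andbT.
  by case: sgrP => _; rewrite ?subr0 ?sub0r ?subrr.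
by apply: measurable_funB; apply: measurableT_comp mg; exact: measurable_indic.
Qed.

(** The sine of (Y - y0) / (n + 1) has the sign of Y - y0 as soon as |Y - y0| < 2 (n + 1). *)
Lemma rho_sg (y0 : R) : \int[P]_w (rho w * Num.sg (Y w - y0)) = 0.
Proof.
apply: (@Rintegral_cvg0 _ _ _ P
  (fun n w => rho w * Num.sg (sin (n.+1%:R^-1 * Y w + n.+1%:R^-1 * - y0))) _
  (fun w => `|rho w|)).
- by move=> k; apply: measurable_funM => //; exact: msg.
- move=> w; apply: cvgM; first exact: cvg_cst.
  apply: cvg_near_cst; near=> n.
  have n0 : 0 < n.+1%:R^-1 :> R by rewrite invr_gt0 ltr0n.
  rewrite -mulrDr sg_sin; first by rewrite sgrM (gtr0_sg n0) mul1r.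
  rewrite normrM ger0_norm ?invr_ge0// ltr_pdivrMl ?ltr0n//.
  rewrite (@lt_le_trans _ _ n.+1%:R)//; last by rewrite ler_peMr// ler1n.
  near: n; exists (Num.truncn `|Y w - y0|) => //= n.
  move=> hn; rewrite (lt_le_trans (truncnS_gt _))// ler_nat ltnS//.
- exact: irhoN.
- move=> k w; rewrite normrM ler_piMr//.
  by rewrite normr_sg; case: (_ != 0).
- by move=> k; exact: rho_sg_sin.
Unshelve. all: by end_near. Qed.

(** The thresholds y0 + 1 / (n + 1) decrease to y0, so that the points where Y = y0 get the limit 0;
    [Y] may have an atom there. *)
Lemma rho_gt (y0 : R) : \int[P]_w (rho w * (y0 < Y w)%R%:R) = 0.
Proof.
have i1 y : P.-integrable [set: T] (EFin \o (fun w => rho w * Num.sg (Y w - y))).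
  apply: irho_mul; first by apply: msg; exact: measurable_funB.
  by move=> w; rewrite normr_sg; case: (_ != 0).
apply: (@Rintegral_cvg0 _ _ _ P
  (fun n w => rho w * (2^-1 * (1 + Num.sg (Y w - (y0 + n.+1%:R^-1))))) _
  (fun w => `|rho w|)).
- move=> k; apply: measurable_funM => //; apply: measurable_funM => //.
  by apply: measurable_funD => //; apply: msg; exact: measurable_funB.
- move=> w; apply: cvgM; first exact: cvg_cst.
  apply: cvg_near_cst; have [yY|yY] := ltP y0 (Y w).
    have e0 : 0 < Y w - y0 by rewrite subr_gt0.
    near=> n; rewrite gtr0_sg ?subr_gt0; first by rewrite -mulr2n mulVf.
    rewrite -ltrBrDl; near: n; exact: near_infty_natSinv_lt (PosNum e0).
  apply: nearW => n; rewrite ltr0_sg; first by rewrite subrr mulr0.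
  by rewrite subr_lt0 (le_lt_trans yY)// ltrDl invr_gt0.
- exact: irhoN.
- move=> k w; rewrite normrM ler_piMr//.
  case: sgrP => _; rewrite ?addr0 ?subrr ?mulr0 ?normr0 ?mulr1//.
    by rewrite ger0_norm ?invr_ge0// invf_le1// ler1n.
  by rewrite -mulr2n mulVf// normr1.
- move=> k.
  have E w : rho w * (2^-1 * (1 + Num.sg (Y w - (y0 + k.+1%:R^-1)))) =
    2^-1 * (rho w * cos (0 * Y w + 0) + rho w * Num.sg (Y w - (y0 + k.+1%:R^-1))).
    by rewrite mul0r addr0 cos0; ring.
  under eq_Rintegral do rewrite E.
  have i0 : P.-integrable [set: T] (EFin \o (fun w => rho w * cos (0 * Y w + 0))).
    by apply: irho_mul => // w; exact: cos_max.
  rewrite RintegralZl//; last exact: integrable_EFinD.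
  by rewrite RintegralD// rho_cos rho_sg addr0 mulr0.
Unshelve. all: by end_near. Qed.

(** The Taylor polynomials of the exponential, taken at b times a sine, are uniformly bounded by exp
    |b|. *)
Lemma rho_expR_sin (b u u0 : R) :
  \int[P]_w (rho w * expR (b * sin (u * Y w + u0))) = 0.
Proof.
pose p n : {poly R} := \poly_(k < n) (b ^+ k / k`!%:R).
have pE n (x : R) : (p n).[x] = series (exp_coeff (b * x)) n.
  rewrite horner_poly seriesEord; apply: eq_bigr => k _ /=.
  by rewrite /exp_coeff /= exprMn mulrAC.
have pb n (x : R) : `|x| <= 1 -> `|(p n).[x]| <= expR `|b|.
  move=> x1; rewrite pE seriesEord (le_trans (ler_norm_sum _ _ _))//.
  rewrite (@le_trans _ _ (series (exp_coeff `|b|) n))//.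
    rewrite seriesEord; apply: ler_sum => k _; rewrite /exp_coeff /= normrM normrX.
    rewrite [`|_^-1|]ger0_norm ?invr_ge0// ler_wpM2r ?invr_ge0// lerXn2r ?nnegrE//.
    by rewrite normrM ler_piMr.
  rewrite /expR /pseries; apply: nondecreasing_cvgn_le; last exact: is_cvg_series_exp_coeff.
  by apply: nondecreasing_series => k _ _; rewrite /exp_coeff /= divr_ge0// exprn_ge0.
apply: (@Rintegral_cvg0 _ _ _ P
  (fun k w => rho w * (p k).[sin (u * Y w + u0)]) _ (fun w => expR `|b| * `|rho w|)).
- by move=> k; apply: measurable_funM => //; exact: mhorner.
- move=> w; apply: cvgM; first exact: cvg_cst.
  under eq_fun do rewrite pE; exact: is_cvg_series_exp_coeff.
- exact: integrable_EFinZ.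
- by move=> k w; rewrite normrM mulrC ler_wpM2r// pb// sin_max.
- by move=> k; exact: rho_horner_sin.
Qed.

(** The exponents b (n + 1) sin(Y / (n + 1)) tend to b Y and never exceed |b Y|, so that the
    integrability assumed is the domination required. *)
Lemma rho_expR (b : R) :
  P.-integrable [set: T] (EFin \o (fun w => rho w * expR `|b * Y w|)) ->
  \int[P]_w (rho w * expR (b * Y w)) = 0.
Proof.
move=> ib.
apply: (@Rintegral_cvg0 _ _ _ P
  (fun n w => rho w * expR (b * n.+1%:R * sin (n.+1%:R^-1 * Y w + 0))) _
  (fun w => `|rho w * expR `|b * Y w| |)).
- move=> k; apply: measurable_funM => //; apply: measurableT_comp => //.
  exact: measurable_funM.
- move=> w; apply: cvgM; first exact: cvg_cst.
  apply: continuous_cvg; first exact: continuous_expR.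
  under eq_fun do rewrite addr0 -mulrA.
  by apply: cvgM; [exact: cvg_cst|exact: cvg_mul_sin_inv].
- exact: (integrable_norm ib).
- move=> k w; rewrite normrM [leRHS]normrM ler_wpM2l// ger0_norm ?expR_ge0//.
  rewrite [leRHS]ger0_norm ?expR_ge0// ler_expR.
  rewrite (le_trans (ler_norm _))// addr0 -mulrA normrM [leRHS]normrM ler_wpM2l//.
  rewrite normrM ger0_norm// -ler_pdivlMl ?ltr0n//.
  by rewrite (le_trans (ler_norm_sin _))// normrM ger0_norm// invr_ge0.
- by move=> k; exact: rho_expR_sin.
Qed.

End CosineUniqueness.

(** * Maxima of Gaussian vectors *)

Section FirstArgmax.
Context {R : realType}.
Implicit Types (n : nat).

(** The strict comparison with smaller indices breaks ties: for a nonempty family exactly one of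
    these indicators is 1. *)
Definition argmax_ind n (u : 'I_n -> R) (i : 'I_n) : R :=
  \prod_(j < n) (if (j < i)%N then u j < u i else u j <= u i)%R%:R.

Lemma argmax_ind_ge0 n (u : 'I_n -> R) i : 0 <= argmax_ind u i.
Proof. by apply: prodr_ge0 => j _; rewrite ler0n. Qed.

Lemma argmax_ind_le1 n (u : 'I_n -> R) i : argmax_ind u i <= 1.
Proof.
suff /andP[] : 0 <= argmax_ind u i <= 1 by [].
apply: (big_ind (fun x : R => 0 <= x <= 1)) => [|x y /andP[x0 x1] /andP[y0 y1]|j _].
- by rewrite ler01 lexx.
- by rewrite mulr_ge0// mulr_ile1.
- by rewrite ler0n lern1 leq_b1.
Qed.

Lemma argmax_indP n (u : 'I_n.+1 -> R) :
  exists2 i0, forall j, u j <= u i0 &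
  forall F : 'I_n.+1 -> R, \sum_i argmax_ind u i * F i = F i0.
Proof.
pose k := [arg max_(i > ord0) u i]%O.
have kmax : [forall j, u j <= u k].
  by rewrite /k; case: arg_maxP => // i _ h; apply/forallP => j; exact: h.
pose Q i := [forall j, u j <= u i].
case: (@arg_minnP _ k Q (fun i => i) kmax) => i0 /forallP i0max i0min.
exists i0 => // F.
have lt0 (j : 'I_n.+1) : (j < i0)%N -> u j < u i0.
  move=> ji; rewrite lt_neqAle i0max andbT; apply/eqP => uj.
  have /i0min : Q j by apply/forallP => l; rewrite uj; exact: i0max.
  by rewrite leqNgt ji.
rewrite (bigD1 i0)//= [X in _ + X]big1 ?addr0; last first.
  move=> i ii0; rewrite /argmax_ind.
  have [ilt|igt|/val_inj ie] := ltngtP i i0; last by rewrite ie eqxx in ii0.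
  - rewrite (bigD1 i0)//= ltnNge (ltnW ilt)/= leNgt lt0// !mul0r//.
  - by rewrite (bigD1 i0)//= igt ltNge i0max !mul0r.
rewrite /argmax_ind big1 ?mul1r// => j _.
by case: ltnP => [/lt0 ->|_]; rewrite ?i0max.
Qed.

Definition maxf n (u : 'I_n -> R) : R := \sum_i argmax_ind u i * u i.

Lemma maxfP n (u : 'I_n.+1 -> R) :
  (exists i, maxf u = u i) /\ forall i, u i <= maxf u.
Proof.
have [i0 i0max i0E] := argmax_indP u.
by rewrite /maxf i0E; split; [exists i0|].
Qed.

(** Jensen's inequality for the uniform mean, from the tangent of exp at s. It splits the total
    increment along a rotation into single steps, each multiplied by their number. *)
Lemma jensen_expR n (x : 'I_n.+1 -> R) :
  expR (\sum_i x i) <= n.+1%:R^-1 * \sum_i expR (n.+1%:R * x i).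
Proof.
have n0 : 0 < n.+1%:R :> R by rewrite ltr0n.
rewrite -(ler_pM2l n0) mulVKf ?gt_eqF//.
set s := \sum_i x i.
rewrite (@le_trans _ _ (\sum_(i < n.+1) expR s * (1 + (n.+1%:R * x i - s))))//.
  rewrite -mulr_sumr big_split/= sumr_const card_ord sumrB -mulr_sumr -/s.
  by rewrite sumr_const card_ord -[s *+ _]mulr_natl subrr addr0 mulrC.
apply: ler_sum => i _.
have -> : expR (n.+1%:R * x i) = expR s * expR (n.+1%:R * x i - s).
  by rewrite -expRD subrKC.
by rewrite ler_pM2l ?expR_gt0// expR_ge1Dx.
Qed.

(** Convexity between 0 and x: the tangent of exp at al x is compared with exp at both ends, with
    weights 1 - al and al. *)
Lemma expR_convex_le (al x : R) : 0 <= al <= 1 ->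
  expR (al * x) <= 1 - al + al * expR x.
Proof.
move=> /andP[a0 a1].
have e : 0 < expR (al * x) by exact: expR_gt0.
have h1 : expR (al * x) * (1 - al * x) <= 1.
  rewrite -[leRHS](expRxMexpNx_1 (al * x)) ler_pM2l//.
  by have := expR_ge1Dx (- (al * x)); lra.
have h2 : expR (al * x) * (1 + (1 - al) * x) <= expR x.
  have -> : expR x = expR (al * x) * expR ((1 - al) * x).
    by rewrite -expRD; congr expR; ring.
  by rewrite ler_pM2l// expR_ge1Dx.
nra.
Qed.

End FirstArgmax.

(** * Gaussian vectors described by their linear forms *)

Section GaussianVectors.
Context {R : realType} {d : measure_display} {T : measurableType d}.
Variable P : probability T R.

(* The characteristic function and exponential moment of a centred Gaussian of
   variance v, at frequency 1 only: the others come from the multiples of Z. *)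
Definition cgauss (Z : T -> R) (v : R) : Prop :=
  [/\ measurable_fun [set: T] Z,
      (\int[P]_w (expR (Z w))%:E = (expR (v / 2))%:E)%E
    & forall r, \int[P]_w cos (Z w + r) = expR (- (v / 2)) * cos r].

Definition linform n (a : 'I_n -> R) (X : 'I_n -> T -> R) (w : T) : R :=
  \sum_i a i * X i w.

Definition quadform n (C : 'I_n -> 'I_n -> R) (a : 'I_n -> R) : R :=
  \sum_i \sum_j a i * a j * C i j.

(* X and Y are independent centred Gaussian vectors of covariance C: the joint
   law is encoded by the laws of the linear forms. *)
Definition iid_gauss n (C : 'I_n -> 'I_n -> R) (X Y : 'I_n -> T -> R) : Prop :=
  forall a b : 'I_n -> R,
    cgauss (fun w => linform a X w + linform b Y w) (quadform C a + quadform C b).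

Lemma linform0 n (X : 'I_n -> T -> R) w : linform (fun=> 0) X w = 0.
Proof. by rewrite /linform big1// => i _; rewrite mul0r. Qed.

Lemma linformD n (a b : 'I_n -> R) X w :
  linform (fun i => a i + b i) X w = linform a X w + linform b X w.
Proof. by rewrite /linform -big_split; apply: eq_bigr => i _; rewrite mulrDl. Qed.

Lemma linformZ n (c : R) (a : 'I_n -> R) X w :
  linform (fun i => c * a i) X w = c * linform a X w.
Proof. by rewrite /linform mulr_sumr; apply: eq_bigr => i _; rewrite mulrA. Qed.

Lemma linform_delta n (i : 'I_n) X w : linform (fun j => (j == i)%:R) X w = X i w.
Proof.
rewrite /linform (bigD1 i)//= eqxx mul1r big1 ?addr0// => j ji.
by rewrite (negbTE ji) mul0r.
Qed.

Lemma quadform0 n (C : 'I_n -> 'I_n -> R) : quadform C (fun=> 0) = 0.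
Proof. by rewrite /quadform big1// => i _; rewrite big1// => j _; rewrite !mul0r. Qed.

Lemma quadformZ n (C : 'I_n -> 'I_n -> R) c a :
  quadform C (fun i => c * a i) = c ^+ 2 * quadform C a.
Proof.
rewrite /quadform mulr_sumr; apply: eq_bigr => i _.
by rewrite mulr_sumr; apply: eq_bigr => j _; ring.
Qed.

Lemma quadform_delta n (C : 'I_n -> 'I_n -> R) i :
  quadform C (fun j => (j == i)%:R) = C i i.
Proof.
rewrite /quadform (bigD1 i)//= [X in _ + X]big1 ?addr0; last first.
  by move=> j ji; rewrite big1// => k _; rewrite (negbTE ji) !mul0r.
rewrite (bigD1 i)//= eqxx !mul1r big1 ?addr0// => j ji.
by rewrite (negbTE ji) mulr0 mul0r.
Qed.

Lemma quadform_rot n (C : 'I_n -> 'I_n -> R) a b s c : s ^+ 2 + c ^+ 2 = 1 ->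
  quadform C (fun i => s * a i + c * b i) + quadform C (fun i => c * a i - s * b i) =
  quadform C a + quadform C b.
Proof.
move=> sc; rewrite /quadform -!big_split; apply: eq_bigr => i _ /=.
rewrite -!big_split; apply: eq_bigr => j _ /=.
rewrite -[RHS]mul1r -sc; ring.
Qed.

(** Linear forms of the rotated pair are linear forms of the pair with rotated coefficients, and the
    sum of the two quadratic forms is invariant. *)
Lemma iid_gauss_rot n (C : 'I_n -> 'I_n -> R) X Y s c : s ^+ 2 + c ^+ 2 = 1 ->
  iid_gauss C X Y ->
  iid_gauss C (fun i w => s * X i w + c * Y i w) (fun i w => c * X i w - s * Y i w).
Proof.
move=> sc XY a b.
have := XY (fun i => s * a i + c * b i) (fun i => c * a i - s * b i).
rewrite quadform_rot//; congr (cgauss _ _); apply/funext => w.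
rewrite /linform -!big_split; apply: eq_bigr => i _ /=; ring.
Qed.

Section Independence.
Variables (n : nat) (C : 'I_n -> 'I_n -> R) (X Y : 'I_n -> T -> R).
Hypothesis XY : iid_gauss C X Y.

Let cg (a : 'I_n -> R) (i : 'I_n) (t : R) :
  cgauss (fun w => linform a X w + t * Y i w) (quadform C a + t ^+ 2 * C i i).
Proof.
have := XY a (fun j => t * (j == i)%:R).
rewrite quadformZ quadform_delta; congr (cgauss _ _); apply/funext => w.
by rewrite linformZ linform_delta.
Qed.

Lemma cgauss_linform a : cgauss (linform a X) (quadform C a).
Proof.
have := XY a (fun=> 0); rewrite quadform0 addr0; congr (cgauss _ _).
by apply/funext => w; rewrite linform0 addr0.
Qed.

Lemma cgauss_right i t : cgauss (fun w => t * Y i w) (t ^+ 2 * C i i).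
Proof.
have := XY (fun=> 0) (fun j => t * (j == i)%:R).
rewrite quadform0 add0r quadformZ quadform_delta; congr (cgauss _ _).
by apply/funext => w; rewrite linformZ linform_delta linform0 add0r.
Qed.

Lemma measurable_linform a : measurable_fun [set: T] (linform a X).
Proof. by case: (cgauss_linform a). Qed.

Lemma measurable_left i : measurable_fun [set: T] (X i).
Proof.
have -> : X i = linform (fun j => (j == i)%:R) X.
  by apply/funext => w; rewrite linform_delta.
exact: measurable_linform.
Qed.

Lemma measurable_right i : measurable_fun [set: T] (Y i).
Proof.
have [m1 _ _] := cgauss_right i 1.
by move: m1; congr (measurable_fun _ _); apply/funext => w; rewrite mul1r.
Qed.

Lemma measurable_cos (Z : T -> R) r : measurable_fun [set: T] Z ->
  measurable_fun [set: T] (fun w => cos (Z w + r)).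
Proof.
move=> mZ; apply: (measurableT_comp (f := @cos R)).
  exact: continuous_measurable_fun (@continuous_cos R).
exact: measurable_funD.
Qed.

Lemma integrable_cos (Z : T -> R) r : measurable_fun [set: T] Z ->
  P.-integrable [set: T] (EFin \o (fun w => cos (Z w + r))).
Proof.
move=> mZ; apply: (@bounded_integrable_EFin _ _ _ _ _ 1) => [|x].
  exact: measurable_cos.
exact: cos_max.
Qed.

Lemma cgauss_integrable (Z : T -> R) v : cgauss Z v ->
  P.-integrable [set: T] (EFin \o (fun w => expR (Z w))).
Proof.
by case=> mZ Zv _; apply: ge0_integrable_EFin Zv => //; exact: measurableT_comp.
Qed.

(* E[rho | X] = 0, tested on trigonometric functions. *)
Definition cos_orthogonal (rho : T -> R) : Prop :=
  P.-integrable [set: T] (EFin \o rho) /\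
  forall a s, \int[P]_w (rho w * cos (linform a X w + s)) = 0.

(** The roles are exchanged: the centred cosine [k] of a linear form of X integrates to 0 against
    all cosines of [Y i], since the characteristic function factorizes, and therefore against exp(b
    Y_i) by [rho_expR]. *)
Lemma cos_orthogonal_expR i b :
  cos_orthogonal (fun w => expR (b * Y i w) - expR (b ^+ 2 * C i i / 2)).
Proof.
have [mbY bYE _] := cgauss_right i b.
have iE := cgauss_integrable (cgauss_right i b).
have iEN := cgauss_integrable (cgauss_right i (- b)).
have ic := integrable_EFin_cst P (expR (b ^+ 2 * C i i / 2)).
split; first exact: integrable_EFinB.
move=> a s; set c := expR _ in ic *.
have mX := measurable_linform a; have mY := measurable_right i.
have [_ _ cX] := cgauss_linform a.
pose e := \int[P]_w cos (linform a X w + s).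
pose k w := cos (linform a X w + s) - e.
have mk : measurable_fun [set: T] k.
  by apply: measurable_funB => //; exact: measurable_cos.
have kb w : `|k w| <= 1 + `|e|.
  by rewrite (le_trans (ler_normB _ _))// lerD2r cos_max.
have ik : P.-integrable [set: T] (EFin \o k) by exact: bounded_integrable_EFin mk kb.
have kcos t r : \int[P]_w (k w * cos (t * Y i w + r)) = 0.
  have [_ _ cY] := cgauss_right i t.
  have mtY : measurable_fun [set: T] (fun w => t * Y i w) by exact: measurable_funM.
  have [mp _ cp] := cg a i t; have [mn _ cn] := cg a i (- t).
  have kE w : k w * cos (t * Y i w + r) =
      2^-1 * (cos (linform a X w + t * Y i w + (s + r)) +
              cos (linform a X w + - t * Y i w + (s - r))) - e * cos (t * Y i w + r).
    have -> : linform a X w + t * Y i w + (s + r) =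
        (linform a X w + s) + (t * Y i w + r) by ring.
    have -> : linform a X w + - t * Y i w + (s - r) =
        (linform a X w + s) - (t * Y i w + r) by ring.
    rewrite /k; move: (linform a X w + s) (t * Y i w + r) => x y.
    by rewrite (cosB x) (cosD x); field.
  under eq_Rintegral do rewrite kE.
  have i1 := integrable_cos (s + r) mp; have i2 := integrable_cos (s - r) mn.
  have i3 := integrable_cos r mtY.
  rewrite RintegralB//; last 2 first.
  - by apply: integrable_EFinZ; exact: integrable_EFinD.
  - exact: integrable_EFinZ.
  rewrite !RintegralZl//; last exact: integrable_EFinD.
  rewrite RintegralD// cp cn cY /e cX sqrrN cosD cosB.
  by rewrite mulrDl opprD !expRD; field.
have := @rho_expR _ _ _ P k (Y i) ik mY kcos b.
have ikE : P.-integrable [set: T] (EFin \o (fun w => k w * expR `|b * Y i w|)).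
  have iS := integrable_EFinZ (1 + `|e|) (integrable_EFinD iE iEN).
  apply: le_integrable_EFin iS => [|w].
    apply: measurable_funM => //; apply: measurableT_comp => //.
    by apply: measurableT_comp.
  rewrite normrM; apply: ler_pM => //.
  rewrite ger0_norm ?expR_ge0// mulNr.
  by have [_|_] := ger0P (b * Y i w); rewrite ?lerDl ?lerDr expR_ge0.
move=> /(_ ikE); under eq_Rintegral do rewrite mulrBl.
have icE : P.-integrable [set: T]
    (EFin \o (fun w => cos (linform a X w + s) * expR (b * Y i w))).
  under eq_fun do rewrite mulrC.
  apply: (@integrable_EFinM_bounded _ _ _ _ _ _ 1) => //; first exact: measurable_cos.
  by move=> w; exact: cos_max.
have bYE' := RintegralE bYE.
rewrite RintegralB//; last exact: integrable_EFinZ.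
rewrite RintegralZl// bYE' => h.
under eq_Rintegral do rewrite mulrBl mulrC.
have icos := integrable_cos s mX.
by rewrite RintegralB// ?RintegralZl//; [rewrite mulrC|exact: integrable_EFinZ].
Qed.

Lemma measurable_gt_nat (Z : T -> R) (d0 : R) : measurable_fun [set: T] Z ->
  measurable_fun [set: T] (fun w => (d0 < Z w)%R%:R : R).
Proof.
move=> mZ.
have -> : (fun w => (d0 < Z w)%R%:R) = (fun w => \1_`]d0, +oo[ (Z w) : R).
  by apply/funext => w; rewrite indicE mem_setE in_itv/= andbT.
by apply: measurableT_comp mZ; exact: measurable_indic.
Qed.

(** [rho_gt] is applied to [rho] multiplied by a cosine of a linear form of X: times a cosine of
    [linform a X], this is again [rho] times cosines of linear forms. *)
Lemma cos_orthogonal_gt rho a d0 : cos_orthogonal rho ->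
  cos_orthogonal (fun w => rho w * (d0 < linform a X w)%R%:R).
Proof.
move=> [irho rho0]; have mD := measurable_linform a.
have mb := measurable_gt_nat d0 mD.
have b1 w : `|(d0 < linform a X w)%R%:R : R| <= 1.
  by case: (_ < _); rewrite ?normr1 ?normr0.
split; first exact: (integrable_EFinM_bounded mb b1).
move=> a1 s; have ma1 := measurable_linform a1.
have mc1 := measurable_cos s ma1.
have ik : P.-integrable [set: T] (EFin \o (fun w => rho w * cos (linform a1 X w + s))).
  by apply: (integrable_EFinM_bounded mc1) irho => w; exact: cos_max.
have := @rho_gt _ _ _ P _ _ ik mD _ d0.
under eq_Rintegral do rewrite mulrAC.
apply=> t r.
have E w : rho w * cos (linform a1 X w + s) * cos (t * linform a X w + r) =
  2^-1 * (rho w * cos (linform (fun i => a1 i + t * a i) X w + (s + r)) +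
          rho w * cos (linform (fun i => a1 i + - t * a i) X w + (s - r))).
  rewrite !linformD !linformZ.
  have -> : linform a1 X w + t * linform a X w + (s + r) =
      (linform a1 X w + s) + (t * linform a X w + r) by ring.
  have -> : linform a1 X w + - t * linform a X w + (s - r) =
      (linform a1 X w + s) - (t * linform a X w + r) by ring.
  move: (linform a1 X w + s) (t * linform a X w + r) => x y.
  by rewrite (cosB x) (cosD x); field.
under eq_Rintegral do rewrite E.
have i1 a' s' : P.-integrable [set: T] (EFin \o (fun w => rho w * cos (linform a' X w + s'))).
  have mc' := measurable_cos s' (measurable_linform a').
  by apply: (integrable_EFinM_bounded mc') irho => w; exact: cos_max.
rewrite RintegralZl//; last exact: integrable_EFinD.
by rewrite RintegralD// !rho0 addr0 mulr0.
Qed.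

Lemma cos_orthogonal_le rho a d0 : cos_orthogonal rho ->
  cos_orthogonal (fun w => rho w * (linform a X w <= d0)%R%:R).
Proof.
move=> rho0; have [i2 c2] := cos_orthogonal_gt a d0 rho0; have [i1 c1] := rho0.
have E w : rho w * (linform a X w <= d0)%R%:R =
    rho w - rho w * (d0 < linform a X w)%R%:R.
  by rewrite leNgt; case: (d0 < _); rewrite /= ?mulr1 ?mulr0 ?subrr ?subr0.
split; first by under eq_fun do rewrite E; exact: integrable_EFinB.
move=> a1 s; under eq_Rintegral do rewrite E mulrBl.
have mc := measurable_cos s (measurable_linform a1).
rewrite RintegralB// ?c1 ?c2 ?subrr//.
- by apply: (integrable_EFinM_bounded mc) i1 => w; exact: cos_max.
- by apply: (integrable_EFinM_bounded mc) i2 => w; exact: cos_max.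
Qed.

Lemma cos_orthogonal_prod (I : Type) (l : seq I) (p : pred I) (a : I -> 'I_n -> R)
    (d0 : I -> R) rho : cos_orthogonal rho ->
  cos_orthogonal (fun w => rho w *
    \prod_(j <- l) (if p j then d0 j < linform (a j) X w
                    else linform (a j) X w <= d0 j)%R%:R).
Proof.
move=> rho0; elim/last_ind: l => [|l j IH].
  by under eq_fun do rewrite big_nil mulr1.
under eq_fun do rewrite big_rcons/= mulrA.
by case: (p j); [exact: cos_orthogonal_gt|exact: cos_orthogonal_le].
Qed.

Lemma cos_orthogonal_expR_integral rho a : cos_orthogonal rho ->
  P.-integrable [set: T] (EFin \o (fun w => rho w * expR `|linform a X w|)) ->
  \int[P]_w (rho w * expR (linform a X w)) = 0.
Proof.
move=> [irho rho0] ie.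
have tr t r : \int[P]_w (rho w * cos (t * linform a X w + r)) = 0.
  have := rho0 (fun i => t * a i) r.
  by under eq_Rintegral do rewrite linformZ.
have ie1 : P.-integrable [set: T] (EFin \o (fun w => rho w * expR `|1 * linform a X w|)).
  by under eq_fun do rewrite mul1r.
have := rho_expR irho (measurable_linform a) tr ie1.
by under eq_Rintegral do rewrite mul1r.
Qed.

Section ArgmaxEvent.
Variables (b : 'I_n -> R) (i : 'I_n) (al be : R).
Let u w j := X j w + b j.
Let g w := argmax_ind (u w) i.

Let a (j : 'I_n) : 'I_n -> R := if (j < i)%N
  then fun k => (k == i)%:R + - 1 * (k == j)%:R
  else fun k => (k == j)%:R + - 1 * (k == i)%:R.
Let d0 (j : 'I_n) := if (j < i)%N then b j - b i else b i - b j.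

Let gE w : g w = \prod_(j < n) (if (j < i)%N then d0 j < linform (a j) X w
                    else linform (a j) X w <= d0 j)%R%:R.
Proof.
apply: eq_bigr => j _; rewrite /a /d0 /u; case: ifP => _.
- rewrite linformD linformZ !linform_delta; congr (nat_of_bool _)%:R; lra.
- rewrite linformD linformZ !linform_delta; congr (nat_of_bool _)%:R; lra.
Qed.

Lemma measurable_argmax_ind : measurable_fun [set: T] g.
Proof.
have -> : g = (fun w => \prod_(j < n) (if (j < i)%N then d0 j < linform (a j) X w
    else linform (a j) X w <= d0 j)%R%:R) by apply/funext => w; exact: gE.
apply: measurable_prod => j _; case: (_ < _)%N.
  by apply: measurable_gt_nat; exact: measurable_linform.
have E w : (linform (a j) X w <= d0 j)%R%:R = 1 - (d0 j < linform (a j) X w)%R%:R :> R.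
  by rewrite leNgt; case: (d0 j < _); rewrite ?subrr ?subr0.
under eq_fun do rewrite E.
apply: measurable_funB => //; apply: measurable_gt_nat; exact: measurable_linform.
Qed.

Let g_bound w : `|g w| <= 1.
Proof. by rewrite ger0_norm ?argmax_ind_le1// argmax_ind_ge0. Qed.

(* The indicator g of the first argmax being i is a product of indicators of
   half-spaces, to each of which cos_orthogonal extends. *)
Lemma argmax_independence :
  \int[P]_w (g w * expR (al * X i w + be * Y i w)) =
  expR (be ^+ 2 * C i i / 2) * \int[P]_w (g w * expR (al * X i w)).
Proof.
set c := expR _.
have mX := measurable_left i; have mY := measurable_right i.
have mg := measurable_argmax_ind.
pose al' k := al * (k == i)%:R : R.
have alE w : linform al' X w = al * X i w by rewrite linformZ linform_delta.
have iXY a1 b1 : P.-integrable [set: T] (EFin \o (fun w => expR (a1 * X i w + b1 * Y i w))).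
  have := XY (fun k => a1 * (k == i)%:R) (fun k => b1 * (k == i)%:R).
  move=> /cgauss_integrable; congr (P.-integrable _ _).
  by apply/funext => w /=; rewrite !linformZ !linform_delta.
have iX a1 : P.-integrable [set: T] (EFin \o (fun w => expR (a1 * X i w))).
  have := iXY a1 0; congr (P.-integrable _ _).
  by apply/funext => w /=; rewrite mul0r addr0.
have ho := cos_orthogonal_prod (index_enum 'I_n) (fun j => (j < i)%N) a d0
  (cos_orthogonal_expR i be).
have {}ho : cos_orthogonal (fun w => (expR (be * Y i w) - c) * g w).
  move: ho; congr cos_orthogonal; apply/funext => w.
  by rewrite gE.
have c0 : 0 <= c by exact: expR_ge0.
have iM : P.-integrable [set: T] (EFin \o (fun w =>
    (expR (al * X i w + be * Y i w) + expR (- al * X i w + be * Y i w)) +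
    c * (expR (al * X i w) + expR (- al * X i w)))).
  apply: integrable_EFinD; first exact: integrable_EFinD.
  by apply: integrable_EFinZ; exact: integrable_EFinD.
have ie : P.-integrable [set: T] (EFin \o (fun w =>
    (expR (be * Y i w) - c) * g w * expR `|linform al' X w|)).
  apply: le_integrable_EFin iM => [|w].
    apply: measurable_funM; [apply: measurable_funM => //|].
      by apply: measurable_funB => //; apply: measurableT_comp => //; exact: measurable_funM.
    apply: measurableT_comp => //; apply: measurableT_comp => //.
    exact: measurable_linform.
  rewrite alE normrM [`|_ * g w|]normrM.
  rewrite (@le_trans _ _ ((expR (be * Y i w) + c) * (expR (al * X i w) + expR (- al * X i w))))//.
    apply: ler_pM => //.
      rewrite -[leRHS]mulr1; apply: ler_pM => //.
      by rewrite (le_trans (ler_normB _ _))// !ger0_norm ?expR_ge0.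
    rewrite ger0_norm ?expR_ge0// mulNr.
    by have [_|_] := ger0P (al * X i w); rewrite ?lerDl ?lerDr expR_ge0.
  by rewrite !expRD mulrDl !mulrDr; lra.
have := cos_orthogonal_expR_integral ho ie.
have E w : (expR (be * Y i w) - c) * g w * expR (linform al' X w) =
    g w * expR (al * X i w + be * Y i w) - c * (g w * expR (al * X i w)).
  by rewrite alE expRD; ring.
under eq_Rintegral do rewrite E.
have ig1 : P.-integrable [set: T] (EFin \o (fun w => g w * expR (al * X i w + be * Y i w))).
  under eq_fun do rewrite mulrC.
  exact: (integrable_EFinM_bounded mg g_bound).
have ig2 : P.-integrable [set: T] (EFin \o (fun w => g w * expR (al * X i w))).
  under eq_fun do rewrite mulrC.
  exact: (integrable_EFinM_bounded mg g_bound).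
rewrite RintegralB// ?RintegralZl//; last exact: integrable_EFinZ.
by move/eqP; rewrite subr_eq0 => /eqP.
Qed.

End ArgmaxEvent.
End Independence.

Lemma Rintegral_sum (I : Type) (r : seq I) (f : I -> T -> R) :
  (forall i, P.-integrable [set: T] (EFin \o f i)) ->
  \int[P]_x (\sum_(i <- r) f i x) = \sum_(i <- r) \int[P]_x f i x.
Proof.
move=> fi; elim: r => [|i r IH].
  by under eq_Rintegral do rewrite big_nil; rewrite Rintegral_prob_cst big_nil.
under eq_Rintegral do rewrite big_cons.
by rewrite big_cons RintegralD// ?IH//; exact: integrable_EFin_sum.
Qed.

(** * Exponential moment of a single rotation step *)

Section OneStep.
Variables (n : nat) (C : 'I_n.+1 -> 'I_n.+1 -> R) (X Y : 'I_n.+1 -> T -> R).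
Hypothesis XY : iid_gauss C X Y.
Variables (b : 'I_n.+1 -> R) (sg2 : R).
Hypothesis Csg : forall i, C i i <= sg2.
Let u w j := X j w + b j.

Let iXY a1 b1 i : P.-integrable [set: T] (EFin \o (fun w => expR (a1 * X i w + b1 * Y i w))).
Proof.
have := XY (fun k => a1 * (k == i)%:R) (fun k => b1 * (k == i)%:R).
move=> /cgauss_integrable; congr (P.-integrable _ _).
by apply/funext => w /=; rewrite !linformZ !linform_delta.
Qed.

Let iX a1 i : P.-integrable [set: T] (EFin \o (fun w => expR (a1 * X i w))).
Proof.
have := iXY a1 0 i; congr (P.-integrable _ _).
by apply/funext => w /=; rewrite mul0r addr0.
Qed.

Let g_bound i w : `|argmax_ind (u w) i| <= 1.
Proof. by rewrite ger0_norm ?argmax_ind_le1// argmax_ind_ge0. Qed.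

Let mg i : measurable_fun [set: T] (fun w => argmax_ind (u w) i).
Proof. exact: (measurable_argmax_ind XY b i). Qed.

Lemma integrable_argmax al be : P.-integrable [set: T] (EFin \o
  (fun w => \sum_i argmax_ind (u w) i * expR (al * X i w + be * Y i w))).
Proof.
apply: integrable_EFin_sum => i _; under eq_fun do rewrite mulrC.
exact: (integrable_EFinM_bounded (mg i) (g_bound i)).
Qed.

(** Independence of [Y] from the argmax gives the sharp factor exp(be^2 sg2 / 2). The part in [al]
    is bounded crudely, the chosen coordinate being replaced by a sum over all of them; this is
    affordable because [al] will tend to 0. *)
Lemma argmax_step al be : 0 <= al <= 1 ->
  \int[P]_w (\sum_i argmax_ind (u w) i * expR (al * X i w + be * Y i w)) <=
  expR (be ^+ 2 * sg2 / 2) * (1 + al * (n.+1%:R * expR (sg2 / 2))).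
Proof.
move=> al01; have /andP[al0 al1] := al01.
have ig1 i : P.-integrable [set: T]
    (EFin \o (fun w => argmax_ind (u w) i * expR (al * X i w + be * Y i w))).
  under eq_fun do rewrite mulrC.
  exact: (integrable_EFinM_bounded (mg i) (g_bound i)).
have ig2 i : P.-integrable [set: T]
    (EFin \o (fun w => argmax_ind (u w) i * expR (al * X i w))).
  under eq_fun do rewrite mulrC.
  exact: (integrable_EFinM_bounded (mg i) (g_bound i)).
rewrite Rintegral_sum//.
under eq_bigr do rewrite (argmax_independence XY).
rewrite (@le_trans _ _ (\sum_i expR (be ^+ 2 * sg2 / 2) *
    \int[P]_w (argmax_ind (u w) i * expR (al * X i w))))//.
  apply: ler_sum => i _; rewrite ler_wpM2r//.
    by apply: Rintegral_ge0 => w _; rewrite mulr_ge0 ?expR_ge0// argmax_ind_ge0.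
  by rewrite ler_expR ler_wpM2r// ler_wpM2l// sqr_ge0.
rewrite -mulr_sumr ler_pM2l ?expR_gt0// -Rintegral_sum//.
have i1X i : P.-integrable [set: T] (EFin \o (fun w => expR (X i w))).
  by have := iX 1 i; under eq_fun do rewrite mul1r.
have i0 := integrable_EFin_cst P (1 : R).
have iS : P.-integrable [set: T] (EFin \o (fun w => \sum_i expR (X i w))).
  exact: integrable_EFin_sum.
have iaS := integrable_EFinZ al iS.
have -> : al * (n.+1%:R * expR (sg2 / 2)) = al * (\sum_(i < n.+1) expR (sg2 / 2)).
  by rewrite sumr_const card_ord mulr_natl.
rewrite (@le_trans _ _ (1 + al * \int[P]_w (\sum_i expR (X i w))))//.
  rewrite -{1}(Rintegral_prob_cst P 1) -RintegralZl// -RintegralD//.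
  apply: le_Rintegral => //; [exact: integrable_EFin_sum|exact: integrable_EFinD|].
  move=> w _; have [j _ ->] := argmax_indP (u w).
  rewrite (le_trans (expR_convex_le _ al01))//.
  apply: lerD; first by rewrite gerBl.
  rewrite ler_wpM2l// (bigD1 j)//= lerDl.
  by apply: sumr_ge0 => i _; exact: expR_ge0.
rewrite lerD2l ler_wpM2l// Rintegral_sum//; apply: ler_sum => i _.
have [_ XE _] := XY (fun k => 1 * (k == i)%:R) (fun=> 0).
rewrite quadformZ quadform0 quadform_delta expr1n mul1r addr0 in XE.
rewrite (@RintegralE _ _ _ P _ (expR (C i i / 2))).
  by rewrite ler_expR ler_wpM2r.
rewrite -XE; apply: eq_integral => w _.
by rewrite linform0 addr0 linformZ mul1r linform_delta.
Qed.

End OneStep.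

(** * Rotation from a Gaussian vector to its independent copy *)

Section MaximumDeviation.
Variables (n : nat) (C : 'I_n.+1 -> 'I_n.+1 -> R) (X Y : 'I_n.+1 -> T -> R).
Hypothesis XY : iid_gauss C X Y.
Variables (b : 'I_n.+1 -> R) (sg2 l : R).
Hypothesis Csg : forall i, C i i <= sg2.
Hypothesis sg0 : 0 <= sg2.
Hypothesis l0 : 0 <= l.
Let F (Z : 'I_n.+1 -> T -> R) w := maxf (fun i => Z i w + b i).

Let measurable_F (Z : 'I_n.+1 -> T -> R) Z' : iid_gauss C Z Z' ->
  measurable_fun [set: T] (F Z).
Proof.
move=> ZZ; apply: measurable_sum => i; apply: measurable_funM.
  exact: (measurable_argmax_ind ZZ b i).
by apply: measurable_funD => //; exact: (measurable_left ZZ).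
Qed.

Let XYsym : iid_gauss C Y X.
Proof.
move=> a1 a2; have := XY a2 a1; rewrite addrC; congr (cgauss _ _).
by apply/funext => w; rewrite addrC.
Qed.

Section Rotations.
Variable M : nat.
(** The quarter circle is cut into [m] steps of angle [delta]. [Xr j] runs from Y at j = 0 to X at j
    = m, and [Yr j] is its derivative in the angle. The factor [m] in [al] and [be] comes from
    Jensen's inequality: [al] is of order 1/m, while [be] tends to l pi / 2, whence the exponent l^2
    pi^2 sg2 / 8. *)
Let m : R := M.+1%:R.
Let delta : R := pi / (2 * m).
Let al := l * m * (1 - cos delta).
Let be := l * m * sin delta.
Let Xr (j : nat) i w := sin (j%:R * delta) * X i w + cos (j%:R * delta) * Y i w.
Let Yr (j : nat) i w := cos (j%:R * delta) * X i w - sin (j%:R * delta) * Y i w.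

Let m_gt0 : 0 < m. Proof. by rewrite ltr0n. Qed.

Let XYr j : iid_gauss C (Xr j) (Yr j).
Proof. by apply: iid_gauss_rot XY; rewrite addrC cos2Dsin2. Qed.

(** The start of a step is expressed at its end, because the argmax is taken at the end and is
    independent of [Yr j.+1]. *)
Let XrS j i w : Xr j i w = cos delta * Xr j.+1 i w - sin delta * Yr j.+1 i w.
Proof.
have -> : Xr j i w = sin (j.+1%:R * delta - delta) * X i w +
    cos (j.+1%:R * delta - delta) * Y i w.
  have -> : j.+1%:R * delta - delta = j%:R * delta by rewrite -natr1; ring.
  by [].
by rewrite sinB cosB /Xr /Yr; ring.
Qed.

Let Fstep j w : expR (m * (l * (F (Xr j.+1) w - F (Xr j) w))) <=
  \sum_i argmax_ind (fun k => Xr j.+1 k w + b k) i *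
     expR (al * Xr j.+1 i w + be * Yr j.+1 i w).
Proof.
have [k kmax kE] := argmax_indP (fun k => Xr j.+1 k w + b k).
rewrite {1}/F /maxf !kE ler_expR.
have [_ /(_ k)] := maxfP (fun i => Xr j i w + b i).
rewrite -/(F _ w) XrS => h.
have ml : 0 <= m * l by rewrite mulr_ge0// ltW.
rewrite mulrA (@le_trans _ _ (m * l * ((1 - cos delta) * Xr j.+1 k w + sin delta * Yr j.+1 k w)))//.
  rewrite ler_wpM2l//; lra.
by rewrite /al /be; lra.
Qed.

Let Fbound w : expR (l * (F X w - F Y w)) <= m^-1 * \sum_(j < M.+1)
  \sum_i argmax_ind (fun k => Xr j.+1 k w + b k) i *
     expR (al * Xr j.+1 i w + be * Yr j.+1 i w).
Proof.
have XE : X = Xr M.+1.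
  apply/funext => i; apply/funext => w'; rewrite /Xr -/m.
  have -> : m * delta = pi / 2 by rewrite /delta; field; rewrite gt_eqF.
  by rewrite sin_pihalf cos_pihalf mul1r mul0r addr0.
have YE : Y = Xr 0.
  apply/funext => i; apply/funext => w'; rewrite /Xr.
  by rewrite mul0r sin0 cos0 mul1r mul0r add0r.
have -> : l * (F X w - F Y w) = \sum_(j < M.+1) (l * (F (Xr j.+1) w - F (Xr j) w)).
  rewrite -mulr_sumr -(big_mkord xpredT (fun j => F (Xr j.+1) w - F (Xr j) w)).
  by rewrite telescope_sumr// -XE -YE.
rewrite (le_trans (jensen_expR _))// ler_pM2l ?invr_gt0//.
by apply: ler_sum => j _; exact: Fstep.
Qed.

Let iG j : P.-integrable [set: T] (EFin \o (fun w =>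
  \sum_i argmax_ind (fun k => Xr j k w + b k) i *
     expR (al * Xr j i w + be * Yr j i w))).
Proof. exact: integrable_argmax. Qed.

Lemma integrable_maxf_diff :
  P.-integrable [set: T] (EFin \o (fun w => expR (l * (F X w - F Y w)))).
Proof.
apply: (@le_integrable_EFin _ _ _ _ _ (fun w => m^-1 * \sum_(j < M.+1)
  \sum_i argmax_ind (fun k => Xr j.+1 k w + b k) i *
     expR (al * Xr j.+1 i w + be * Yr j.+1 i w))) => [|w|].
- apply: measurableT_comp => //; apply: measurable_funM => //.
  by apply: measurable_funB; [exact: measurable_F XY|exact: measurable_F XYsym].
- by rewrite ger0_norm ?expR_ge0.
- by apply: integrable_EFinZ; apply: integrable_EFin_sum => j _; exact: iG.
Qed.

(** As 1 - cos delta <= delta^2 / 2, [al] is at most l pi^2 / (8 m), so that the hypothesis on [m]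
    ensures al <= 1; |sin delta| <= delta gives be^2 <= l^2 pi^2 / 4. *)
Lemma maxf_diff_le_approx : l * pi ^+ 2 / 8 <= m ->
  \int[P]_w expR (l * (F X w - F Y w)) <=
  expR (l ^+ 2 * pi ^+ 2 * sg2 / 8) *
    (1 + l * pi ^+ 2 / 8 * (n.+1%:R * expR (sg2 / 2)) / m).
Proof.
move=> lm; have pi0 : 0 < pi :> R := pi_gt0 R.
have d0 : 0 < delta by rewrite divr_gt0// mulr_gt0.
have md : m * delta = pi / 2 by rewrite /delta; field; rewrite gt_eqF.
have al0 : 0 <= al by rewrite mulr_ge0 ?(mulr_ge0 l0) ?(ltW m_gt0)// subr_ge0 cos_le1.
have alm : al <= l * pi ^+ 2 / 8 / m.
  rewrite /al (@le_trans _ _ (l * m * (delta ^+ 2 / 2)))//.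
    by rewrite ler_wpM2l ?ler_1subcos// mulr_ge0// ltW.
  suff -> : l * m * (delta ^+ 2 / 2) = l * pi ^+ 2 / 8 / m by [].
  by rewrite /delta; field; rewrite gt_eqF.
have al1 : al <= 1.
  by rewrite (le_trans alm)// ler_pdivrMr// mul1r.
have be2 : be ^+ 2 <= l ^+ 2 * pi ^+ 2 / 4.
  have s2 : sin delta ^+ 2 <= delta ^+ 2.
    rewrite -[leLHS]real_normK ?num_real// -[leRHS]real_normK ?num_real//.
    by rewrite lerXn2r ?nnegrE// ler_norm_sin.
  have -> : l ^+ 2 * pi ^+ 2 / 4 = (l * m) ^+ 2 * delta ^+ 2.
    have -> : (l * m) ^+ 2 * delta ^+ 2 = l ^+ 2 * (m * delta) ^+ 2 by ring.
    by rewrite md; field.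
  by rewrite exprMn ler_wpM2l// sqr_ge0.
rewrite (@le_trans _ _ (m^-1 * \sum_(j < M.+1) (expR (be ^+ 2 * sg2 / 2) *
    (1 + al * (n.+1%:R * expR (sg2 / 2))))))//.
  have iS : P.-integrable [set: T] (EFin \o (fun w => \sum_(j < M.+1)
    \sum_i argmax_ind (fun k => Xr j.+1 k w + b k) i *
     expR (al * Xr j.+1 i w + be * Yr j.+1 i w))).
    by apply: integrable_EFin_sum => j _; exact: iG.
  apply: (@le_trans _ _ (\int[P]_w (m^-1 * \sum_(j < M.+1)
    \sum_i argmax_ind (fun k => Xr j.+1 k w + b k) i *
     expR (al * Xr j.+1 i w + be * Yr j.+1 i w)))).
    by apply: le_Rintegral => //; [exact: integrable_maxf_diff|exact: integrable_EFinZ].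
  rewrite RintegralZl// ler_pM2l ?invr_gt0// Rintegral_sum//.
  apply: ler_sum => j _; apply: (argmax_step (XYr j.+1)) => //.
  by rewrite al0.
rewrite sumr_const card_ord -[_ *+ _]mulr_natl -/m mulKf ?gt_eqF//.
apply: ler_pM; rewrite ?expR_ge0 ?addr_ge0 ?mulr_ge0 ?expR_ge0//.
  by rewrite ler_expR; have := ler_wpM2r sg0 be2; lra.
have K0 : 0 <= n.+1%:R * expR (sg2 / 2) by rewrite mulr_ge0 ?expR_ge0.
by rewrite lerD2l [leRHS]mulrAC ler_wpM2r.
Qed.

End Rotations.

(** The left side does not depend on the number of steps, while the error factor, although it grows
    with [n], tends to 1 when this number does. *)
Lemma maxf_diff_mgf : (\int[P]_w (expR (l * (F X w - F Y w)))%:E <=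
  (expR (l ^+ 2 * pi ^+ 2 * sg2 / 8))%:E)%E.
Proof.
rewrite Rintegral_EFin; last exact: (integrable_maxf_diff 0).
rewrite lee_fin; set E := expR (_ / 8).
set c := l * pi ^+ 2 / 8 * (n.+1%:R * expR (sg2 / 2)).
apply/ler_addgt0Pr => e e0.
(* Enough steps for [maxf_diff_le_approx] to apply and for the error to be at most [e]. *)
pose M := Num.truncn (Num.max (l * pi ^+ 2 / 8) (E * c / e)).
have Mgt : Num.max (l * pi ^+ 2 / 8) (E * c / e) < M.+1%:R by exact: truncnS_gt.
have m0 : 0 < M.+1%:R :> R by rewrite ltr0n.
move: Mgt; rewrite gt_max => /andP[M1 M2].
rewrite (le_trans (maxf_diff_le_approx (ltW M1)))// -/E -/c mulrDr mulr1 lerD2l.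
by rewrite mulrA ler_pdivrMr// [leRHS]mulrC -ler_pdivrMr// ltW.
Qed.

End MaximumDeviation.
End GaussianVectors.

(** * Independent copies on the product space *)

Section IndependentCopies.
Context {R : realType} {d : measure_display} {T : measurableType d}.
Variable P : probability T R.
Local Notation P2 := (P \x P)%E.

Lemma ge0_integral_prod (f g : T -> R) :
  measurable_fun [set: T] f -> measurable_fun [set: T] g ->
  (forall x, 0 <= f x) -> (forall x, 0 <= g x) ->
  (\int[P2]_z (f z.1 * g z.2)%:E =
   \int[P]_x (f x)%:E * \int[P]_x (g x)%:E)%E.
Proof.
move=> mf mg f0 g0; rewrite fubini_tonelli1.
- rewrite /fubini_F.
  under eq_integral => x _.
    under eq_integral do rewrite EFinM.
    rewrite /= ge0_integralZl_EFin//; last 2 first.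
    - by move=> y _; rewrite lee_fin.
    - exact/measurable_EFinP.
    over.
  rewrite /= ge0_integralZr//.
  - exact/measurable_EFinP.
  - by move=> x _; rewrite lee_fin.
  - by apply: integral_ge0 => y _; rewrite lee_fin.
- apply/measurable_EFinP; apply: measurable_funM.
    exact: (measurableT_comp mf measurable_fst).
  exact: (measurableT_comp mg measurable_snd).
- by move=> x; rewrite lee_fin mulr_ge0.
Qed.

Lemma Rintegral_prod (f g : T -> R) (M : R) :
  measurable_fun [set: T] f -> measurable_fun [set: T] g ->
  (forall x, `|f x| <= M) -> (forall x, `|g x| <= M) ->
  \int[P2]_z (f z.1 * g z.2) = \int[P]_x f x * \int[P]_x g x.
Proof.
move=> mf mg fM gM.
have i2 : P2.-integrable [set: T * T] (EFin \o (fun z => f z.1 * g z.2)).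
  apply: (@bounded_integrable_EFin _ _ _ P2 _ (M * M)).
    apply: measurable_funM.
      exact: (measurableT_comp mf measurable_fst).
    exact: (measurableT_comp mg measurable_snd).
  by move=> z; rewrite normrM ler_pM.
have if_ := bounded_integrable_EFin P mf fM.
have ig := bounded_integrable_EFin P mg gM.
rewrite {1}/Rintegral -(integral12_prod_meas1 i2) /fubini_F.
have E x : (\int[P]_y (f x * g y)%:E = (f x * (\int[P]_y g y)%R)%:E)%E.
  by rewrite -(RintegralZl _ measurableT ig)//= Rintegral_EFin//; exact: integrable_EFinZ.
rewrite /= (eq_integral (fun x => (f x * (\int[P]_y g y)%R)%:E)); last first.
  by move=> x _; exact: E.
by rewrite -RintegralZr.
Qed.

Lemma iid_gauss_prod n (C : 'I_n -> 'I_n -> R) (X : 'I_n -> T -> R) :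
  (forall a, cgauss P (linform a X) (quadform C a)) ->
  iid_gauss P2 C (fun i z => X i z.1) (fun i z => X i z.2).
Proof.
move=> XC a b; have [ma Ea ca] := XC a; have [mb Eb cb] := XC b.
have ma1 : measurable_fun [set: T * T] (fun z => linform a X z.1).
  exact: (measurableT_comp ma measurable_fst).
have mb2 : measurable_fun [set: T * T] (fun z => linform b X z.2).
  exact: (measurableT_comp mb measurable_snd).
split; first exact: measurable_funD.
- transitivity (\int[P2]_z (expR (linform a X z.1) * expR (linform b X z.2))%:E)%E.
    by apply: eq_integral => z _; rewrite -expRD.
  rewrite (ge0_integral_prod (f := fun w => expR (linform a X w))
    (g := fun w => expR (linform b X w)))//.
  + by rewrite Ea Eb -EFinM -expRD; congr (expR _)%:E; lra.
  + exact: measurableT_comp.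
  + exact: measurableT_comp.
- move=> r.
  (* cos(x + r + y) = cos(x + r) cos y - sin(x + r) sin y, with the sines written as shifted
     cosines; the second product integrates to 0 because E sin y = 0. *)
  pose f1 w := cos (linform a X w + r); pose g1 w := cos (linform b X w + 0).
  pose f2 w := cos (linform a X w + (r - pi / 2)).
  pose g2 w := cos (linform b X w + - (pi / 2)).
  have E z : cos (linform a X z.1 + linform b X z.2 + r) =
      f1 z.1 * g1 z.2 - f2 z.1 * g2 z.2.
    rewrite /f1 /f2 /g1 /g2 addr0 addrA !cosBpihalf -cosD; congr cos; ring.
  transitivity (\int[P2]_z (f1 z.1 * g1 z.2 - f2 z.1 * g2 z.2)).
    by apply: eq_Rintegral => z _; rewrite -E.
  have mf1 : measurable_fun [set: T] f1 by exact: measurable_cos.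
  have mf2 : measurable_fun [set: T] f2 by exact: measurable_cos.
  have mg1 : measurable_fun [set: T] g1 by exact: measurable_cos.
  have mg2 : measurable_fun [set: T] g2 by exact: measurable_cos.
  have b1 w : `|f1 w| <= 1 by exact: cos_max.
  have b2 w : `|f2 w| <= 1 by exact: cos_max.
  have c1 w : `|g1 w| <= 1 by exact: cos_max.
  have c2 w : `|g2 w| <= 1 by exact: cos_max.
  have ip (f g : T -> R) : measurable_fun [set: T] f -> measurable_fun [set: T] g ->
      (forall w : T, `|f w| <= 1) -> (forall w, `|g w| <= 1) ->
      P2.-integrable [set: T * T] (EFin \o (fun z => f z.1 * g z.2)).
    move=> mf mg f1' g1'; apply: (@bounded_integrable_EFin _ _ _ P2 _ 1).
      apply: measurable_funM.
        exact: (measurableT_comp mf measurable_fst).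
      exact: (measurableT_comp mg measurable_snd).
    by move=> z; rewrite normrM mulr_ile1.
  rewrite RintegralB//; [|exact: ip|exact: ip].
  rewrite (Rintegral_prod mf1 mg1 b1 c1) (Rintegral_prod mf2 mg2 b2 c2).
  rewrite /f1 /f2 /g1 /g2 ca ca cb cb cosN cos_pihalf !mulr0 subr0 cos0 mulr1.
  by rewrite mulrAC -expRD; congr (expR _ * _); lra.
Qed.

End IndependentCopies.

(** * Truncated variation of a continuous path *)

Section TruncatedVariationPath.
Context {R : realType}.
Implicit Types (f : R -> R) (c S : R).

Lemma continuous_at_nonneg f (x e : R) :
  {within `[0, +oo[, continuous f} -> 0 <= x -> 0 < e ->
  exists2 r : R, 0 < r & forall y, 0 <= y -> `|y - x| < r -> `|f y - f x| < e.
Proof.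
move=> /subspace_continuousP cf x0 e0.
have /cvgrPdist_lt/(_ _ e0) : f @ within `[0, +oo[ (nbhs x) --> f x.
  by apply: cf; rewrite /= in_itv/= x0.
move=> [r /= r0 h]; exists r => // y y0 yx.
by rewrite distrC; apply: h; rewrite /= ?in_itv/= ?y0// distrC.
Qed.

Lemma segment_uniform_continuity f S c : {within `[0, +oo[, continuous f} ->
  0 < c -> exists2 r : R, 0 < r & forall x y, 0 <= x <= S -> 0 <= y <= S ->
  `|y - x| < r -> `|f y - f x| <= c.
Proof.
move=> cf c0.
pose Q (r x : R) := forall y, 0 <= y <= S -> `|y - x| < r -> `|f y - f x| <= c.
have cov : near_covering_within (`[0, S]%classic : set R).
  by apply/near_covering_withinP/compact_near_coveringP; exact: segment_compact.
(* Compactness in near-covering form, along radii tending to 0 from the right: a radius good near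
   each point yields one good on the whole segment. *)
have := cov R (0^'+) Q _.
have c2 : 0 < c / 2 by rewrite divr_gt0.
case=> [x|r /= r0 h].
  rewrite /= in_itv/= => /andP[x0 xS].
  have [r r0 hr] := continuous_at_nonneg cf x0 c2.
  have r2 : 0 < r / 2 by rewrite divr_gt0.
  exists ([set x' | `|x' - x| < r / 2], [set r' | r' < r / 2]).
    split => /=.
      by exists (r / 2) => //= z /=; rewrite distrC.
    by exists (r / 2) => //= z /=; rewrite sub0r normrN => /ltr_normlP[].
  move=> [x' r'] /= [xx' rr']; rewrite in_itv/= => /andP[x'0 x'S] y /andP[y0 yS] yx'.
  have h1 : `|f y - f x| < c / 2.
    apply: hr => //; rewrite (_ : y - x = (y - x') + (x' - x)); last by ring.
    by rewrite (le_lt_trans (ler_normD _ _))//; lra.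
  have h2 : `|f x' - f x| < c / 2 by apply: hr => //; lra.
  rewrite (_ : f y - f x' = (f y - f x) - (f x' - f x)); last by ring.
  by rewrite (le_trans (ler_normB _ _))//; lra.
exists (r / 2) => [|x y xS yS yx]; first by rewrite divr_gt0.
have r2 : 0 < r / 2 by rewrite divr_gt0.
have br : ball_ Num.norm 0 r (r / 2).
  by rewrite /= sub0r normrN ger0_norm ?ltW// ltr_pdivrMr//; lra.
by apply: (h (r / 2) br r2 x) => //=; rewrite in_itv.
Qed.

Lemma segment_bounded f S : {within `[0, +oo[, continuous f} -> 0 <= S ->
  exists2 M : R, 0 <= M & forall x, 0 <= x <= S -> `|f x| <= M.
Proof.
move=> cf S0.
have cS : {within `[0, S], continuous f}.
  by apply: continuous_subspaceW cf => x /=; rewrite !in_itv/= => /andP[->].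
have [c1 _ h1] := EVT_max S0 cS; have [c2 _ h2] := EVT_min S0 cS.
exists (`|f c1| + `|f c2|) => [|x xS]; first by rewrite addr_ge0.
have {}h1 := h1 x _; have {}h2 := h2 x _; rewrite in_itv/= xS in h1 h2.
have := ler_norm (f c1); have := ler_norm (- f c2); rewrite normrN.
have := h1 isT; have := h2 isT; rewrite ler_norml.
have := normr_ge0 (f c1); have := normr_ge0 (f c2).
by move=> *; apply/andP; split; lra.
Qed.

Lemma interlaced_bounds (s t : R) n (a b : nat -> R) i : interlaced s t n a b ->
  (i <= n)%N -> s <= a i /\ b i <= t.
Proof.
move=> [sa ab ba bt] iN; split.
  elim: i iN => [//|i IH] iN; rewrite (le_trans (IH (ltnW iN)))// ltW//.
  by rewrite (lt_trans (ab i (ltnW iN)))// ba.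
have : forall k, (k <= n)%N -> b (n - k)%N <= t.
  elim=> [_|k IH kn]; first by rewrite subn0.
  have kn' : (n - k.+1 < n)%N by rewrite ltn_subrL (leq_trans _ kn).
  rewrite (le_trans _ (IH (ltnW kn)))// ltW//.
  rewrite (lt_trans (ba _ kn'))// subnSK// ab// leq_subr//.
by move=> /(_ (n - i)%N (leq_subr _ _)); rewrite subKn.
Qed.

Lemma interlaced_length (s t : R) n (a b : nat -> R) : interlaced s t n a b ->
  \sum_(i < n.+1) (b i - a i) <= t - s.
Proof.
move=> [sa ab ba bt]; suff h k : (k <= n)%N -> \sum_(i < k.+1) (b i - a i) <= b k - s.
  by rewrite (le_trans (h n _))// lerD2r.
elim: k => [_|k IH kn]; first by rewrite big_ord_recl big_ord0 addr0 lerD2l lerN2.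
rewrite big_ord_recr/=; have := IH (ltnW kn); have := ba k kn; lra.
Qed.

(** On an interval shorter than [r] the path gains at most [c], so that the truncated gain is 0. On
    any other interval the gain is at most 2 M, hence at most 2 M / r times its length, and the
    lengths add up to at most [S]. *)
Lemma UTV_lty f c S : {within `[0, +oo[, continuous f} -> 0 < c -> 0 <= S ->
  (UTV c f 0 S < +oo)%E.
Proof.
move=> cf c0 S0.
have [r r0 hr] := segment_uniform_continuity S cf c0.
have [M M0 hM] := segment_bounded cf S0.
apply: (@le_lt_trans _ _ (2 * M / r * S)%:E); last exact: ltry.
apply: ge_ereal_sup => _ [n [a [b [ilac ->]]]]; rewrite lee_fin.
have Mr : 0 <= 2 * M / r by rewrite divr_ge0 ?mulr_ge0// ltW.
rewrite (@le_trans _ _ (2 * M / r * \sum_(i < n.+1) (b i - a i)))//; last first.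
  by rewrite ler_wpM2l// (le_trans (interlaced_length ilac))// subr0.
rewrite mulr_sumr; apply: ler_sum => -[i /= iN] _.
have [a0 bS] := interlaced_bounds ilac iN; have [_ ab _ _] := ilac.
have {}ab := ab i iN; rewrite ge_max; apply/andP; split; last first.
  by rewrite mulr_ge0// subr_ge0 ltW.
have aS : 0 <= a i <= S by rewrite a0/=; lra.
have bS' : 0 <= b i <= S by rewrite bS andbT; lra.
have [lt_r|ge_r] := ltP (b i - a i) r.
  rewrite (@le_trans _ _ 0)//; last by rewrite mulr_ge0// subr_ge0 ltW.
  have := hr (a i) (b i) aS bS'; rewrite gtr0_norm ?subr_gt0// => /(_ lt_r).
  by have := ler_norm (f (b i) - f (a i)); lra.
rewrite (@le_trans _ _ (2 * M))//.
  have := hM _ aS; have := hM _ bS'; rewrite !ler_norml => /andP[? ?] /andP[? ?]; lra.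
by rewrite mulrAC ler_pdivlMr// ler_wpM2l// mulr_ge0.
Qed.

Lemma UTV_ge0 f c S : 0 < S -> (0 <= UTV c f 0 S)%E.
Proof.
move=> S0; apply: (@le_trans _ _ (\sum_(i < 1) Num.max (f S - f 0 - c) 0)%:E).
  by rewrite lee_fin big_ord_recl big_ord0 addr0 le_max lexx orbT.
apply: ereal_sup_ubound; exists 0%N, (fun=> 0), (fun=> S); split => //.
Qed.

Lemma ratr_dense_right f (x y e : R) : {within `[0, +oo[, continuous f} ->
  0 <= x -> x < y -> 0 < e ->
  exists q : rat, x < ratr q < y /\ `|f (ratr q) - f x| < e.
Proof.
move=> cf x0 xy e0; have [r r0 hr] := continuous_at_nonneg cf x0 e0.
have /rat_in_itvoo[q] : x < Num.min y (x + r) by rewrite lt_min xy ltrDl.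
rewrite in_itv/= lt_min => /and3P[xq qy qr]; exists q; rewrite xq qy; split=> //.
by apply: hr; [exact: ltW (le_lt_trans x0 xq)|rewrite gtr0_norm ?subr_gt0// ltrBlDl].
Qed.

Lemma ratr_dense_left f (x y e : R) : {within `[0, +oo[, continuous f} ->
  0 <= x -> x < y -> 0 < e ->
  exists q : rat, x < ratr q < y /\ `|f (ratr q) - f y| < e.
Proof.
move=> cf x0 xy e0; have y0 := ltW (le_lt_trans x0 xy).
have [r r0 hr] := continuous_at_nonneg cf y0 e0.
have /rat_in_itvoo[q] : Num.max x (y - r) < y by rewrite gt_max xy gtrBl.
rewrite in_itv/= gt_max => /andP[/andP[xq qr] qy]; exists q; rewrite xq qy; split=> //.
apply: hr; first exact: ltW (le_lt_trans x0 xq).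
by rewrite ltr0_norm ?subr_lt0// opprB ltrBlDr -ltrBlDl.
Qed.

(* (n, a, b, J): the rational partition points a 0 < b 0 < ... < a n < b n
   together with the set J of the intervals that are summed over. *)
Definition rat_partition : Type := (nat * seq rat * seq rat * seq bool)%type.

Implicit Types (q : rat_partition).

Definition rp_left q i : R := ratr (nth 0 q.1.1.2 i).
Definition rp_right q i : R := ratr (nth 0 q.1.2 i).
Definition rp_mask q i : R := (nth false q.2 i)%:R.

Definition rp_valid S q : Prop := interlaced 0 S q.1.1.1 (rp_left q) (rp_right q).

(** The mask replaces the positive parts by a free choice of intervals, which makes the sum affine
    in [f]. *)
Definition rp_sum c f q : R :=
  \sum_(i < q.1.1.1.+1) rp_mask q i * (f (rp_right q i) - f (rp_left q i) - c).

Lemma rp_sum_le_UTV f c S q : rp_valid S q -> ((rp_sum c f q)%:E <= UTV c f 0 S)%E.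
Proof.
move=> qS; apply: (@le_trans _ _ (\sum_(i < q.1.1.1.+1)
    Num.max (f (rp_right q i) - f (rp_left q i) - c) 0)%:E); last first.
  by apply: ereal_sup_ubound; exists q.1.1.1, (rp_left q), (rp_right q).
rewrite lee_fin; apply: ler_sum => i _; rewrite /rp_mask.
by case: nth; rewrite ?mul1r ?mul0r le_max lexx ?orbT.
Qed.

Lemma UTV_approx f c S (x : R) : {within `[0, +oo[, continuous f} ->
  (x%:E < UTV c f 0 S)%E -> exists2 q, rp_valid S q & x < rp_sum c f q.
Proof.
move=> cf /ereal_sup_gt[_ [n [a [b [ilac ->]]]]]; rewrite lte_fin => xlt.
have [_ ab ba _] := ilac.
set s := \sum_(i < _) _ in xlt.
(* Moving the two ends of an interval costs at most 2 e, hence (s - x) / 2 in all. The rational ends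
   are taken inside the original intervals, so that they remain interlaced. *)
pose e := (s - x) / (4 * n.+1%:R).
have n0 : 0 < n.+1%:R :> R by rewrite ltr0n.
have e0 : 0 < e by rewrite divr_gt0 ?subr_gt0// mulr_gt0.
have eE : n.+1%:R * (4 * e) = s - x by rewrite /e; field; rewrite gt_eqF.
have pq i : exists pq : rat * rat, (i <= n)%N ->
  [/\ a i < ratr pq.1, ratr pq.1 < ratr pq.2 :> R, ratr pq.2 < b i,
      `|f (ratr pq.1) - f (a i)| < e & `|f (ratr pq.2) - f (b i)| < e].
  have [iN|_] := leqP i n; last by exists (0, 0).
  have [a0 bS] := interlaced_bounds ilac iN.
  have abi := ab i iN.
  have [p [/andP[ap pb] fp]] := ratr_dense_right cf a0 abi e0.
  have p0 : 0 <= ratr p :> R by exact: ltW (le_lt_trans a0 ap).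
  have [q [/andP[pq qb] fq]] := ratr_dense_left cf p0 pb e0.
  by exists (p, q) => _; split.
have [pq' hpq] := choice pq.
(* The mask is decided on the original ends, where it reproduces the positive parts exactly. *)
pose J i := 0 < f (b i) - f (a i) - c.
pose q : rat_partition := (n, mkseq (fun i => (pq' i).1) n.+1,
  mkseq (fun i => (pq' i).2) n.+1, mkseq J n.+1).
have qa i : (i <= n)%N -> rp_left q i = ratr (pq' i).1.
  by move=> iN; rewrite /rp_left nth_mkseq.
have qb i : (i <= n)%N -> rp_right q i = ratr (pq' i).2.
  by move=> iN; rewrite /rp_right nth_mkseq.
exists q.
  have [a0 _] := interlaced_bounds ilac (leq0n n).
  have [_ bS] := interlaced_bounds ilac (leqnn n).
  split => [|i iN|i iN|].
  - by rewrite qa//; have [h _ _ _ _] := hpq 0%N (leq0n n); rewrite (le_trans a0)// ltW.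
  - by rewrite qa// qb//; have [_ h _ _ _] := hpq i iN.
  - have iN' : (i.+1 <= n)%N by []; rewrite qb ?(ltnW iN)// qa//.
    have [_ _ h _ _] := hpq i (ltnW iN); have [h' _ _ _ _] := hpq i.+1 iN.
    by rewrite (lt_trans h)// (lt_trans (ba _ iN)).
  - by rewrite qb//; have [_ _ h _ _] := hpq n (leqnn n); rewrite (le_trans _ bS)// ltW.
have : s - n.+1%:R * (2 * e) <= rp_sum c f q; last first.
  by apply: lt_le_trans; move: eE xlt; lra.
have -> : n.+1%:R * (2 * e) = \sum_(i < n.+1) (2 * e).
  by rewrite sumr_const card_ord mulr_natl.
rewrite /s -sumrB; apply: ler_sum => -[i /= iN] _.
rewrite /rp_mask qa// qb// nth_mkseq//.
have [_ _ _ ] := hpq i iN; rewrite !ltr_norml => /andP[? ?] /andP[? ?].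
rewrite /J; case: ltP => h /=; rewrite ?mul1r ?mul0r; lra.
Qed.

End TruncatedVariationPath.

(** * Linear functionals of fractional Brownian motion *)

Section GaussianLaw.
Context {R : realType} {d : measure_display} {T : measurableType d}.
Variable P : probability T R.

Lemma gaussian_rv_integrable (Z : T -> R) : gaussian_rv P Z ->
  P.-integrable [set: T] (EFin \o Z).
Proof. by move=> [mZ [m [s lawZ]]]; exact: gaussian_integrable lawZ. Qed.

Lemma centered_gaussian_rv (Z : T -> R) : gaussian_rv P Z ->
  \int[P]_w Z w = 0 ->
  [/\ P.-integrable [set: T] (EFin \o (fun w => Z w ^+ 2)),
      cgauss P Z (\int[P]_w (Z w ^+ 2))
    & exists2 s : R, s ^+ 2 = \int[P]_w (Z w ^+ 2) &
        forall A : set R, measurable A ->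
        P (Z @^-1` A) = (if s == 0 then \d_(0 : R) A else normal_prob 0 s A)].
Proof.
move=> [mZ [m [s lawZ]]] EZ.
have m0 := gaussian_mean0 mZ lawZ EZ; rewrite m0 in lawZ.
rewrite (gaussian_variance mZ lawZ); split.
- exact: gaussian_sqr_integrable lawZ.
- split => //.
  + have := gaussian_mgf mZ lawZ 1; rewrite mul0r add0r expr1n mul1r => <-.
    by apply: eq_integral => w _; rewrite mul1r.
  + move=> r; have := gaussian_cf mZ lawZ 1 r; rewrite expr1n mulr1 => <-.
    by apply: eq_Rintegral => w _; rewrite mul1r.
- by exists s.
Qed.

End GaussianLaw.

Section FractionalBrownianMotion.
Context {R : realType} {d : measure_display} {T : measurableType d}.
Variables (P : probability T R) (H : R) (W : R -> T -> R).
Hypothesis fBm : is_fBm P H W.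
Hypothesis H2 : 2^-1 <= H.

(** Explicit finite sums at nonnegative times, the shape in which [fBm_gaussian] applies. *)
Definition in_span (Z : T -> R) : Prop :=
  exists n (t a : 'I_n -> R), (forall i, 0 <= t i) /\
    Z = (fun w => \sum_(i < n) a i * W (t i) w).

Lemma in_span0 : in_span (fun=> 0).
Proof.
exists 0%N, (fun=> 0), (fun=> 0); split=> //.
by apply/funext => w; rewrite big_ord0.
Qed.

Lemma in_spanW t : 0 <= t -> in_span (W t).
Proof.
move=> t0; exists 1%N, (fun=> t), (fun=> 1); split=> //.
by apply/funext => w; rewrite big_ord1 mul1r.
Qed.

Lemma in_spanZ c Z : in_span Z -> in_span (fun w => c * Z w).
Proof.
move=> [n [t [a [t0 ->]]]]; exists n, t, (fun i => c * a i); split=> //.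
by apply/funext => w; rewrite mulr_sumr; apply: eq_bigr => i _; rewrite mulrA.
Qed.

Lemma in_spanD Z1 Z2 : in_span Z1 -> in_span Z2 ->
  in_span (fun w => Z1 w + Z2 w).
Proof.
move=> [n1 [t1 [a1 [t10 ->]]]] [n2 [t2 [a2 [t20 ->]]]].
exists (n1 + n2)%N,
  (fun i => match fintype.split i with inl j => t1 j | inr j => t2 j end),
  (fun i => match fintype.split i with inl j => a1 j | inr j => a2 j end).
split; first by move=> i; case: fintype.split.
apply/funext => w; rewrite big_split_ord/=; congr (_ + _).
- by apply: eq_bigr => i _; rewrite (unsplitK (inl _ i)).
- by apply: eq_bigr => i _; rewrite (unsplitK (inr _ i)).
Qed.

Lemma in_spanB Z1 Z2 : in_span Z1 -> in_span Z2 ->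
  in_span (fun w => Z1 w - Z2 w).
Proof.
move=> h1 h2; have := in_spanD h1 (in_spanZ (- 1) h2).
by congr in_span; apply/funext => w; rewrite mulN1r.
Qed.

Lemma in_span_sum (I : Type) (r : seq I) (Z : I -> T -> R) :
  (forall i, in_span (Z i)) -> in_span (fun w => \sum_(i <- r) Z i w).
Proof.
move=> hZ; elim: r => [|i r IH].
  by under eq_fun do rewrite big_nil; exact: in_span0.
by under eq_fun do rewrite big_cons; exact: in_spanD.
Qed.

Lemma in_span_gaussian Z : in_span Z -> gaussian_rv P Z.
Proof. by move=> [n [t [a [t0 ->]]]]; exact: (fBm_gaussian fBm). Qed.

Lemma in_span_centered Z : in_span Z -> \int[P]_w Z w = 0.
Proof.
move=> [n [t [a [t0 ->]]]].
have iW i : P.-integrable [set: T] (EFin \o W (t i)).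
  by apply: gaussian_rv_integrable; apply: in_span_gaussian; exact: in_spanW.
rewrite Rintegral_sum => [|i]; last exact: integrable_EFinZ.
rewrite big1// => i _; rewrite RintegralZl//.
have := fBm_centered fBm (t0 i); rewrite unlock => E0.
by rewrite (@RintegralE _ _ _ P _ 0) ?mulr0.
Qed.

Lemma in_span_cgauss Z : in_span Z -> cgauss P Z (\int[P]_w (Z w ^+ 2)).
Proof.
move=> Zs; have [] := centered_gaussian_rv (in_span_gaussian Zs) (in_span_centered Zs).
by [].
Qed.

Lemma in_span_sqr_integrable Z : in_span Z ->
  P.-integrable [set: T] (EFin \o (fun w => Z w ^+ 2)).
Proof.
move=> Zs; have [] := centered_gaussian_rv (in_span_gaussian Zs) (in_span_centered Zs).
by [].
Qed.

Lemma in_span_measurable Z : in_span Z -> measurable_fun [set: T] Z.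
Proof. by move=> /in_span_gaussian[]. Qed.

Lemma in_span_mul_integrable Z1 Z2 : in_span Z1 -> in_span Z2 ->
  P.-integrable [set: T] (EFin \o (fun w => Z1 w * Z2 w)).
Proof.
move=> h1 h2.
apply: le_integrable_EFin (integrable_EFinD (in_span_sqr_integrable h1)
  (in_span_sqr_integrable h2)) => [|w].
  by apply: measurable_funM; exact: in_span_measurable.
rewrite normrM -[Z1 w ^+ 2]real_normK ?num_real// -[Z2 w ^+ 2]real_normK ?num_real//.
have := sqr_ge0 (`|Z1 w| - `|Z2 w|); have := normr_ge0 (Z1 w).
by have := normr_ge0 (Z2 w); nra.
Qed.

Definition cov (Z1 Z2 : T -> R) : R := \int[P]_w (Z1 w * Z2 w).

Lemma covC Z1 Z2 : cov Z1 Z2 = cov Z2 Z1.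
Proof. by apply: eq_Rintegral => w _; rewrite mulrC. Qed.

Lemma covDl Z1 Z2 Z : in_span Z1 -> in_span Z2 -> in_span Z ->
  cov (fun w => Z1 w + Z2 w) Z = cov Z1 Z + cov Z2 Z.
Proof.
move=> h1 h2 h; rewrite /cov; under eq_Rintegral do rewrite mulrDl.
by rewrite RintegralD//; exact: in_span_mul_integrable.
Qed.

Lemma covZl c Z1 Z : in_span Z1 -> in_span Z ->
  cov (fun w => c * Z1 w) Z = c * cov Z1 Z.
Proof.
move=> h1 h; rewrite /cov; under eq_Rintegral do rewrite -mulrA.
by rewrite RintegralZl//; exact: in_span_mul_integrable.
Qed.

Lemma covDr Z1 Z2 Z : in_span Z1 -> in_span Z2 -> in_span Z ->
  cov Z (fun w => Z1 w + Z2 w) = cov Z Z1 + cov Z Z2.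
Proof. by move=> h1 h2 h; rewrite covC covDl// !(covC Z). Qed.

Lemma covZr c Z1 Z : in_span Z1 -> in_span Z ->
  cov Z (fun w => c * Z1 w) = c * cov Z Z1.
Proof. by move=> h1 h; rewrite covC covZl// (covC Z). Qed.

Lemma cov_suml (I : Type) (r : seq I) (Z : I -> T -> R) Z' :
  (forall i, in_span (Z i)) -> in_span Z' ->
  cov (fun w => \sum_(i <- r) Z i w) Z' = \sum_(i <- r) cov (Z i) Z'.
Proof.
move=> hZ hZ'; rewrite /cov; under eq_Rintegral do rewrite mulr_suml.
by rewrite Rintegral_sum// => i; exact: in_span_mul_integrable.
Qed.

Lemma cov_diag Z : cov Z Z = \int[P]_w (Z w ^+ 2).
Proof. by apply: eq_Rintegral => w _; rewrite expr2. Qed.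

Lemma in_span_linform n (X : 'I_n -> T -> R) a : (forall i, in_span (X i)) ->
  in_span (linform a X).
Proof. by move=> hX; apply: in_span_sum => i; exact: in_spanZ. Qed.

Lemma in_span_linform_cgauss n (X : 'I_n -> T -> R) a :
  (forall i, in_span (X i)) ->
  cgauss P (linform a X) (quadform (fun i j => cov (X i) (X j)) a).
Proof.
move=> hX; have hl := in_span_linform a hX.
have -> : quadform (fun i j => cov (X i) (X j)) a = cov (linform a X) (linform a X).
  rewrite /linform cov_suml//; last by move=> i; exact: in_spanZ.
  apply: eq_bigr => i _; rewrite covC cov_suml//; last 2 first.
  - by move=> j; exact: in_spanZ.
  - exact: in_spanZ.
  apply: eq_bigr => j _; rewrite covZl//; last exact: in_spanZ.
  by rewrite covZr// (covC (X j)); ring.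
by rewrite cov_diag; exact: in_span_cgauss.
Qed.

Let p : R := 2 * H.
Let p1 : 1 <= p. Proof. by rewrite /p mulrC -ler_pdivrMr// div1r. Qed.

Lemma cov_fBm s t : 0 <= s -> 0 <= t ->
  cov (W s) (W t) = 2^-1 * (s `^ p + t `^ p - `|t - s| `^ p).
Proof.
move=> s0 t0; have := fBm_covariance fBm s0 t0.
rewrite unlock => E; rewrite /cov (RintegralE E).
by rewrite (ger0_norm s0) (ger0_norm t0).
Qed.

Let incr x y w := W y w - W x w.

Let in_span_incr x y : 0 <= x -> 0 <= y -> in_span (incr x y).
Proof. by move=> x0 y0; apply: in_spanB; exact: in_spanW. Qed.

Lemma cov_incr x y x' y' : 0 <= x -> 0 <= y -> 0 <= x' -> 0 <= y' ->
  cov (incr x y) (incr x' y') =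
  2^-1 * (`|y' - x| `^ p + `|x' - y| `^ p - `|y' - y| `^ p - `|x' - x| `^ p).
Proof.
move=> x0 y0 x'0 y'0.
have hW t : 0 <= t -> in_span (W t) by exact: in_spanW.
have hN t : 0 <= t -> in_span (fun w => - 1 * W t w) by move=> t0; apply: in_spanZ; exact: in_spanW.
have E a b : incr a b = (fun w => W b w + - 1 * W a w).
  by apply/funext => w; rewrite mulN1r.
rewrite !E covDl; [|exact: hW|exact: hN|by apply: in_spanD; [exact: hW|exact: hN]].
rewrite !covDr; [|exact: hW|exact: hN|exact: hN|exact: hW|exact: hN|exact: hW].
rewrite !covZl ?covZr; try solve [exact: hW|exact: hN].
rewrite !cov_fBm//; lra.
Qed.

(** x + h and x + k are convex combinations of x and x + h + k with complementary weights; the power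
    is convex since p = 2 H >= 1, which is where H >= 1/2 enters. *)
Lemma powR_supermodular (x h k : R) : 0 <= x -> 0 <= h -> 0 <= k ->
  (x + h) `^ p + (x + k) `^ p <= (x + h + k) `^ p + x `^ p.
Proof.
move=> x0 h0 k0.
have [hk0|hk0] := eqVneq (h + k) 0.
  have -> : h = 0 by lra.
  have -> : k = 0 by lra.
  by rewrite !addr0.
have hk : 0 < h + k by rewrite lt_neqAle eq_sym hk0 addr_ge0.
have conv (t : R) : 0 <= t -> t <= 1 ->
    (t * x + (1 - t) * (x + h + k)) `^ p <= t * x `^ p + (1 - t) * (x + h + k) `^ p.
  move=> t0 t1; have y0 : 0 <= x + h + k by rewrite !addr_ge0.
  have := convex_powR p1 (Itv01 t0 t1) (x := x) (y := x + h + k).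
  by rewrite !convRE; apply; rewrite inE/= in_itv/= ?x0 ?y0.
have t0 : 0 <= k / (h + k) by rewrite divr_ge0// ltW.
have t1 : k / (h + k) <= 1 by rewrite ler_pdivrMr// mul1r lerDr.
have s0 : 0 <= h / (h + k) by rewrite divr_ge0// ltW.
have s1 : h / (h + k) <= 1 by rewrite ler_pdivrMr// mul1r lerDl.
have := conv _ t0 t1; have := conv _ s0 s1.
have -> : k / (h + k) * x + (1 - k / (h + k)) * (x + h + k) = x + h.
  by field.
have -> : h / (h + k) * x + (1 - h / (h + k)) * (x + h + k) = x + k.
  by field.
have -> : h / (h + k) = 1 - k / (h + k) by field.
lra.
Qed.

Lemma cov_incr_ge0 x y x' y' : 0 <= x -> x <= y -> y <= x' -> x' <= y' ->
  0 <= cov (incr x y) (incr x' y').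
Proof.
move=> x0 xy yx' xy'; have y0 := le_trans x0 xy; have x'0 := le_trans y0 yx'.
have y'0 := le_trans x'0 xy'.
rewrite cov_incr// mulr_ge0 ?invr_ge0//.
have u0 : 0 <= x' - y by lra.
have h0 : 0 <= y - x by lra.
have k0 : 0 <= y' - x' by lra.
have := powR_supermodular u0 h0 k0.
have -> : x' - y + (y - x) = x' - x by ring.
have -> : x' - y + (y' - x') = y' - y by ring.
have -> : x' - x + (y' - x') = y' - x by ring.
by rewrite !ger0_norm; lra.
Qed.

(** * Variance of a partial sum of disjoint increments *)

Section PartialIncrements.
Variables (S : R) (n : nat) (a b j : nat -> R).
Hypothesis ilac : interlaced 0 S n a b.
Hypothesis j01 : forall i, 0 <= j i <= 1.

(** The time reached after the first [k] intervals, 0 if there is none; [Z k] will be compared with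
    the full increment from 0 to [e k]. *)
Let e k := if k is k'.+1 then b k' else 0.
Let Z k w := \sum_(i < k) j i * incr (a i) (b i) w.

Let a0 i : (i <= n)%N -> 0 <= a i.
Proof. by move=> /(interlaced_bounds ilac)[]. Qed.

Let ab i : (i <= n)%N -> a i <= b i.
Proof. by have [_ h _ _] := ilac; move=> /h/ltW. Qed.

Let b0 i : (i <= n)%N -> 0 <= b i.
Proof. by move=> iN; exact: le_trans (a0 iN) (ab iN). Qed.

Let e0 k : (k <= n.+1)%N -> 0 <= e k.
Proof. by case: k => //= k; exact: b0. Qed.

Let ea k : (k <= n)%N -> e k <= a k.
Proof.
have [h _ h' _] := ilac; case: k => //= k kn.
by rewrite ltW// h'.
Qed.

Let Zspan k : (k <= n.+1)%N -> in_span (Z k).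
Proof.
elim: k => [_|k IH kn].
  by rewrite /Z; under eq_fun do rewrite big_ord0; exact: in_span0.
rewrite /Z; under eq_fun do rewrite big_ord_recr/=.
apply: in_spanD; first exact: IH (ltnW kn).
by apply: in_spanZ; apply: in_span_incr; [exact: a0|exact: b0].
Qed.

Let incrD x y z : incr x z = (fun w => incr x y w + incr y z w).
Proof. by apply/funext => w; rewrite /incr; ring. Qed.

(** The comparison of variances does not propagate by itself, as a new interval brings a cross term
    with the previous ones. The induction therefore also compares the covariances with every later
    increment. *)
Let main k : (k <= n.+1)%N ->
  (forall x y, e k <= x -> x <= y ->
     0 <= cov (Z k) (incr x y) <= cov (incr 0 (e k)) (incr x y)) /\
  cov (Z k) (Z k) <= cov (incr 0 (e k)) (incr 0 (e k)).
Proof.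
elim: k => [_|k IH kn].
  have Z0 : Z 0 = (fun w => 0 * W 0 w).
    by apply/funext => w; rewrite /Z big_ord0 mul0r.
  have i0 : incr 0 (e 0) = (fun w => 0 * W 0 w).
    by apply/funext => w; rewrite /incr subrr mul0r.
  split => [x y x0 xy|]; last by rewrite Z0 i0.
  rewrite Z0 i0 !covZl; [by rewrite !mul0r lexx|exact: in_spanW|..].
  by apply: in_span_incr; rewrite ?(le_trans x0).
have {IH}[IH1 IH2] := IH (ltnW kn).
have Zk := Zspan (ltnW kn).
have ek0 := e0 (ltnW kn); have ak0 := a0 kn; have bk0 := b0 kn.
have eak := ea kn; have abk := ab kn.
have /andP[jk0 jk1] := j01 k.
have sD : in_span (incr (a k) (b k)) by exact: in_span_incr.
have sG : in_span (incr (e k) (a k)) by exact: in_span_incr.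
have sE : in_span (incr 0 (e k)) by exact: in_span_incr.
have sEG : in_span (fun w => incr 0 (e k) w + incr (e k) (a k) w) by exact: in_spanD.
have ZS : Z k.+1 = (fun w => Z k w + j k * incr (a k) (b k) w).
  by apply/funext => w; rewrite /Z big_ord_recr.
(* The full increment is split into the past, the gap from [e k] to [a k] and the new interval; the
   gap contributes nonnegative terms to the larger side only. *)
have ES : incr 0 (b k) =
    (fun w => (incr 0 (e k) w + incr (e k) (a k) w) + incr (a k) (b k) w).
  by rewrite (incrD 0 (a k)) (incrD 0 (e k)).
have sjD : in_span (fun w => j k * incr (a k) (b k) w) by exact: in_spanZ.
rewrite /= -/(e k) in IH1 IH2 *.
split => [x y bx xy|].
  have x0 : 0 <= x by exact: le_trans bk0 bx.
  have sI : in_span (incr x y) by apply: in_span_incr => //; exact: le_trans xy.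
  have ex : e k <= x by rewrite (le_trans eak)// (le_trans abk).
  have /andP[h1 h2] := IH1 x y ex xy.
  have h3 : 0 <= cov (incr (a k) (b k)) (incr x y) by exact: cov_incr_ge0.
  have h4 : 0 <= cov (incr (e k) (a k)) (incr x y).
    by apply: cov_incr_ge0 => //; exact: le_trans bx.
  rewrite ZS ES (covDl Zk sjD sI) (covZl (j k) sD sI) (covDl sEG sD sI) (covDl sE sG sI).
  by apply/andP; split; nra.
have /andP[h1 h2] := IH1 (a k) (b k) eak abk.
have h3 : 0 <= cov (incr 0 (e k)) (incr (e k) (a k)) by exact: cov_incr_ge0.
have h4 : 0 <= cov (incr (e k) (a k)) (incr (a k) (b k)) by exact: cov_incr_ge0.
have sq Z' : 0 <= cov Z' Z'.
  by rewrite cov_diag; apply: Rintegral_ge0 => w _; exact: sqr_ge0.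
have h5 := sq (incr (a k) (b k)); have h6 := sq (incr (e k) (a k)).
rewrite ZS ES.
have sZD := in_spanD Zk sjD; have sEGD := in_spanD sEG sD.
rewrite (covDl Zk sjD sZD) (covDr Zk sjD Zk) (covDr Zk sjD sjD).
rewrite (covZl (j k) sD Zk) (covZl (j k) sD sjD) (covZr (j k) sD sD) (covZr (j k) sD Zk).
rewrite (covDl sEG sD sEGD) (covDr sEG sD sEG) (covDr sEG sD sD).
rewrite (covDl sE sG sEG) (covDr sE sG sE) (covDr sE sG sG) (covDl sE sG sD) (covDr sE sG sD).
rewrite (covC (incr (a k) (b k)) (Z k)).
rewrite (covC (incr (e k) (a k)) (incr 0 (e k))).
rewrite (covC (incr (a k) (b k)) (incr 0 (e k))).
rewrite (covC (incr (a k) (b k)) (incr (e k) (a k))).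
have hj1 := ler_piMl h1 jk1; have hj2 := ler_piMl h5 jk1.
have hj3 := ler_piMl (mulr_ge0 jk0 h5) jk1.
lra.
Qed.

Lemma partial_increments_variance :
  in_span (fun w => \sum_(i < n.+1) j i * (W (b i) w - W (a i) w)) /\
  \int[P]_w ((\sum_(i < n.+1) j i * (W (b i) w - W (a i) w)) ^+ 2) <= S `^ p.
Proof.
split; first exact: (Zspan (leqnn n.+1)).
have [_] := main (leqnn n.+1); rewrite cov_diag => /le_trans; apply.
have bn := b0 (leqnn n); have [_ bS] := interlaced_bounds ilac (leqnn n).
(* The real power 0 to the 0 is 1, so that the terms in 0 vanish for a nonzero exponent. *)
have pn0 : p != 0 by rewrite gt_eqF// (lt_le_trans _ p1).
rewrite cov_incr//= !subr0 !sub0r !subrr normrN normr0 powR0// !subr0.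
rewrite (ger0_norm bn) (_ : 2^-1 * (_ + _) = b n `^ p); last by field.
apply: ge0_ler_powR => //; rewrite ?nnegrE//; first exact: le_trans ler01 p1.
exact: le_trans bn bS.
Qed.

End PartialIncrements.
End FractionalBrownianMotion.

(** * Concentration *)

Section Envelope.
Import HBNNSimple.
Context {R : realType} {d : measure_display} {T : measurableType d}.
Variable P : probability T R.

(* U need not be measurable; V is the measurable function it coincides with
   outside of a null set. *)
Definition envelope (U : T -> \bar R) (V : T -> R) (N : set T) : Prop :=
  [/\ measurable N, P N = 0, measurable_fun [set: T] V
    & forall w, [/\ 0 <= V w, ((V w)%:E <= U w)%E & ~ N w -> U w = (V w)%:E]].

Variables (U : T -> \bar R) (V : T -> R) (N : set T).
Hypothesis UV : envelope U V N.

(** The integral of a nonnegative function is a supremum over the simple functions below it, whether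
    it is measurable or not. A simple function below [U] is below [V] outside [N], and one below [V]
    is below [U] everywhere. *)
Lemma integral_envelope : (\int[P]_w U w = \int[P]_w (V w)%:E)%E.
Proof.
have [mN PN mV h] := UV.
have V0 w : 0 <= V w by have [] := h w.
have VU w : ((V w)%:E <= U w)%E by have [] := h w.
have U0 w : (0 <= U w)%E by apply: le_trans (VU w); rewrite lee_fin.
apply/eqP; rewrite eq_le; apply/andP; split.
  rewrite ge0_integralTE//; apply: ge_ereal_sup => _ [g gU <-].
  have := integral_nnsfun P measurableT g; rewrite patch_setT => <-.
  apply: ae_ge0_le_integral => //.
  - by move=> w _; rewrite lee_fin; exact: fun_ge0.
  - by apply/measurable_EFinP; exact: measurable_funPT.
  - by move=> w _; rewrite lee_fin.
  - by apply/measurable_EFinP.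
  exists N; split=> // w /= /not_implyP[_ nle]; apply: contrapT => nNw.
  by apply: nle; have [_ _ /(_ nNw) <-] := h w; exact: gU.
rewrite !ge0_integralTE//.
apply: le_ereal_sup => _ [g gV <-]; exists g => // w.
exact: le_trans (gV w) _.
Qed.

End Envelope.

(** * Passage of exponential moments to a monotone limit *)

Section MonotoneLimit.
Context {R : realType} {d : measure_display} {T : measurableType d}.
Variables (P : probability T R) (F : nat -> T -> R) (U : T -> \bar R) (k : R).
Hypothesis mF : forall n, measurable_fun [set: T] (F n).
Hypothesis ndF : forall w, nondecreasing_seq (F ^~ w).
Hypothesis U0 : forall w, (0 <= U w)%E.
Hypothesis Usup : {ae P, forall w, (U w < +oo)%E /\
  U w = ereal_sup (range (fun n => (F n w)%:E))}.
Hypothesis mgfF : forall n l, 0 <= l ->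
  (\int[P]_w (expR (l * F n w))%:E * \int[P]_w (expR (- l * F n w))%:E <=
   (expR (l ^+ 2 * k))%:E)%E.

(** On the exceptional set [V] is 0, which keeps it below [U] since U >= 0; elsewhere it is the
    pointwise limit of the [F n], hence measurable. *)
Lemma sup_envelope : exists V N, envelope P U V N /\
  forall w, ~ N w -> F ^~ w @ \oo --> V w.
Proof.
have [N [mN PN subN]] := Usup.
pose V w := if w \in N then 0 else fine (U w).
have fU w : ~ N w -> (fine (U w))%:E = U w.
  move=> nN; have [Uoo _] : (U w < +oo)%E /\ U w = ereal_sup (range (fun n => (F n w)%:E)).
    by apply: contrapT => nh; apply: nN; apply: subN.
  by rewrite fineK// ge0_fin_numE.
have VE w : ~ N w -> V w = fine (U w) by move=> nN; rewrite /V memNset.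
have VN w : N w -> V w = 0 by move=> wN; rewrite /V mem_set.
have FV w : ~ N w -> F ^~ w @ \oo --> V w.
  move=> nN; have [_ UE] : (U w < +oo)%E /\ U w = ereal_sup (range (fun n => (F n w)%:E)).
    by apply: contrapT => nh; apply: nN; apply: subN.
  have : (fun n => (F n w)%:E) @ \oo --> (V w)%:E.
    rewrite VE// fU// UE; apply: ereal_nondecreasing_cvgn => m n mn.
    by rewrite lee_fin; exact: ndF.
  by move=> /fine_cvgP[].
exists V, N; split=> //; split=> //.
  apply: (@measurable_fun_cvg _ _ _ _ (fun n w => \1_(~` N) w * F n w)) => [n|w _].
    by apply: measurable_funM => //; apply: measurable_indic; exact: measurableC.
  have [wN|nN] := pselect (N w).
    rewrite VN// (_ : (fun _ => _) = cst 0); first exact: cvg_cst.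
    by apply/funext => n; rewrite indicE memNset ?mul0r// => /(_ wN).
  rewrite (_ : (fun _ => _) = F ^~ w); first exact: FV.
  by apply/funext => n; rewrite indicE mem_set// mul1r.
move=> w; have [wN|nN] := pselect (N w).
  by rewrite VN//; split.
by rewrite VE// fU//; split=> //; rewrite fine_ge0.
Qed.

Variables (V : T -> R) (N : set T).
Hypothesis UV : envelope P U V N.
Hypothesis FV : forall w, ~ N w -> F ^~ w @ \oo --> V w.

Let mN : measurable N. Proof. by case: UV. Qed.
Let PN : P N = 0. Proof. by case: UV. Qed.
Let mV : measurable_fun [set: T] V. Proof. by case: UV. Qed.
Let V0 w : 0 <= V w. Proof. by case: UV => _ _ _ /(_ w)[]. Qed.

Let FleV n w : ~ N w -> F n w <= V w.
Proof.
move=> nN; have := FV nN => cF; rewrite -(cvg_lim (@Rhausdorff R) cF).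
by apply: nondecreasing_cvgn_le; [exact: ndF|apply/cvg_ex; exists (V w)].
Qed.

Let expZ_meas (l : R) (f : T -> R) : measurable_fun [set: T] f ->
  measurable_fun [set: T] (fun w => (expR (l * f w))%:E).
Proof.
by move=> mf; apply/measurable_EFinP; apply: measurableT_comp => //; exact: measurable_funM.
Qed.

(** Positivity expresses that [V] is finite: a vanishing integral would make the positive function
    exp(-l V) zero almost everywhere. *)
Let fin_neg l : 0 <= l ->
  exists2 b, 0 < b & (\int[P]_w (expR (- l * V w))%:E = b%:E)%E.
Proof.
move=> l0.
have i : P.-integrable [set: T] (EFin \o (fun w => expR (- l * V w))).
  apply: (@bounded_integrable_EFin _ _ _ P _ 1) => [|w].
    by apply/measurable_EFinP; exact: expZ_meas.
  by rewrite ger0_norm ?expR_ge0// expR_le1 mulNr oppr_le0 mulr_ge0.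
exists (\int[P]_w (expR (- l * V w))); last exact: Rintegral_EFin.
rewrite lt0r; apply/andP; split; last by apply: Rintegral_ge0 => w _; exact: expR_ge0.
apply/negP => /eqP E0.
have := Rintegral_EFin i; rewrite E0 => I0.
have [] := @ae_eq_integral_abs _ _ _ P _ measurableT
  (fun w => (expR (- l * V w))%:E) (expZ_meas _ mV).
case=> [|A [mA PA sA] _].
  by rewrite -[RHS]I0; apply: eq_integral => w _; rewrite gee0_abs// lee_fin expR_ge0.
have := probability_setT P; rewrite (_ : [set: T] = A).
  by rewrite PA => /esym/eqP; rewrite eqe oner_eq0.
apply/seteqP; split=> // w _; apply: sA => /= /(_ I)[] /eqP.
by rewrite gt_eqF// expR_gt0.
Qed.

(** Since F n <= V almost everywhere, E exp(-l F_n) >= b for all n. Dividing the product bound by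
    [b] gives a bound on E exp(l F_n) uniform in n, and monotone convergence off [N] carries it to
    [V]. *)
Let mgf_prod l b : 0 <= l -> 0 < b -> (\int[P]_w (expR (- l * V w))%:E = b%:E)%E ->
  (\int[P]_w (expR (l * V w))%:E <= (expR (l ^+ 2 * k) / b)%:E)%E.
Proof.
move=> l0 b0 Eb.
have step n : (\int[P]_w (expR (l * F n w))%:E <= (expR (l ^+ 2 * k) / b)%:E)%E.
  have hb : (b%:E <= \int[P]_w (expR (- l * F n w))%:E)%E.
    rewrite -Eb; apply: ae_ge0_le_integral => //.
    - exact: expZ_meas.
    - exact: expZ_meas.
    exists N; split=> // w /= /not_implyP[_ nle]; apply: contrapT => nN; apply: nle.
    by rewrite lee_fin ler_expR !mulNr lerN2 ler_wpM2l// FleV.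
  rewrite EFinM lee_pdivlMr//.
  apply: le_trans (mgfF n l0); apply: lee_wpmul2l => //.
  by apply: integral_ge0 => w _; rewrite lee_fin expR_ge0.
rewrite (@ge0_negligible_integral _ _ _ P _ N)//; last exact: expZ_meas.
have Fcvg w : ~ N w -> (fun n => (expR (l * F n w))%:E) @ \oo --> (expR (l * V w))%:E.
  move=> nN; apply: cvg_EFin; first by near=> n.
  apply: (@cvg_comp _ _ _ (fun n => l * F n w) expR); last exact: continuous_expR.
  exact: cvgMl_tmp (FV nN).
have mD : measurable ([set: T] `\` N) by exact: measurableD.
have mG n : measurable_fun ([set: T] `\` N) (fun w => (expR (l * F n w))%:E).
  by apply: measurable_funS (expZ_meas _ (mF n)).
have G0 n w : ([set: T] `\` N) w -> (0 <= (expR (l * F n w))%:E)%E.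
  by move=> _; rewrite lee_fin expR_ge0.
have ndG w : ([set: T] `\` N) w -> nondecreasing_seq (fun n => (expR (l * F n w))%:E).
  by move=> _ m n mn; rewrite lee_fin ler_expR ler_wpM2l// ndF.
rewrite (_ : (\int[P]_(w in _) _ = \int[P]_(w in [set: T] `\` N)
    limn (fun n => (expR (l * F n w))%:E))%E); last first.
  apply: eq_integral => w; rewrite inE => -[_ nN].
  by apply/esym/cvg_lim => //; exact: Fcvg.
have cvgG := @cvg_monotone_convergence _ _ _ P _ mD _ mG G0 ndG.
apply: (cvge_to_le cvgG).
apply: nearW => n; apply: le_trans (step n).
by apply: ge0_subset_integral => //; exact: expZ_meas.
Unshelve. all: by end_near. Qed.
Let expR_mean (g : T -> R) : P.-integrable [set: T] (EFin \o g) -> \int[P]_w g w = 0 ->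
  P.-integrable [set: T] (EFin \o (fun w => expR (g w))) -> 1 <= \int[P]_w expR (g w).
Proof.
move=> ig g0 ieg.
have <- : \int[P]_w (1 + g w) = 1.
  by rewrite RintegralD//; [rewrite g0 Rintegral_prob_cst addr0|exact: integrable_EFin_cst].
apply: le_Rintegral => //; last by move=> w _; exact: expR_ge1Dx.
by apply: integrable_EFinD => //; exact: integrable_EFin_cst.
Qed.

(** The factors exp(l E) and exp(-l E) cancel in the product of the two centred moments, so that the
    product bound still holds; by Jensen's inequality each moment is at least 1, so each is bounded
    by the product. *)
Lemma sup_mgf : exists E : R, (\int[P]_w (V w)%:E = E%:E)%E /\
  forall l, 0 <= l ->
    \int[P]_w expR (l * (V w - E)) <= expR (l ^+ 2 * k) /\
    \int[P]_w expR (l * (E - V w)) <= expR (l ^+ 2 * k) /\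
    P.-integrable [set: T] (EFin \o (fun w => expR (l * (V w - E)))) /\
    P.-integrable [set: T] (EFin \o (fun w => expR (l * (E - V w)))).
Proof.
have iexp l : 0 <= l -> P.-integrable [set: T] (EFin \o (fun w => expR (l * V w))).
  move=> l0; have [b b0 Eb] := fin_neg l0.
  apply/integrableP; split; first exact: expZ_meas.
  under eq_integral do rewrite /= ger0_norm ?expR_ge0//.
  by apply: le_lt_trans (mgf_prod l0 b0 Eb) _; rewrite ltry.
have iexpN l : 0 <= l -> P.-integrable [set: T] (EFin \o (fun w => expR (- l * V w))).
  move=> l0; have [b b0 Eb] := fin_neg l0.
  apply: ge0_integrable_EFin Eb => [|w]; last exact: expR_ge0.
  by apply/measurable_EFinP; exact: expZ_meas.
have iV : P.-integrable [set: T] (EFin \o V).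
  apply: le_integrable_EFin mV _ (iexp 1 ler01) => w.
  by rewrite ger0_norm// mul1r (le_trans _ (expR_ge1Dx _))// lerDr.
exists (\int[P]_w V w); set E := \int[P]_w V w; split; first exact: Rintegral_EFin.
move=> l l0; have [b b0 Eb] := fin_neg l0.
have := mgf_prod l0 b0 Eb; rewrite (Rintegral_EFin (iexp l l0)) lee_fin.
set a := \int[P]_w expR (l * V w) => ab.
have bE : \int[P]_w expR (- l * V w) = b by exact: RintegralE.
have E1 : (fun w => expR (l * (V w - E))) = (fun w => expR (- (l * E)) * expR (l * V w)).
  by apply/funext => w; rewrite -expRD; congr expR; ring.
have E2 : (fun w => expR (l * (E - V w))) = (fun w => expR (l * E) * expR (- l * V w)).
  by apply/funext => w; rewrite -expRD; congr expR; ring.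
have i1 : P.-integrable [set: T] (EFin \o (fun w => expR (l * (V w - E)))).
  by rewrite E1; apply: integrable_EFinZ; exact: iexp.
have i2 : P.-integrable [set: T] (EFin \o (fun w => expR (l * (E - V w)))).
  by rewrite E2; apply: integrable_EFinZ; exact: iexpN.
have I1 : \int[P]_w expR (l * (V w - E)) = expR (- (l * E)) * a.
  by rewrite E1 RintegralZl//; exact: iexp.
have I2 : \int[P]_w expR (l * (E - V w)) = expR (l * E) * b.
  by rewrite E2 RintegralZl ?bE//; exact: iexpN.
have icst : P.-integrable [set: T] (EFin \o (fun=> E)) by exact: integrable_EFin_cst.
have g1 : 1 <= \int[P]_w expR (l * (V w - E)).
  apply: expR_mean => //.
    by apply: integrable_EFinZ; exact: integrable_EFinB.
  rewrite RintegralZl//; last exact: integrable_EFinB.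
  by rewrite RintegralB// Rintegral_prob_cst subrr mulr0.
have g2 : 1 <= \int[P]_w expR (l * (E - V w)).
  apply: expR_mean => //.
    by apply: integrable_EFinZ; exact: integrable_EFinB.
  rewrite RintegralZl//; last exact: integrable_EFinB.
  by rewrite RintegralB// Rintegral_prob_cst subrr mulr0.
have prodle : (expR (- (l * E)) * a) * (expR (l * E) * b) <= expR (l ^+ 2 * k).
  rewrite mulrACA -expRD addNr expR0 mul1r -ler_pdivlMr//.
move: g1 g2; rewrite I1 I2 => g1 g2; split; [|split=> //]; apply: le_trans prodle.
  by rewrite ler_peMr// (le_trans ler01).
by rewrite ler_peMl// (le_trans ler01).
Qed.

End MonotoneLimit.

Section MaximumMoments.
Context {R : realType} {d : measure_display} {T : measurableType d}.
Variable P : probability T R.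

Lemma maxf_bigmax n (u : 'I_n.+1 -> R) : maxf u = \big[Num.max/u ord0]_(i < n.+1) u i.
Proof.
have [[i0 ->] umax] := maxfP u; apply/eqP; rewrite eq_le; apply/andP; split.
  exact: le_bigmax_cond.
by apply: bigmax_le => [|i _]; exact: umax.
Qed.

Lemma measurable_maxf n (Z : 'I_n.+1 -> T -> R) :
  (forall i, measurable_fun [set: T] (Z i)) ->
  measurable_fun [set: T] (fun w => maxf (Z ^~ w)).
Proof.
move=> mZ; under eq_fun do rewrite maxf_bigmax.
have main (r : seq 'I_n.+1) :
    measurable_fun [set: T] (fun w => \big[Num.max/Z ord0 w]_(i <- r) Z i w).
  elim: r => [|i r IH]; first by under eq_fun do rewrite big_nil; exact: mZ.
  by under eq_fun do rewrite big_cons; exact: measurable_maxr.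
exact: main.
Qed.

Lemma maxf_mgf_prod n (C : 'I_n.+1 -> 'I_n.+1 -> R) (X : 'I_n.+1 -> T -> R)
    (b : 'I_n.+1 -> R) (sg2 l : R) :
  (forall i, measurable_fun [set: T] (X i)) ->
  (forall a, cgauss P (linform a X) (quadform C a)) ->
  (forall i, C i i <= sg2) -> 0 <= sg2 -> 0 <= l ->
  (\int[P]_w (expR (l * maxf (fun i => X i w + b i)))%:E *
   \int[P]_w (expR (- l * maxf (fun i => X i w + b i)))%:E <=
   (expR (l ^+ 2 * (pi ^+ 2 * sg2 / 8)))%:E)%E.
Proof.
move=> mX XC Csg sg0 l0.
have mF : measurable_fun [set: T] (fun w => maxf (fun i => X i w + b i)).
  by apply: (@measurable_maxf _ (fun i w => X i w + b i)) => i; exact: measurable_funD.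
rewrite -ge0_integral_prod; last 4 first.
- by apply: measurableT_comp => //; exact: measurable_funM.
- by apply: measurableT_comp => //; exact: measurable_funM.
- by move=> w; exact: expR_ge0.
- by move=> w; exact: expR_ge0.
have := maxf_diff_mgf (iid_gauss_prod XC) b Csg sg0 l0.
rewrite (_ : l ^+ 2 * pi ^+ 2 * sg2 / 8 = l ^+ 2 * (pi ^+ 2 * sg2 / 8)); last by rewrite !mulrA.
congr (_ <= _)%E; apply: eq_integral => z _.
by rewrite -expRD mulrBr mulNr.
Qed.

End MaximumMoments.

(** * Truncated variation as a supremum of countably many affine functionals *)

Section Discretization.
Context {R : realType} {d : measure_display} {T : measurableType d}.
Variables (P : probability T R) (H S c : R) (W : R -> T -> R).
Hypotheses (fBm : is_fBm P H W) (H2 : 2^-1 <= H) (S0 : 0 < S) (c0 : 0 < c).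

(** Linear part of the k-th functional, the rational partitions being enumerated by their codes. An
    invalid code gives the functional 0, harmless because the truncated variation is nonnegative. *)
Definition gain_lin (k : nat) (w : T) : R :=
  if unpickle k : option (nat * seq rat * seq rat * seq bool)%type is Some q then
    if `[< rp_valid S q >] then
      \sum_(i < q.1.1.1.+1) rp_mask q i * (W (rp_right q i) w - W (rp_left q i) w)
    else 0
  else 0.

Definition gain_cst (k : nat) : R :=
  if unpickle k : option (nat * seq rat * seq rat * seq bool)%type is Some q then
    if `[< rp_valid S q >] then
      - \sum_(i < q.1.1.1.+1) rp_mask q i * c
    else 0
  else 0.

Let rp_sum_split q w : \sum_(i < q.1.1.1.+1) rp_mask q i *
    (W (rp_right q i) w - W (rp_left q i) w) -
  \sum_(i < q.1.1.1.+1) rp_mask q i * c = rp_sum c (W ^~ w) q.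
Proof. by rewrite -sumrB; apply: eq_bigr => i _; rewrite -mulrBr. Qed.

Lemma gain_le_UTV k w :
  ((gain_lin k w + gain_cst k)%:E <= UTV c (W ^~ w) 0 S)%E.
Proof.
rewrite /gain_lin /gain_cst.
case: (unpickle k) => [q|]; last by rewrite addr0; exact: UTV_ge0.
case: asboolP => [qS|_]; last by rewrite addr0; exact: UTV_ge0.
by rewrite rp_sum_split; exact: rp_sum_le_UTV.
Qed.

Lemma gain_approx w x : {within `[0, +oo[, continuous (W ^~ w)} ->
  (x%:E < UTV c (W ^~ w) 0 S)%E -> exists k, x < gain_lin k w + gain_cst k.
Proof.
move=> cW /(UTV_approx cW)[q qS xq].
exists (pickle (q : (nat * seq rat * seq rat * seq bool)%type)).
by rewrite /gain_lin /gain_cst pickleK asboolT// rp_sum_split.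
Qed.

Lemma gain_lin_span k : in_span W (gain_lin k) /\
  \int[P]_w (gain_lin k w ^+ 2) <= S `^ (2 * H).
Proof.
have h0 : in_span W (fun=> 0) /\ \int[P]_w ((fun=> 0 : R) w ^+ 2) <= S `^ (2 * H).
  by split; [exact: in_span0|rewrite Rintegral_prob_cst expr0n powR_ge0].
rewrite /gain_lin; case: (unpickle k) => [q|//].
case: asboolP => [qS|//]; apply: (partial_increments_variance fBm H2 qS) => i.
by rewrite /rp_mask; case: nth; rewrite /= lexx ler01.
Qed.

Let F n w := maxf (fun i : 'I_n.+1 => gain_lin i w + gain_cst i).

Let ndF w : nondecreasing_seq (F ^~ w).
Proof.
move=> m n mn; rewrite /F; have [[i ->] _] := maxfP (fun i : 'I_m.+1 => gain_lin i w + gain_cst i).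
have [_ h] := maxfP (fun i : 'I_n.+1 => gain_lin i w + gain_cst i).
have im : (i < n.+1)%N by rewrite ltnS (leq_trans _ mn)// -ltnS.
exact: h (Ordinal im).
Qed.

Let Usup : {ae P, forall w, (UTV c (W ^~ w) 0 S < +oo)%E /\
  UTV c (W ^~ w) 0 S = ereal_sup (range (fun n => (F n w)%:E))}.
Proof.
apply: filterS (fBm_continuous fBm) => w cW; split.
  by apply: UTV_lty => //; exact: ltW.
apply/eqP; rewrite eq_le; apply/andP; split.
  rewrite leNgt; apply/negP; set L := ereal_sup _ => LU.
  have FL n : ((F n w)%:E <= L)%E by apply: ereal_sup_ubound; exists n.
  have fL : L \is a fin_num.
    rewrite fin_numE -ltNye (lt_le_trans _ (FL 0%N)) ?ltNyr//=.
    by rewrite -ltey (lt_le_trans LU)// leey.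
  move: LU; rewrite -(fineK fL) => /(gain_approx cW)[m Lm].
  have [_ /(_ ord_max) Fm] := maxfP (fun i : 'I_m.+1 => gain_lin i w + gain_cst i).
  have := FL m; rewrite -(fineK fL) lee_fin leNgt => /negP; apply.
  exact: lt_le_trans Lm Fm.
apply: ge_ereal_sup => _ [n _ <-].
rewrite /F; have [[i ->] _] := maxfP (fun i : 'I_n.+1 => gain_lin i w + gain_cst i).
exact: gain_le_UTV.
Qed.

Let k := pi ^+ 2 * S `^ (2 * H) / 8.

Lemma UTV_concentration : exists V N (E : R),
  [/\ envelope P (fun w => UTV c (W ^~ w) 0 S) V N,
      (\int[P]_w (V w)%:E = E%:E)%E &
      forall l, 0 <= l ->
    \int[P]_w expR (l * (V w - E)) <= expR (l ^+ 2 * k) /\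
    \int[P]_w expR (l * (E - V w)) <= expR (l ^+ 2 * k) /\
    P.-integrable [set: T] (EFin \o (fun w => expR (l * (V w - E)))) /\
    P.-integrable [set: T] (EFin \o (fun w => expR (l * (E - V w))))].
Proof.
have mF n : measurable_fun [set: T] (F n).
  apply: (@measurable_maxf _ _ _ _ (fun (i : 'I_n.+1) w => gain_lin i w + gain_cst i)) => i.
  by apply: measurable_funD => //; apply: (in_span_measurable fBm); have [] := gain_lin_span i.
have U0 w : (0 <= UTV c (W ^~ w) 0 S)%E by exact: UTV_ge0.
have mgfF n l : 0 <= l -> (\int[P]_w (expR (l * F n w))%:E *
    \int[P]_w (expR (- l * F n w))%:E <= (expR (l ^+ 2 * k))%:E)%E.
  move=> l0; apply: (@maxf_mgf_prod _ _ _ P n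
    (fun i j => cov P (gain_lin i) (gain_lin j)) (fun i => gain_lin i) (fun i => gain_cst i)) => //.
  - by move=> i; apply: (in_span_measurable fBm); have [] := gain_lin_span i.
  - by move=> a; apply: (in_span_linform_cgauss fBm) => i; have [] := gain_lin_span i.
  - by move=> i; rewrite cov_diag; have [] := gain_lin_span i.
  - exact: powR_ge0.
have [V [N [UV FV]]] := sup_envelope mF ndF U0 Usup.
have [E [EV h]] := sup_mgf mF ndF mgfF UV FV.
by exists V, N, E.
Qed.

End Discretization.

(** * Tail estimates *)

Section TailBounds.
Context {R : realType}.

Lemma chernoff {d : measure_display} {T : measurableType d} (P : probability T R)
    (f : T -> R) (k u : R) : 0 < k -> 0 < u ->
  measurable_fun [set: T] f ->
  (forall l, 0 <= l -> P.-integrable [set: T] (EFin \o (fun w => expR (l * f w)))) ->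
  (forall l, 0 <= l -> \int[P]_w expR (l * f w) <= expR (l ^+ 2 * k)) ->
  (P [set w | (u < f w)%R] <= (expR (- (u ^+ 2 / (4 * k))))%:E)%E.
Proof.
move=> k0 u0 mf ie be; set A := [set w | _].
have mA : measurable A.
  have -> : A = [set: T] `&` f @^-1` `]u, +oo[.
    by rewrite setTI; apply/seteqP; split=> w; rewrite /= in_itv/= andbT.
  exact: mf.
(* The minimizer of l^2 k - l u. *)
pose l := u / (2 * k).
have l0 : 0 <= l by rewrite divr_ge0 ?ltW// mulr_gt0.
have -> : P A = (\int[P]_w (\1_A w)%:E)%E by rewrite integral_indic// setIT.
apply: (@le_trans _ _ (\int[P]_w (expR (- (l * u)) * expR (l * f w))%:E)%E).
  apply: ge0_le_integral => //.
  - by apply/measurable_EFinP; exact: measurable_indic.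
  - apply/measurable_EFinP; apply: measurable_funM => //.
    by apply: measurableT_comp => //; exact: measurable_funM.
  move=> w _; rewrite lee_fin indicE; have [wA|_] := boolP (w \in A).
    rewrite -expRD -expR0 ler_expR addrC -mulrBr mulr_ge0// subr_ge0 ltW//.
    by move: wA; rewrite inE.
  by rewrite mulr_ge0 ?expR_ge0.
rewrite Rintegral_EFin; last by apply: integrable_EFinZ; exact: ie.
rewrite lee_fin RintegralZl//; last exact: ie.
apply: (@le_trans _ _ (expR (- (l * u)) * expR (l ^+ 2 * k))).
  by rewrite ler_wpM2l ?expR_ge0// be.
rewrite -expRD ler_expR le_eqVlt; apply/orP; left; apply/eqP; rewrite /l; field.
by rewrite gt_eqF.
Qed.

(** On ]2 u, 2 u + |s|], which ends before 3 u, the density is at least its peak times exp(-(9/2) y)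
    with y = u^2 / s^2 >= 1. The length |s| cancels the scale of the peak and leaves 1 / sqrt(2 pi)
    >= 1/5. Passing from the rate 9/2 to 6 gains exp((3/2) y) >= 5/2, which turns 1/5 into 1/2. *)
Lemma normal_prob_upper_tail (s u : R) : s != 0 -> 0 < u -> s ^+ 2 <= u ^+ 2 ->
  ((2^-1 * expR (- (6 * (s ^+ 2)^-1 * u ^+ 2)))%:E <= normal_prob 0 s `](2 * u)%R, +oo[%classic)%E.
Proof.
move=> sn0 u0 su.
have s20 : 0 < s ^+ 2 by rewrite exprn_even_gt0.
pose t : R := `|s|; have t0 : 0 < t by rewrite normr_gt0.
have tu : t <= u by rewrite -(ler_pXn2r (ltn0Sn 1)) ?nnegrE ?(ltW t0) ?(ltW u0)// real_normK ?num_real.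
pose y := u ^+ 2 / s ^+ 2.
have y1 : 1 <= y by rewrite ler_pdivlMr// mul1r.
pose m := normal_peak s * expR (- (9 / 2 * y)).
have m0 : 0 <= m by rewrite mulr_ge0 ?normal_peak_ge0 ?expR_ge0.
have mle x : x \in `]2 * u, 2 * u + t] -> m <= normal_pdf 0 s x.
  rewrite in_itv/= => /andP[x1 x2]; rewrite normal_pdfE// ler_wpM2l ?normal_peak_ge0//.
  rewrite /normal_fun ler_expR subr0 mulNr lerN2 -mulr_natr ler_pdivrMr; last by lra.
  rewrite /y (_ : _ * (s ^+ 2 * 2) = 9 * u ^+ 2); last by field.
  by have : 0 <= (3 * u - x) * (3 * u + x); [apply: mulr_ge0; lra|lra].
apply: (@le_trans _ _ (\int[lebesgue_measure]_(x in `](2 * u)%R, (2 * u + t)%R]%classic) (cst m%:E) x)%E).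
  rewrite integral_cst//= lebesgue_measure_itv/= lte_fin ltrDl t0 -EFinD -EFinM lee_fin.
  have -> : 2 * u + t - 2 * u = t by ring.
  have -> : m * t = (Num.sqrt (pi *+ 2))^-1 * expR (- (9 / 2 * y)).
    rewrite /m /normal_peak -mulrnAr sqrtrM ?sqr_ge0// sqrtr_sqr -/t invfM mulrAC.
    by congr (_ * _); rewrite mulrAC mulVf ?gt_eqF// mul1r.
  set q := Num.sqrt _.
  have q0 : 0 < q by rewrite sqrtr_gt0 mulrn_wgt0// pi_gt0.
  have q5 : q <= 5.
    rewrite -(ler_pXn2r (ltn0Sn 1)) ?nnegrE ?(ltW q0)// sqr_sqrtr.
      by have := pihalf_lt2 R; rewrite -mulr_natr; lra.
    by apply: mulrn_wge0; exact: pi_ge0.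
  have -> : 6 * (s ^+ 2)^-1 * u ^+ 2 = 6 * y by rewrite /y; field.
  have -> : - (9 / 2 * y) = - (6 * y) + 3 / 2 * y by field.
  rewrite expRD [leLHS]mulrC [leRHS]mulrCA ler_wpM2l ?expR_ge0// ler_pdivlMl//.
  by have := expR_ge1Dx (3 / 2 * y); lra.
have mpdf (A : set R) : measurable_fun A (fun x => (normal_pdf 0 s x)%:E).
  by apply/measurable_EFinP; apply: measurable_funTS; exact: measurable_normal_pdf.
apply: (@le_trans _ _ (\int[lebesgue_measure]_(x in `](2 * u)%R, (2 * u + t)%R]%classic)
    (normal_pdf 0 s x)%:E)%E).
  apply: ge0_le_integral => //=; exact: mpdf.
apply: ge0_subset_integral => //.
- exact: mpdf.
- by move=> x _; rewrite lee_fin normal_pdf_ge0.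
- by move=> x /=; rewrite !in_itv/= andbT => /andP[].
Qed.

End TailBounds.

Lemma increment_le_UTV {R : realType} (f : R -> R) (c S : R) : 0 < S ->
  ((f S - f 0 - c)%:E <= UTV c f 0 S)%E.
Proof.
move=> S0; apply: (@le_trans _ _ (\sum_(i < 1) Num.max (f S - f 0 - c) 0)%:E).
  by rewrite lee_fin big_ord1 le_max lexx.
apply: ereal_sup_ubound; exists 0%N, (fun=> 0), (fun=> S); split => //.
Qed.

(** * Lower estimates for the mean and the tail *)

Section Optimality.
Context {R : realType} {d : measure_display} {T : measurableType d}.
Variables (P : probability T R) (H S c : R) (W : R -> T -> R).
Hypotheses (fBm : is_fBm P H W) (H2 : 2^-1 <= H) (S0 : 0 < S).
Hypothesis cS : 0 < c <= S `^ H.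

Let SH0 : 0 < S `^ H. Proof. exact: powR_gt0. Qed.

Let sqrSH : (S `^ H) ^+ 2 = S `^ (2 * H).
Proof. by rewrite mulrC powRrM powR_mulrn// ltW. Qed.

Lemma increment_upper_tail u : S `^ H <= u ->
  measurable [set w | 2 * u < W S w - W 0 w] /\
  ((2^-1 * expR (- (6 * S `^ (- (2 * H)) * u ^+ 2)))%:E <=
   P [set w | (2 * u < W S w - W 0 w)%R])%E.
Proof.
move=> Su; have u0 : 0 < u by exact: lt_le_trans Su.
have Dspan : in_span W (fun w => W S w - W 0 w).
  by apply: in_spanB; apply: in_spanW; [exact: ltW|].
have p0 : 2 * H != 0 by rewrite mulf_neq0// gt_eqF// (lt_le_trans _ H2) ?invr_gt0.
have varD : \int[P]_w ((W S w - W 0 w) ^+ 2) = S `^ (2 * H).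
  rewrite -cov_diag (cov_incr fBm)// ?ltW// !subr0 subrr normr0 powR0// sub0r normrN.
  by rewrite gtr0_norm//; field.
have [_ _ [s]] := centered_gaussian_rv (in_span_gaussian fBm Dspan) (in_span_centered fBm Dspan).
rewrite varD => sE lawD.
have s0 : s != 0 by rewrite -sqrf_eq0 sE gt_eqF// powR_gt0.
have AE : [set w | 2 * u < W S w - W 0 w] =
    (fun w => W S w - W 0 w) @^-1` `]2 * u, +oo[%classic.
  by apply/seteqP; split=> w /=; rewrite in_itv/= andbT.
split.
  rewrite AE -[_ @^-1` _]setTI; apply: (in_span_measurable fBm Dspan) => //.
have := lawD `]2 * u, +oo[%classic (measurable_itv _); rewrite -AE (negbTE s0) => ->.
rewrite powRN -sE; apply: normal_prob_upper_tail => //.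
by rewrite sE -sqrSH ler_sqr// nnegrE ltW.
Qed.

Variables (V : T -> R) (N : set T) (E : R).
Hypothesis UV : envelope P (fun w => UTV c (W ^~ w) 0 S) V N.
Hypothesis EV : (\int[P]_w (V w)%:E = E%:E)%E.

(** Where the increment of W over [0, S] exceeds 2 S^H, the truncated variation exceeds 2 S^H - c >=
    S^H almost surely. The tail bound at u = S^H gives this event probability at least exp(-6) /
    2. *)
Lemma mean_UTV_ge : S `^ H <= 2 * expR 6 * E.
Proof.
have [mN PN mV h] := UV; have [mA PA] := increment_upper_tail (lexx _).
set A := [set w | _] in mA PA.
have : (\int[P]_w ((S `^ H)%:E * (\1_A w)%:E) <= \int[P]_w (V w)%:E)%E.
  apply: ae_ge0_le_integral => //.
  - by move=> w _; rewrite -EFinM lee_fin mulr_ge0// ltW.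
  - apply/measurable_EFinP; apply: measurable_funM => //; exact: measurable_indic.
  - by move=> w _; rewrite lee_fin; have [] := h w.
  - exact/measurable_EFinP.
  exists N; split=> // w /= /not_implyP[_ nle]; apply: contrapT => nN; apply: nle.
  rewrite -EFinM lee_fin indicE; have [wA|_] := boolP (w \in A); last first.
    by rewrite mulr0; have [] := h w.
  have [_ _ /(_ nN) UE] := h w.
  have := increment_le_UTV (W ^~ w) c S0; rewrite UE lee_fin mulr1.
  by move: wA; rewrite inE /A/=; case/andP: cS; lra.
rewrite EV ge0_integralZl//; last 2 first.
- by apply/measurable_EFinP; exact: measurable_indic.
- by rewrite lee_fin ltW.
rewrite integral_indic// setIT => SE.
have : ((S `^ H)%:E * (2^-1 * expR (- 6))%:E <= E%:E)%E.
  apply: le_trans SE; apply: lee_wpmul2l; first by rewrite lee_fin ltW.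
  move: PA; rewrite sqrSH powRN -mulrA mulVf ?mulr1//.
  by rewrite gt_eqF// powR_gt0.
rewrite -EFinM lee_fin expRN => SE'.
have e0 := expR_gt0 (6 : R).
rewrite (_ : S `^ H = 2 * expR 6 * (S `^ H * (2^-1 * (expR 6)^-1))).
  by rewrite ler_pM2l// mulr_gt0.
by field; rewrite gt_eqF.
Qed.

(** If the increment exceeds 2 u, then U - E > 2 u - c - E >= u; this is the reason for the
    threshold 2 u. *)
Lemma UTV_lower_tail u : E + c <= u -> S `^ H <= u ->
  ((2^-1 * expR (- (6 * S `^ (- (2 * H)) * u ^+ 2)))%:E <=
   prob P [set w | u%:E < `|UTV c (W ^~ w) 0 S - E%:E|])%E.
Proof.
move=> Ecu Su; have [mA] := increment_upper_tail Su; move=> /le_trans; apply.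
rewrite -measurable_mu_extE//; apply: le_mu_ext => w /= wA.
apply: (@lt_le_trans _ _ (W S w - W 0 w - c - E)%:E); first by rewrite lte_fin; lra.
apply: le_trans (lee_abs _); rewrite EFinD leeD2r//.
exact: increment_le_UTV.
Qed.

End Optimality.

(** Off [N] the event is the union of the two one-sided tails of [V], each controlled by Chernoff's
    bound. Together with [N] they form a measurable set covering the event, which bounds the outer
    measure. *)
Lemma envelope_deviation {R : realType} {d : measure_display} {T : measurableType d}
    (P : probability T R) (U : T -> \bar R) (V : T -> R) (N : set T) (E k u : R) :
  envelope P U V N -> 0 < k -> 0 < u ->
  (forall l, 0 <= l ->
    \int[P]_w expR (l * (V w - E)) <= expR (l ^+ 2 * k) /\
    \int[P]_w expR (l * (E - V w)) <= expR (l ^+ 2 * k) /\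
    P.-integrable [set: T] (EFin \o (fun w => expR (l * (V w - E)))) /\
    P.-integrable [set: T] (EFin \o (fun w => expR (l * (E - V w))))) ->
  (prob P [set w | u%:E < `|U w - E%:E|] <= (2 * expR (- (u ^+ 2 / (4 * k))))%:E)%E.
Proof.
move=> [mN PN mV h] k0 u0 hE.
have mV1 : measurable_fun [set: T] (fun w => V w - E) by exact: measurable_funB.
have mV2 : measurable_fun [set: T] (fun w => E - V w) by exact: measurable_funB.
have mA (f : T -> R) : measurable_fun [set: T] f -> measurable [set w | u < f w].
  move=> mf; have -> : [set w | u < f w] = [set: T] `&` f @^-1` `]u, +oo[.
    by rewrite setTI; apply/seteqP; split=> w; rewrite /= in_itv/= andbT.
  exact: mf.
have PA1 := @chernoff _ _ _ P _ k u k0 u0 mV1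
  (fun l l0 => (hE l l0).2.2.1) (fun l l0 => (hE l l0).1).
have PA2 := @chernoff _ _ _ P _ k u k0 u0 mV2
  (fun l l0 => (hE l l0).2.2.2) (fun l l0 => (hE l l0).2.1).
set A1 := [set w | _] in PA1; set A2 := [set w | _] in PA2.
have mA1 : measurable A1 by exact: mA.
have mA2 : measurable A2 by exact: mA.
apply: (@le_trans _ _ (P (A1 `|` (A2 `|` N)))).
  rewrite -measurable_mu_extE; last by apply: measurableU => //; exact: measurableU.
  apply: le_mu_ext => w /=; have [wN|nN] := pselect (N w); first by right; right.
  have [_ _ ->//] := h w; rewrite -EFinB abse_EFin lte_fin.
  have [VE|VE] := leP E (V w).
    by rewrite ger0_norm ?subr_ge0//; left.
  by rewrite distrC ger0_norm ?subr_ge0 ?(ltW VE)//; right; left.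
apply: le_trans (measureU2 _ _ _) _ => //; first exact: measurableU.
rewrite mulr_natl mulr2n EFinD; apply: leeD => //.
by apply: le_trans (measureU2 _ _ _) _ => //; rewrite [X in (_ + X)%E]PN adde0.
Qed.

Theorem mainTheorem7 (R : realType) :
  exists C A B T : R,
    [/\ 0 < C, 0 < A <= 2, 2 / pi ^+ 2 <= B & 0 < T] /\
    forall (d : measure_display) (Omega : measurableType d)
      (P : probability Omega R) (H S c : R) (W : R -> Omega -> R),
      is_fBm P H W -> 0 < S -> 2^-1 <= H < 1 -> 0 < c <= S `^ H ->
      let U : Omega -> \bar R := fun w => UTV c (fun t => W t w) 0 S in
      let EU : \bar R := (\int[P]_w U w)%E in
      let M : \bar R := maxe (EU + c%:E)%E (S `^ H)%:E in
      [/\ sim_with C M EU,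
          forall u : R, 0 < u ->
            (prob P [set w | u%:E < `|U w - EU|] <=
             (A * expR (- (B * S `^ (- (2 * H)) * u ^+ 2)))%:E)%E
        & forall u : R, (M <= u%:E)%E ->
            ((2^-1 * expR (- (T * S `^ (- (2 * H)) * u ^+ 2)))%:E <=
             prob P [set w | u%:E < `|U w - EU|])%E].
Proof.
have e6 : 0 < expR 6 :> R by exact: expR_gt0.
have pi0 : 0 < pi :> R by exact: pi_gt0.
(* The first constant comes from E + c <= E + S^H and [mean_UTV_ge]. The second counts the two
   tails, the third is 1 / (4 k) for k = pi^2 / 8, in units of S^(2H), and the last is the rate in
   [normal_prob_upper_tail]. *)
exists (1 + 2 * expR 6), 2, (2 / pi ^+ 2), 6; split.
  by split=> //; lra.
move=> d Omega P H S c W fBm S0 /andP[H2 _] cS U EU M.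
have /andP[c0 _] := cS.
have [V [N [E [UV EV hE]]]] := UTV_concentration fBm H2 S0 c0.
have EUE : EU = E%:E by rewrite -EV; exact: integral_envelope UV.
have S20 : 0 < S `^ (2 * H) by exact: powR_gt0.
have SH0 : 0 < S `^ H by exact: powR_gt0.
have SE := mean_UTV_ge fBm H2 S0 cS UV EV.
have e26 : 0 < 2 * expR 6 :> R by exact: mulr_gt0.
have E0 : 0 < E by rewrite -(pmulr_rgt0 _ e26); exact: lt_le_trans SH0 SE.
have ME : M = (Num.max (E + c) (S `^ H))%:E by rewrite /M EUE -EFinD EFin_max.
rewrite ME EUE; set m := Num.max _ _.
have Em : E <= m by rewrite /m le_max lerDl ltW.
have mE : m <= (1 + 2 * expR 6) * E.
  case/andP: cS => _ cS; rewrite mulrDl mul1r /m ge_max; apply/andP; split; lra.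
split.
- split=> //; rewrite ?lte_fin//; first exact: lt_le_trans Em.
  rewrite -!EFinM !lee_fin ler_pdivrMl ?mE/=; last by lra.
  rewrite mulrDl mul1r (le_trans Em)// lerDl; apply: mulr_ge0; [exact: ltW|lra].
- move=> u u0.
  have k0 : 0 < pi ^+ 2 * S `^ (2 * H) / 8 by rewrite divr_gt0// mulr_gt0// exprn_gt0.
  apply: le_trans (envelope_deviation UV k0 u0 hE) _.
  rewrite lee_fin ler_wpM2l// ler_expR powRN le_eqVlt; apply/orP; left; apply/eqP.
  have := lt0r_neq0 S20; have := lt0r_neq0 pi0.
  by move: (S `^ _) (pi : R) => x y y0 x0; field; rewrite x0 y0.
- move=> u; rewrite lee_fin ge_max => /andP[Ecu Su].
  exact: (UTV_lower_tail fBm H2 S0).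
Qed.
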